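(* Let $\mathbb K$ be an algebraically closed field of characteristic $p\neq2$, $p>0$. Let $\mathfrak g=\mathfrak{psl}(2|2)=\mathfrak g(A)^{(1)}/\mathfrak c$, where $$A=\begin{pmatrix}2&-1&0\\-1&0&1\\0&-1&2\end{pmatrix},$$ $x_2,y_2$ are odd, $x_1,y_1,x_3,y_3$ are even, and $\mathfrak c$ is the center; let $x_4=[x_1,x_2]$, $x_5=[x_2,x_3]$, $x_6=[x_3,[x_1,x_2]]$ and let $y_4,y_5,y_6$ be given by the same expressions in the $y_i$. (a1) For a basis of $H^1(\mathfrak g;\mathfrak g)$ one can take the classes of the three derivations $D_{-4}$, $D_0$ and $\theta D_{-4}\theta^{-1}$, where $$D_{-4}:\ x_2\mapsto y_6,\ x_4\mapsto -y_5,\ x_5\mapsto -y_4,\ x_6\mapsto y_2;$$ $$D_0:\ x_2\mapsto x_2,\ x_3\mapsto -x_3,\ x_4\mapsto x_4,\ y_2\mapsto -y_2,\ y_3\mapsto y_3,\ y_4\mapsto -y_4$$ (all root vectors not mentioned and all elements of the torus are sent to $0$), and $\theta$ is the automorphism with $x_i\mapsto y_i$, $y_i\mapsto(-1)^{p(x_i)}x_i$ for $i=1,2,3$. So the Lie superalgebra of all derivations of $\mathfrak g$ is $$\mathfrak{der}\,\mathfrak g\simeq\mathfrak{osp}_{-1}(4|2).$$ (a2) For a basis of $H^2(\mathfrak g)$ one can take the classes of $$\widehat x_2\wedge\widehat y_2+\widehat x_3\wedge\widehat y_3-\widehat x_4\wedge\widehat y_4,\qquad \widehat y_2\wedge\widehat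 y_6+\widehat y_4\wedge\widehat y_5,\qquad \widehat x_2\wedge\widehat x_6+\widehat x_4\wedge\widehat x_5 ;$$ the central extension of $\mathfrak g$ (by all three cocycles) is $\mathfrak{osp}_0(4|2)$.
   Context: $\mathfrak g(A)$ for an $n\times n$ matrix $A$ and parities $p_1,\dots,p_n$: let $\mathfrak h$ be an even space of dimension $2n-\operatorname{rk}A$ with linearly independent $h_1,\dots,h_n\in\mathfrak h$ and linearly independent $\alpha_1,\dots,\alpha_n\in\mathfrak h^*$, $\alpha_j(h_i)=A_{ij}$; take the Lie superalgebra generated by $\mathfrak h$ and $x_i,y_i$ of parity $p_i$ with relations $[\mathfrak h,\mathfrak h]=0$, $[h,x_j]=\alpha_j(h)x_j$, $[h,y_j]=-\alpha_j(h)y_j$, $[x_i,y_j]=\delta_{ij}h_i$, and factor out the largest ideal graded with respect to $\deg x_i=e_i=-\deg y_i$ that intersects $\mathfrak h$ trivially. $\mathfrak g^{(1)}$ is the derived algebra. Here $\mathfrak g(A)\simeq\mathfrak{gl}(2|2)$. $\mathfrak{osp}_a(4|2)$ is the one-parameter family of deformations of $\mathfrak{osp}(4|2)=\mathfrak{osp}_1(4|2)$ with Cartan matrix $\begin{pmatrix}2&-1&0\\-1&0&-a\\0&-1&2\end{pmatrix}$ (second generators odd), simple for $a\neq0,-1$. Its two degenerate members fit into exact sequences $$0\to\mathfrak{psl}(2|2)\to\mathfrak{osp}_{-1}(4|2)\to\mathfrak{sl}(2)\to0,\qquad 0\to\mathfrak{sl}(2)\to\mathfrak{osp}_0(4|2)\to\mathfrak{psl}(2|2)\to0,$$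 where in the second sequence $\mathfrak{sl}(2)$ stands for the $3$-dimensional space of the central extensions. Explicitly: let $V_1,V_2,V_3$ be $2$-dimensional spaces with symplectic forms $\omega_i$ and $\psi_i(x,y)z=\omega_i(y,z)x+\omega_i(x,z)y$. $\mathfrak{osp}_{-1}(4|2)$ has even part $\mathfrak{sl}(V_1)\oplus\mathfrak{sl}(V_2)\oplus\mathfrak{sl}(V_3)$ and odd part $V_1\otimes V_2\otimes V_3$ with the natural action and $[v_1\otimes v_2\otimes v_3,w_1\otimes w_2\otimes w_3]=\omega_2(v_2,w_2)\omega_3(v_3,w_3)\psi_1(v_1,w_1)-\omega_1(v_1,w_1)\omega_3(v_3,w_3)\psi_2(v_2,w_2)$. $\mathfrak{osp}_0(4|2)$ is the same superspace in which the elements of the third summand $\mathfrak{sl}(V_3)$ are made central and the term $\omega_1(v_1,w_1)\omega_2(v_2,w_2)\psi_3(v_3,w_3)$ is added to the bracket of odd elements. $H^1(\mathfrak g;\mathfrak g)$ is the superspace of all (even and odd) derivations modulo inner ones. $H^2(\mathfrak g)$ (trivial coefficients, both parities): bilinear forms $\omega$ with $\omega(x,y)=-(-1)^{p(x)p(y)}\omega(y,x)$, $\omega([x,y],z)=\omega(x,[y,z])-(-1)^{p(x)p(y)}\omega(y,[x,z])$ and, for $p=3$, $\omega(x,[x,x])=0$ for odd $x$, modulo the forms $f([x,y])$. For distinct root vectors $u,v$ of the basis, $\widehat u\wedge\widehat v$ is the super-antisymmetric form with value $1$ on $(u,v)$ and zero on all pairs of basis elements other than $(u,v)$, $(v,u)$.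 *)

(* Defs.v *)
From HB Require Import structures.
From mathcomp Require Import all_boot all_order all_algebra ring.
From mathcomp Require Import boolp classical_sets functions.

Set Implicit Arguments.
Unset Strict Implicit.
Unset Printing Implicit Defensive.

Import GRing.Theory.
Local Open Scope classical_set_scope.
Local Open Scope ring_scope.

Reserved Notation "{[ x , y ]}" (at level 0, format "{[ x ,  y ]}").

(* Parities are booleans, [true] being odd; [spart b x] is the component of   *)
(* parity [b] of [x].  No identity is imposed on the product here.            *)
HB.mixin Record isSuperalgebra (K : fieldType) V of GRing.Lmodule K V := {
  spart : bool -> V -> V;
  sbr : V -> V -> V;
  spart_linear : forall b, linear (spart b);
  spartK : forall b c x, spart b (spart c x) = if b == c then spart b x else 0;
  spartD : forall x, spart false x + spart true x = x;
  sbr_linearl : forall y, linear (sbr^~ y);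
  sbr_linearr : forall x, linear (sbr x)
}.

#[short(type="superalgType")]
HB.structure Definition Superalgebra (K : fieldType) :=
  { V of isSuperalgebra K V & GRing.Lmodule K V }.

Notation "{[ x , y ]}" := (sbr x y) : ring_scope.

Definition homog (K : fieldType) (L : superalgType K) (b : bool) (x : L) :=
  spart b x = x.

(* Lie superalgebras in characteristic different from 2.  The last axiom      *)
(* follows from the Jacobi identity except in characteristic 3.               *)
HB.mixin Record isLieSuperalgebra (K : fieldType) L of Superalgebra K L := {
  sbr_graded : forall (b c : bool) (x y : L), homog b x -> homog c y ->
    homog (b (+) c) {[ x, y ]};
  sbr_skew : forall (b c : bool) (x y : L), homog b x -> homog c y ->
    {[ x, y ]} = - ((-1 : K) ^+ (b && c) *: {[ y, x ]});
  sbr_jacobi : forall (b c : bool) (x y z : L), homog b x -> homog c y ->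
    {[ x, {[ y, z ]} ]} =
      {[ {[ x, y ]}, z ]} + (-1 : K) ^+ (b && c) *: {[ y, {[ x, z ]} ]};
  sbr_odd_cube : forall x : L, homog true x -> {[ x, {[ x, x ]} ]} = 0
}.

#[short(type="lieSuperType")]
HB.structure Definition LieSuperalgebra (K : fieldType) :=
  { L of isLieSuperalgebra K L & Superalgebra K L }.

Definition superhom (K : fieldType) (L M : superalgType K)
    (f : {linear L -> M}) : Prop :=
  (forall b x, f (spart b x) = spart b (f x)) /\
  (forall x y, f {[ x, y ]} = {[ f x, f y ]}).

Definition superiso (K : fieldType) (L M : superalgType K) : Prop :=
  exists f : {linear L -> M}, superhom f /\ bijective f.

Section Ideals.
Variables (K : fieldType) (L : lieSuperType K).

Definition ideal (I : set L) : Prop :=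
  [/\ I 0, forall (c : K) u v, I u -> I v -> I (c *: u + v),
      forall u v, I v -> I {[ u, v ]} & forall u v, I u -> I {[ u, v ]}].

Definition derived : set L :=
  [set u | exists s : seq (L * L), u = \sum_(q <- s) {[ q.1, q.2 ]}].

Definition center_of (S : set L) : set L :=
  [set z | S z /\ forall u, S u -> {[ z, u ]} = 0].

End Ideals.

(* [pi] identifies [S / I] with [g], for a graded subalgebra [S] of [L] and   *)
(* an ideal [I] of [S]; the values of [pi] outside [S] are irrelevant.        *)
Definition quotient_map (K : fieldType) (L g : lieSuperType K) (S I : set L)
    (pi : L -> g) : Prop :=
  [/\ (forall (c : K) u v, S u -> S v -> pi (c *: u + v) = c *: pi u + pi v),
      (forall b u, S u -> pi (spart b u) = spart b (pi u)),
      (forall u v, S u -> S v -> pi {[ u, v ]} = {[ pi u, pi v ]}),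
      (forall w, exists2 u, S u & pi u = w) &
      (forall u, S u -> (pi u = 0 <-> I u))].

(* [pi] identifies [g] with the quotient of the derived algebra of [L] by its *)
(* center.                                                                    *)
Definition derived_mod_center (K : fieldType) (L g : lieSuperType K)
    (pi : L -> g) : Prop :=
  quotient_map (derived (L := L)) (center_of (derived (L := L))) pi.

(* The space h with the h_i and the alpha_j. *)
Record realization (K : fieldType) (n : nat) (A : 'M[K]_n) := Realization {
  cartan : vectType K;
  coroot : 'I_n -> cartan;
  simple_root : 'I_n -> 'Hom(cartan, K^o);
  cartan_dim : \dim {: cartan} = (2 * n - \rank A)%N;
  coroot_free : free (codom coroot);
  simple_root_free : free (codom simple_root);
  simple_rootE : forall i j, simple_root j (coroot i) = A i j
}.

(* A copy of h (not assumed to be embedded) and of the x_i, y_i in [L]. *)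
Record generators (K : fieldType) (n : nat) (A : 'M[K]_n) (R : realization A)
    (L : lieSuperType K) := Generators {
  gen_h : {linear cartan R -> L};
  gen_x : 'I_n -> L;
  gen_y : 'I_n -> L
}.

Section Contragredient.
Variables (K : fieldType) (n : nat) (A : 'M[K]_n) (R : realization A).
Variable par : 'I_n -> bool.

Definition chevalley_relations (L : lieSuperType K) (s : generators R L) :=
  [/\ [/\ forall v, homog false (gen_h s v),
          forall i, homog (par i) (gen_x s i) &
          forall i, homog (par i) (gen_y s i)],
      forall u v, {[ gen_h s u, gen_h s v ]} = 0,
      forall v j, {[ gen_h s v, gen_x s j ]} = (simple_root R j v : K) *: gen_x s j,
      forall v j,
        {[ gen_h s v, gen_y s j ]} = - ((simple_root R j v : K) *: gen_y s j) &
      forall i j, {[ gen_x s i, gen_y s j ]} =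
        if i == j then gen_h s (coroot R i) else 0].

Definition carries (L M : lieSuperType K) (f : {linear L -> M})
    (s : generators R L) (t : generators R M) : Prop :=
  [/\ superhom f, forall v, f (gen_h s v) = gen_h t v,
      forall i, f (gen_x s i) = gen_x t i &
      forall i, f (gen_y s i) = gen_y t i].

(* The universal property of the Lie superalgebra generated by h and the      *)
(* x_i, y_i subject to the Chevalley relations.                               *)
Definition presented (L : lieSuperType K) (s : generators R L) : Prop :=
  chevalley_relations s /\
  forall (M : lieSuperType K) (t : generators R M), chevalley_relations t ->
    exists f : {linear L -> M}, carries f s t /\
      forall f' : {linear L -> M}, carries f' s t -> f' =1 f.

(* The homogeneous elements for the grading deg x_i = e_i = - deg y_i. *)
Inductive root_homog (L : lieSuperType K) (s : generators R L) :
    'rV[int]_n -> L -> Prop :=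
| RootHomog0 d : root_homog s d 0
| RootHomogH v : root_homog s 0 (gen_h s v)
| RootHomogX i : root_homog s (delta_mx 0 i) (gen_x s i)
| RootHomogY i : root_homog s (- delta_mx 0 i) (gen_y s i)
| RootHomogD d (c : K) u v of root_homog s d u & root_homog s d v :
    root_homog s d (c *: u + v)
| RootHomogBr d e u v of root_homog s d u & root_homog s e v :
    root_homog s (d + e) {[ u, v ]}.

Definition root_graded (L : lieSuperType K) (s : generators R L) (I : set L) :=
  forall u, I u -> exists r : seq L, u = \sum_(v <- r) v /\
    forall v, v \in r -> I v /\ exists d, root_homog s d v.

Definition small_ideal (L : lieSuperType K) (s : generators R L) (I : set L) :=
  [/\ ideal I, root_graded s I & forall v, I (gen_h s v) -> gen_h s v = 0].

(* [G] with the generators [s] is g(A) with parities [par]. *)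
Definition contragredient (G : lieSuperType K) (s : generators R G) : Prop :=
  exists (L : lieSuperType K) (t : generators R L) (q : {linear L -> G}),
    [/\ presented t, carries q t s, forall w, exists u, q u = w,
        small_ideal t [set u | q u = 0] &
        forall I, small_ideal t I -> I `<=` [set u | q u = 0]].

End Contragredient.

(* The classes of [e] form a basis of [Z / B]. *)
Definition basis_mod (K : fieldType) (V : lmodType K) (Z B : set V) (n : nat)
    (e : n.-tuple V) : Prop :=
  [/\ forall i, Z (tnth e i),
      forall z, Z z -> exists (c : 'I_n -> K) (b : V),
        B b /\ z = \sum_i c i *: tnth e i + b &
      forall c : 'I_n -> K, B (\sum_i c i *: tnth e i) -> forall i, c i = 0].

Section Derivations.
Variables (K : fieldType) (g : superalgType K).

Definition superder (b : bool) (D : g -> g) : Prop :=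
  [/\ linear D, forall c x, homog c x -> homog (b (+) c) (D x) &
      forall c x y, homog c x ->
        D {[ x, y ]} = {[ D x, y ]} + (-1 : K) ^+ (b && c) *: {[ x, D y ]}].

Definition is_der (D : g -> g) : Prop :=
  exists D0 D1 : g -> g, [/\ superder false D0, superder true D1 & D = D0 + D1].

Definition is_inner (D : g -> g) : Prop := exists a : g, D = sbr a.

Definition fpart (b : bool) (D : g -> g) : g -> g :=
  fun x => \sum_(c : bool) spart (b (+) c) (D (spart c x)).

(* The supercommutator. *)
Definition scomm (D E : g -> g) : g -> g := fun x =>
  \sum_(b : bool) \sum_(c : bool)
    (fpart b D (fpart c E x) - (-1 : K) ^+ (b && c) *: fpart c E (fpart b D x)).

End Derivations.

(* The forms below may be even, odd or mixed: no sign depends on their parity. *)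
Definition form_skew (K : fieldType) (g : superalgType K)
    (w : g -> g -> K^o) : Prop :=
  forall (b c : bool) (x y : g), homog b x -> homog c y ->
    w x y = - ((-1) ^+ (b && c) * w y x).

Definition is_cocycle (K : fieldType) (g : superalgType K)
    (w : g -> g -> K^o) : Prop :=
  [/\ (forall y, linear (w^~ y)) /\ (forall x, linear (w x)),
      form_skew w,
      forall (b c : bool) (x y z : g), homog b x -> homog c y ->
        w {[ x, y ]} z =
          w x {[ y, z ]} - (-1) ^+ (b && c) * w y {[ x, z ]} &
      3%N \in [pchar K] -> forall x, homog true x -> w x {[ x, x ]} = 0].

Definition is_coboundary (K : fieldType) (g : superalgType K)
    (w : g -> g -> K^o) : Prop :=
  exists f : {linear g -> K^o}, w = (fun x y => f {[ x, y ]}).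

(* [D] is given on the elements of [B] by the table [l], and is 0 on those    *)
(* which the table does not mention.                                          *)
Definition given_by (K : fieldType) (g : superalgType K) (B : set g)
    (l : seq (g * g)) (D : g -> g) : Prop :=
  (forall q, q \in l -> D q.1 = q.2) /\
  (forall u, B u -> u \notin [seq q.1 | q <- l] -> D u = 0).

Definition is_wedge (K : fieldType) (g : superalgType K) (B : set g)
    (u v : g) (w : g -> g -> K^o) : Prop :=
  [/\ (forall y, linear (w^~ y)) /\ (forall x, linear (w x)),
      form_skew w, w u v = 1 &
      forall a b, B a -> B b -> (a, b) <> (u, v) -> (a, b) <> (v, u) ->
        w a b = 0].

Section DerivationAlgebra.
Variables (K : fieldType) (g : superalgType K).

HB.instance Definition _ (b : bool) :=
  GRing.isLinear.Build K g g *:%R (spart b) (@spart_linear K g b).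

Implicit Types (x y z : g) (D E : g -> g) (b c d : bool).

Lemma homog_spart b x : homog b (spart b x).
Proof. by rewrite /homog spartK eqxx. Qed.

Lemma spart_homog b c x : homog c x -> spart b x = if b == c then x else 0.
Proof. by move=> hx; rewrite -{1}hx spartK; case: eqP => // ->. Qed.

Lemma homog0 b : homog b (0 : g).
Proof. by rewrite /homog raddf0. Qed.

Lemma homogL b (k : K) x y : homog b x -> homog b y -> homog b (k *: x + y).
Proof. by rewrite /homog => hx hy; rewrite (spart_linear b k x y) hx hy. Qed.

Lemma sbrDl x y z : {[ x + y, z ]} = {[ x, z ]} + {[ y, z ]}.
Proof. by have := sbr_linearl z 1 x y; rewrite !scale1r. Qed.
Lemma sbrDr x y z : {[ z, x + y ]} = {[ z, x ]} + {[ z, y ]}.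
Proof. by have := sbr_linearr z 1 x y; rewrite !scale1r. Qed.
Lemma sbr0l z : {[ 0, z ]} = 0.
Proof. by apply: (addrI {[ 0 : g, z ]}); rewrite -sbrDl !addr0. Qed.
Lemma sbr0r z : {[ z, 0 ]} = 0.
Proof. by apply: (addrI {[ z, 0 : g ]}); rewrite -sbrDr !addr0. Qed.
Lemma sbrZl (k : K) x z : {[ k *: x, z ]} = k *: {[ x, z ]}.
Proof. by have := sbr_linearl z k x 0; rewrite sbr0l !addr0. Qed.
Lemma sbrZr (k : K) x z : {[ z, k *: x ]} = k *: {[ z, x ]}.
Proof. by have := sbr_linearr z k x 0; rewrite sbr0r !addr0. Qed.

Lemma fctL (k : K) D E x : (k *: D + E) x = k *: D x + E x.
Proof. by []. Qed.

Lemma superder0 b : superder b (0 : g -> g).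
Proof.
split=> [k x y|c x _|c x y _]; first by rewrite /= scaler0 addr0.
  exact: homog0.
by rewrite /= sbr0l sbr0r scaler0 addr0.
Qed.

Lemma superderL b (k : K) D E :
  superder b D -> superder b E -> superder b (k *: D + E).
Proof.
move=> [lD pD dD] [lE pE dE]; split=> [a x y|c x hx|c x y hx].
- rewrite !fctL lD lE !scalerDr !scalerA [k * a]mulrC.
  by rewrite -!addrA; congr (_ + _); rewrite addrCA.
- by rewrite fctL; apply: homogL; [apply: pD | apply: pE].
- rewrite !fctL (dD c) // (dE c) // sbrDl sbrZl sbrDr sbrZr !scalerDr !scalerA.
  by rewrite [k * _]mulrC -!addrA; congr (_ + _); rewrite addrCA.
Qed.

Lemma fpartP b (k : K) D E : fpart b (k *: D + E) = k *: fpart b D + fpart b E.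
Proof.
apply: funext => x; rewrite fctL /fpart scaler_sumr -big_split /=.
by apply: eq_bigr => c _; rewrite fctL spart_linear.
Qed.

Lemma sum_spart x : \sum_(c : bool) spart c x = x.
Proof. by rewrite big_bool /= addrC spartD. Qed.

Lemma fpart_superder b c D :
  superder b D -> fpart c D = if c == b then D else 0.
Proof.
move=> [lD pD _]; have D0 : D 0 = 0.
  by have := lD (-1) 0 0; rewrite scaler0 addr0 scaleN1r addNr.
have DD x y : D (x + y) = D x + D y.
  by have := lD 1 x y; rewrite !scale1r.
apply: funext => x; rewrite /fpart.
under eq_bigr => d _ do
  rewrite (spart_homog (c (+) d) (pD d _ (homog_spart d x))) (inj_eq (@addIb d)).
case: eqP => _; last by rewrite big1.
by rewrite big_bool /= -DD addrC spartD.
Qed.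

Lemma fpart_der b D : is_der D -> superder b (fpart b D).
Proof.
case=> D0 [D1 [h0 h1 ->]].
have -> : D0 + D1 = 1 *: D0 + D1 by rewrite scale1r.
rewrite fpartP scale1r.
rewrite (fpart_superder b h0) (fpart_superder b h1).
by case: b => /=; rewrite ?add0r ?addr0.
Qed.

Lemma superder_der b D : superder b D -> is_der D.
Proof.
case: b => hD.
  by exists 0, D; split=> //; [apply: superder0 | rewrite add0r].
by exists D, 0; split=> //; [apply: superder0 | rewrite addr0].
Qed.

Lemma is_derL (k : K) D E : is_der D -> is_der E -> is_der (k *: D + E).
Proof.
case=> D0 [D1 [h0 h1 ->]] [E0 [E1 [e0 e1 ->]]].
exists (k *: D0 + E0), (k *: D1 + E1); split; try exact: superderL.
by rewrite scalerDr -!addrA; congr (_ + _); rewrite addrCA.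
Qed.

Lemma is_der0 : is_der (0 : g -> g).
Proof. exact: superder_der (superder0 false). Qed.

Lemma is_derD D E : is_der D -> is_der E -> is_der (D + E).
Proof. by rewrite -{2}[D]scale1r; apply: is_derL. Qed.

Lemma fpartDE D : is_der D -> fpart false D + fpart true D = D.
Proof.
case=> D0 [D1 [h0 h1 ->]].
have -> : D0 + D1 = 1 *: D0 + D1 by rewrite scale1r.
rewrite !fpartP.
rewrite !(fpart_superder _ h0) !(fpart_superder _ h1) /=.
by rewrite !scale1r addr0 add0r.
Qed.

Lemma add_cancel (V : zmodType) (A A' X Y F F' : V) :
  (A + X + (Y + F)) - (A' + Y + (X + F')) = (A - A') + (F - F').
Proof.
rewrite [A' + Y + _]addrACA opprD addrACA !opprD.
by rewrite (addrACA A) (addrACA Y) !subrr addr0 add0r.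
Qed.

Lemma scomm_superder b c D E : superder b D -> superder c E ->
  superder (b (+) c)
    (fun x => D (E x) - (-1 : K) ^+ (b && c) *: E (D x)).
Proof.
move=> [lD pD dD] [lE pE dE].
have D0 : D 0 = 0.
  by have := lD (-1) 0 0; rewrite scaler0 addr0 scaleN1r addNr.
have E0 : E 0 = 0.
  by have := lE (-1) 0 0; rewrite scaler0 addr0 scaleN1r addNr.
have DD x y : D (x + y) = D x + D y by have := lD 1 x y; rewrite !scale1r.
have ED x y : E (x + y) = E x + E y by have := lE 1 x y; rewrite !scale1r.
have DZ (k : K) x : D (k *: x) = k *: D x.
  by have := lD k x 0; rewrite D0 !addr0.
have EZ (k : K) x : E (k *: x) = k *: E x.
  by have := lE k x 0; rewrite E0 !addr0.
split=> [k x y|d x hx|d x y hx].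
- rewrite lE lD lD lE !scalerDr opprD addrACA scalerN !scalerA.
  by rewrite [_ * k]mulrC.
- rewrite addrC -scaleNr; apply: homogL.
    by have := pE _ _ (pD _ _ hx); rewrite addbA [c (+) b]addbC.
  by have := pD _ _ (pE _ _ hx); rewrite addbA.
- rewrite (dE d) // (dD d) // DD ED DZ EZ.
  rewrite (dD _ _ _ (pE _ _ hx)) (dD d) // (dE _ _ _ (pD _ _ hx)) (dE d) //.
  rewrite !scalerDr -!scaleNr sbrDl sbrDr !sbrZl !sbrZr !scaleNr -!scalerN.
  rewrite !scalerDr !scalerA !scalerN -!signr_addb.
  have -> : b && c (+) c && (b (+) d) = c && d by case: b c d {pD dD pE dE hx} => [] [] [].
  have -> : b && c (+) b && d = b && (c (+) d) by case: b c d {pD dD pE dE hx} => [] [] [].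
  rewrite add_cancel; congr (_ + (_ *: _ - _ *: _)); congr (_ ^+ (nat_of_bool _)).
    by case: b c d {pD dD pE dE hx} => [] [] [].
  by case: b c d {pD dD pE dE hx} => [] [] [].
Qed.

Lemma scommE D E : scomm D E = \sum_(b : bool) \sum_(c : bool)
  (fun x => fpart b D (fpart c E x)
            - (-1 : K) ^+ (b && c) *: fpart c E (fpart b D x)).
Proof.
by apply: funext => x; rewrite /scomm !big_bool /=.
Qed.

Lemma scomm_der D E : is_der D -> is_der E -> is_der (scomm D E).
Proof.
move=> hD hE; rewrite scommE.
apply: big_ind => [||b _]; [exact: is_der0 | exact: is_derD |].
apply: big_ind => [||c _]; [exact: is_der0 | exact: is_derD |].
by apply: superder_der; apply: scomm_superder; apply: fpart_der.
Qed.

Lemma fpart_linear b D : is_der D -> linear (fpart b D).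
Proof. by move=> hD; case: (fpart_der b hD). Qed.

Lemma scomm_linearl E : is_der E -> forall (k : K) D D',
  scomm (k *: D + D') E = k *: scomm D E + scomm D' E.
Proof.
move=> hE k D D'; apply: funext => x; rewrite fctL /scomm scaler_sumr -big_split.
apply: eq_bigr => b _ /=; rewrite scaler_sumr -big_split.
apply: eq_bigr => c _ /=; rewrite !fpartP !fctL fpart_linear // !scalerDr !scalerN.
by rewrite !scalerA [_ * k]mulrC opprD addrACA.
Qed.

Lemma scomm_linearr D : is_der D -> forall (k : K) E E',
  scomm D (k *: E + E') = k *: scomm D E + scomm D E'.
Proof.
move=> hD k E E'; apply: funext => x; rewrite fctL /scomm scaler_sumr -big_split.
apply: eq_bigr => b _ /=; rewrite scaler_sumr -big_split.
apply: eq_bigr => c _ /=; rewrite !fpartP !fctL fpart_linear // !scalerDr !scalerN.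
by rewrite !scalerA [_ * k]mulrC opprD addrACA.
Qed.

Definition der_pred : {pred g -> g} := fun D => `[< is_der D >].

Lemma der_submod_closed : submod_closed der_pred.
Proof.
split=> [|k D E]; first exact/asboolP/is_der0.
by move=> /asboolP hD /asboolP hE; apply/asboolP/is_derL.
Qed.

HB.instance Definition _ :=
  GRing.isSubmodClosed.Build K (g -> g) der_pred der_submod_closed.

End DerivationAlgebra.

Record der (K : fieldType) (g : superalgType K) :=
  Der { der_val :> g -> g; der_valP : der_val \in der_pred (g := g) }.

HB.instance Definition _ (K : fieldType) (g : superalgType K) :=
  [isSub for @der_val K g].
HB.instance Definition _ (K : fieldType) (g : superalgType K) :=
  [Choice of der g by <:].
HB.instance Definition _ (K : fieldType) (g : superalgType K) :=
  [SubChoice_isSubLmodule of der g by <:].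

Section DerSuperalgebra.
Variables (K : fieldType) (g : superalgType K).
Implicit Types D E : der g.

Lemma derP D : is_der (der_val D).
Proof. by case: D => D /= /asboolP. Qed.

Definition der_spart (b : bool) D : der g :=
  Der (asboolT (superder_der (fpart_der b (derP D)))).
Definition der_br D E : der g := Der (asboolT (scomm_der (derP D) (derP E))).

Fact der_spart_linear b : linear (der_spart b).
Proof. by move=> k D E; apply: val_inj; rewrite /= fpartP. Qed.

Fact der_spartK b c D :
  der_spart b (der_spart c D) = if b == c then der_spart b D else 0.
Proof.
apply: val_inj; rewrite /= (fpart_superder b (fpart_der c (derP D))).
by case: eqP => // ->.
Qed.

Fact der_spartD D : der_spart false D + der_spart true D = D.
Proof. by apply: val_inj; rewrite /= fpartDE //; apply: derP. Qed.

Fact der_br_linearl E : linear (der_br^~ E).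
Proof. by move=> k D D'; apply: val_inj; apply: scomm_linearl (derP E) _ _ _. Qed.

Fact der_br_linearr D : linear (der_br D).
Proof. by move=> k E E'; apply: val_inj; apply: scomm_linearr (derP D) _ _ _. Qed.

HB.instance Definition _ := isSuperalgebra.Build K (der g) der_spart_linear
  der_spartK der_spartD der_br_linearl der_br_linearr.

End DerSuperalgebra.

(* The central extension of [g] by the cocycles in [w]; it is used for    *)
(* even cocycles, so the added center is even.                                *)
Definition centext (K : fieldType) (g : superalgType K) (n : nat)
  (w : n.-tuple {bilinear g -> g -> K^o}) : Type := (g * 'rV[K]_n)%type.

Section CentralExtension.
Variables (K : fieldType) (g : superalgType K) (n : nat).
Variable w : n.-tuple {bilinear g -> g -> K^o}.

HB.instance Definition _ := GRing.Lmodule.copy (centext w) (g * 'rV[K]_n)%type.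

Implicit Types a b : centext w.

Definition ce_spart (e : bool) a : centext w :=
  (spart e a.1, if e then 0 else a.2).

Definition ce_br a b : centext w :=
  ({[ a.1, b.1 ]}, \row_k (tnth w k a.1 b.1 : K)).

Fact ce_spart_linear e : linear (ce_spart e).
Proof.
move=> k a b; congr pair; rewrite /= ?spart_linear //.
by case: e; rewrite ?scaler0 ?addr0.
Qed.

Fact ce_spartK e f a :
  ce_spart e (ce_spart f a) = if e == f then ce_spart e a else 0.
Proof.
by rewrite /ce_spart /= spartK; case: e; case: f.
Qed.

Fact ce_spartD a : ce_spart false a + ce_spart true a = a.
Proof.
by rewrite [RHS]surjective_pairing; congr pair; rewrite /= ?spartD ?addr0.
Qed.

Fact ce_br_linearl b : linear (ce_br^~ b).
Proof.
move=> k a a'; congr pair; rewrite /= ?sbr_linearl //.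
by apply/rowP => i; rewrite !mxE linearPl.
Qed.

Fact ce_br_linearr a : linear (ce_br a).
Proof.
move=> k b b'; congr pair; rewrite /= ?sbr_linearr //.
by apply/rowP => i; rewrite !mxE linearPr.
Qed.

HB.instance Definition _ := isSuperalgebra.Build K (centext w) ce_spart_linear
  ce_spartK ce_spartD ce_br_linearl ce_br_linearr.

End CentralExtension.

Section Sl2.
Variable K : fieldType.

Definition traceless : {pred 'M[K]_2} := fun M => \tr M == 0.

Fact traceless_closed : submod_closed traceless.
Proof.
split=> [|k M N]; rewrite !unfold_in ?mxtrace0 // => /eqP hM /eqP hN.
by rewrite mxtraceD mxtraceZ hM hN mulr0 addr0.
Qed.

HB.instance Definition _ :=
  GRing.isSubmodClosed.Build K 'M[K]_2 traceless traceless_closed.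

Record sl2 := Sl2 { sl2_val :> 'M[K]_2; sl2_valP : sl2_val \in traceless }.

HB.instance Definition _ := [isSub for sl2_val].
HB.instance Definition _ := [Choice of sl2 by <:].
HB.instance Definition _ := [SubChoice_isSubLmodule of sl2 by <:].

Fact sl2_br_subproof (M N : sl2) : M *m N - N *m M \in traceless.
Proof. by rewrite unfold_in linearB /= mxtrace_mulC subrr. Qed.

Definition sl2_br (M N : sl2) : sl2 := Sl2 (sl2_br_subproof M N).

(* The symplectic form on the plane, and the operator psi(x, y), with         *)
(* psi(x, y) z = omega(y, z) x + omega(x, z) y.                               *)
Definition omega (x y : 'cV[K]_2) : K := x 0 0 * y 1 0 - x 1 0 * y 0 0.

Definition omega_row (x : 'cV[K]_2) : 'rV[K]_2 :=
  \row_j omega x (delta_mx j 0).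

Definition psi_mx (x y : 'cV[K]_2) : 'M[K]_2 :=
  x *m omega_row y + y *m omega_row x.

Fact omega_rowE x j : omega_row x 0 j = if j == 0 then - x 1 0 else x 0 0.
Proof.
rewrite mxE /omega !mxE.
by case: j => [[|[|//]]] lt_j; rewrite /= !(mulr0, mulr1) ?sub0r ?subr0.
Qed.

Fact psi_mxE x y (z : 'cV[K]_2) :
  psi_mx x y *m z = omega y z *: x + omega x z *: y.
Proof.
apply/colP => i; rewrite /psi_mx mulmxDl -!mulmxA !mxE !big_ord1.
rewrite !mxE !big_ord_recl !big_ord0 !omega_rowE /omega /=.
have -> : lift ord0 ord0 = 1 :> 'I_2 by apply: val_inj.
by ring.
Qed.

Fact psi_subproof x y : psi_mx x y \in traceless.
Proof.
rewrite unfold_in /mxtrace !big_ord_recl big_ord0 !mxE !big_ord1 !omega_rowE /=.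
have -> : lift ord0 ord0 = 1 :> 'I_2 by apply: val_inj.
by apply/eqP; ring.
Qed.

Definition psi (x y : 'cV[K]_2) : sl2 := Sl2 (psi_subproof x y).

End Sl2.

Notation tensor3 K := {ffun 'I_2 * 'I_2 * 'I_2 -> K^o}.

Definition tens (K : fieldType) (v1 v2 v3 : 'cV[K]_2) : tensor3 K :=
  [ffun i => v1 i.1.1 0 * v2 i.1.2 0 * v3 i.2 0].

(* The superspace sl(V_1) + sl(V_2) + sl(V_3) + V_1 (x) V_2 (x) V_3 with      *)
(* V_1 = V_2 = V_3 = K^2.  If [z] is false, this is osp_{-1}(4|2); if [z] is  *)
(* true, sl(V_3) is made central, the term omega_1 omega_2 psi_3 is added to  *)
(* the bracket of odd elements, and this is osp_0(4|2).                       *)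
Definition osp_deg (K : fieldType) (z : bool) : Type :=
  (sl2 K * sl2 K * sl2 K * tensor3 K)%type.

Section Osp.
Variables (K : fieldType) (z : bool).

Local Notation osp := (osp_deg K z).
Local Notation V := 'cV[K]_2.

HB.instance Definition _ :=
  GRing.Lmodule.copy osp (sl2 K * sl2 K * sl2 K * tensor3 K)%type.

Definition act1 (M : sl2 K) (t : tensor3 K) : tensor3 K :=
  [ffun i => \sum_l sl2_val M i.1.1 l * t (l, i.1.2, i.2)].
Definition act2 (M : sl2 K) (t : tensor3 K) : tensor3 K :=
  [ffun i => \sum_l sl2_val M i.1.2 l * t (i.1.1, l, i.2)].
Definition act3 (M : sl2 K) (t : tensor3 K) : tensor3 K :=
  [ffun i => \sum_l sl2_val M i.2 l * t (i.1.1, i.1.2, l)].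

Definition even_act (M : sl2 K * sl2 K * sl2 K) (t : tensor3 K) : tensor3 K :=
  act1 M.1.1 t + act2 M.1.2 t + (~~ z)%:R *: act3 M.2 t.

(* The three components of the bracket of pure tensors. *)
Definition pure1 (v w : V * V * V) : sl2 K :=
  (omega v.1.2 w.1.2 * omega v.2 w.2) *: psi v.1.1 w.1.1.
Definition pure2 (v w : V * V * V) : sl2 K :=
  - ((omega v.1.1 w.1.1 * omega v.2 w.2) *: psi v.1.2 w.1.2).
Definition pure3 (v w : V * V * V) : sl2 K :=
  if z then (omega v.1.1 w.1.1 * omega v.1.2 w.1.2) *: psi v.2 w.2 else 0.

Definition basis_vect (i : 'I_2 * 'I_2 * 'I_2) : V * V * V :=
  (delta_mx i.1.1 0, delta_mx i.1.2 0, delta_mx i.2 0).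

(* Bilinear extension to all tensors. *)
Definition odd_br (pure : V * V * V -> V * V * V -> sl2 K) (t u : tensor3 K)
    : sl2 K :=
  \sum_i \sum_j ((t i * u j : K) *: pure (basis_vect i) (basis_vect j)).

Definition osp_br (a b : osp) : osp :=
  (sl2_br a.1.1.1 b.1.1.1 + odd_br pure1 a.2 b.2,
   sl2_br a.1.1.2 b.1.1.2 + odd_br pure2 a.2 b.2,
   (~~ z)%:R *: sl2_br a.1.2 b.1.2 + odd_br pure3 a.2 b.2,
   even_act a.1 b.2 - even_act b.1 a.2).

Definition osp_spart (e : bool) (a : osp) : osp :=
  if e then (0, a.2) else (a.1, 0).

Fact osp_spart_linear e : linear (osp_spart e).
Proof. by move=> k a b; case: e; congr pair; rewrite /= scaler0 addr0. Qed.

Fact osp_spartK e f a :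
  osp_spart e (osp_spart f a) = if e == f then osp_spart e a else 0.
Proof. by case: e; case: f. Qed.

Fact osp_spartD a : osp_spart false a + osp_spart true a = a.
Proof.
by rewrite [RHS]surjective_pairing; congr pair; rewrite /= ?addr0 ?add0r.
Qed.

Fact sl2_br_linearl N : linear (@sl2_br K ^~ N).
Proof.
move=> k M M'; apply: val_inj => /=.
rewrite mulmxDl mulmxDr -scalemxAl -scalemxAr scalerBr.
by rewrite opprD addrACA.
Qed.

Fact sl2_br_linearr M : linear (@sl2_br K M).
Proof.
move=> k N N'; apply: val_inj => /=.
rewrite mulmxDl mulmxDr -scalemxAl -scalemxAr scalerBr.
by rewrite opprD addrACA.
Qed.

Fact odd_br_linearl pure u : linear (odd_br pure ^~ u).
Proof.
move=> k t t'; rewrite /odd_br scaler_sumr -big_split; apply: eq_bigr => i _ /=.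
rewrite scaler_sumr -big_split; apply: eq_bigr => j _ /=.
by rewrite !ffunE mulrDl scalerDl scalerA mulrA.
Qed.

Fact odd_br_linearr pure t : linear (odd_br pure t).
Proof.
move=> k u u'; rewrite /odd_br scaler_sumr -big_split; apply: eq_bigr => i _ /=.
rewrite scaler_sumr -big_split; apply: eq_bigr => j _ /=.
by rewrite !ffunE mulrDr scalerDl scalerA mulrCA.
Qed.

Fact act1_l (k : K) M M' t : act1 (k *: M + M') t = k *: act1 M t + act1 M' t.
Proof.
apply/ffunP => i; rewrite !ffunE scaler_sumr -big_split.
by apply: eq_bigr => l _; rewrite /= !mxE mulrDl scalerAl.
Qed.
Fact act1_r (k : K) M t t' : act1 M (k *: t + t') = k *: act1 M t + act1 M t'.
Proof.
apply/ffunP => i; rewrite !ffunE scaler_sumr -big_split.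
by apply: eq_bigr => l _; rewrite /= !ffunE mulrDr scalerAr.
Qed.
Fact act2_l (k : K) M M' t : act2 (k *: M + M') t = k *: act2 M t + act2 M' t.
Proof.
apply/ffunP => i; rewrite !ffunE scaler_sumr -big_split.
by apply: eq_bigr => l _; rewrite /= !mxE mulrDl scalerAl.
Qed.
Fact act2_r (k : K) M t t' : act2 M (k *: t + t') = k *: act2 M t + act2 M t'.
Proof.
apply/ffunP => i; rewrite !ffunE scaler_sumr -big_split.
by apply: eq_bigr => l _; rewrite /= !ffunE mulrDr scalerAr.
Qed.
Fact act3_l (k : K) M M' t : act3 (k *: M + M') t = k *: act3 M t + act3 M' t.
Proof.
apply/ffunP => i; rewrite !ffunE scaler_sumr -big_split.
by apply: eq_bigr => l _; rewrite /= !mxE mulrDl scalerAl.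
Qed.
Fact act3_r (k : K) M t t' : act3 M (k *: t + t') = k *: act3 M t + act3 M t'.
Proof.
apply/ffunP => i; rewrite !ffunE scaler_sumr -big_split.
by apply: eq_bigr => l _; rewrite /= !ffunE mulrDr scalerAr.
Qed.

Fact even_act_linearl t : linear (even_act^~ t).
Proof.
move=> k M M'; rewrite /even_act /= act1_l act2_l act3_l !scalerDr !scalerA.
by rewrite [_ * k]mulrC (addrACA (k *: act1 _ _)) [LHS]addrACA.
Qed.

Fact even_act_linearr M : linear (even_act M).
Proof.
move=> k t t'; rewrite /even_act /= act1_r act2_r act3_r !scalerDr !scalerA.
by rewrite [_ * k]mulrC (addrACA (k *: act1 _ _)) [LHS]addrACA.
Qed.

Fact osp_br_linearl b : linear (osp_br^~ b).
Proof.
move=> k a a'; rewrite /osp_br; congr (_, _, _, _) => /=.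
- by rewrite sl2_br_linearl odd_br_linearl scalerDr addrACA.
- by rewrite sl2_br_linearl odd_br_linearl scalerDr addrACA.
- rewrite sl2_br_linearl odd_br_linearl !scalerDr !scalerA [_ * k]mulrC.
  by rewrite addrACA.
- rewrite even_act_linearl even_act_linearr scalerBr opprD.
  by rewrite addrACA.
Qed.

Fact osp_br_linearr a : linear (osp_br a).
Proof.
move=> k b b'; rewrite /osp_br; congr (_, _, _, _) => /=.
- by rewrite sl2_br_linearr odd_br_linearr scalerDr addrACA.
- by rewrite sl2_br_linearr odd_br_linearr scalerDr addrACA.
- rewrite sl2_br_linearr odd_br_linearr !scalerDr !scalerA [_ * k]mulrC.
  by rewrite addrACA.
- rewrite even_act_linearl even_act_linearr scalerBr opprD.
  by rewrite addrACA.
Qed.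

HB.instance Definition _ := isSuperalgebra.Build K osp osp_spart_linear
  osp_spartK osp_spartD osp_br_linearl osp_br_linearr.

End Osp.

Notation osp_m1 K := (osp_deg K false).
Notation osp_0 K := (osp_deg K true).

Section Psl22.
Variable K : fieldType.

Definition psl22_cartan_matrix : 'M[K]_3 :=
  \matrix_(i, j) nth 0 (nth [::] [:: [:: 2;  -1; 0];
                                     [:: -1;  0; 1];
                                     [::  0; -1; 2]] i) j.

(* Indices start at 0, so that x_2 and y_2 have index 1. *)
Definition psl22_par (i : 'I_3) : bool := i == 1.

End Psl22.

(* Main.v *)
(* The universal property gives a map from the presented algebra onto gl(2|2);
   spanning by root vectors shows that its kernel meets the Cartan subalgebra
   trivially, and maximality of the ideal then identifies g(A) with gl(2|2).
   Hence g = sl(2|2) / scalars, which embeds in osp_{-1}(4|2) as the ideal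
   sl(V_1) + sl(V_2) + V_1 (x) V_2 (x) V_3.  Every derivation of g is the adjoint
   action of an element of osp_{-1}(4|2): subtracting a suitable one kills
   finitely many coordinates, after which the weights under H_1 and H_2 and a few
   explicit relations leave nothing.  So the outer derivations are sl(V_3).
   The invariant form of g turns 2-cocycles into derivations and coboundaries into
   inner derivations, so H^2 is given by sl(V_3) as well; its three classes,
   written in coordinates, are the components of the term psi_3 in the bracket of
   osp_0(4|2). *)
Require Import Defs.
From HB Require Import structures.
From mathcomp Require Import all_boot all_order all_algebra ring.
From mathcomp Require Import boolp classical_sets functions.
Set Implicit Arguments.
Unset Strict Implicit.
Unset Printing Implicit Defensive.
Import GRing.Theory.
Local Open Scope classical_set_scope.
Local Open Scope ring_scope.

(** A bracket in osp_{-1}(4|2) or osp_0(4|2) is a double sum over pure tensors; written out once in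
    17 coordinates it is a polynomial, and every later identity between brackets is checked as a
    polynomial identity. The characteristic shapes the rest. Only signs and powers of 2 may be
    divided by, and for p = 3 a single torus element does not separate the weights. The odd weight
    spaces of g under H_1 and H_2 are two-dimensional, copies of V_3. An even derivation that kills
    sl(V_1) and sl(V_2) therefore acts through a 2 by 2 matrix on V_3, and the bracket of odd
    elements forces its trace to vanish; this is the origin of the outer sl(2). In gl(2|2) the
    vectors e_0 and e_1 of V_3 stand for the upper right and the lower left block. Matching psi(x,
    x) z = 2 omega(x, z) x with products of matrix units costs a factor 1/2 on the second block,
    whence the constants 2, 1/2 and 4 in the tables. *)

Section SuperalgebraLemmas.
Variables (K : fieldType) (L : superalgType K).
Implicit Types (x y z : L) (b c : bool).

Lemma spart0 b : spart b (0 : L) = 0. Proof. exact: homog0. Qed.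

Lemma spartL b k x y : spart b (k *: x + y) = k *: spart b x + spart b y.
Proof. exact: spart_linear. Qed.

Lemma spart_add b x y : spart b (x + y) = spart b x + spart b y.
Proof. by have := spartL b 1 x y; rewrite !scale1r. Qed.

Lemma sbr_suml (I : Type) (r : seq I) (F : I -> L) y :
  {[\sum_(i <- r) F i, y]} = \sum_(i <- r) {[F i, y]}.
Proof.
by apply: (big_morph (fun x => {[x, y]})) => [x x'|]; rewrite ?sbrDl ?sbr0l.
Qed.

Lemma sbr_sumr (I : Type) (r : seq I) (F : I -> L) y :
  {[y, \sum_(i <- r) F i]} = \sum_(i <- r) {[y, F i]}.
Proof.
by apply: (big_morph (fun x => {[y, x]})) => [x x'|]; rewrite ?sbrDr ?sbr0r.
Qed.

Lemma sbr_parts x y :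
  {[x, y]} = \sum_(b : bool) \sum_(c : bool) {[spart b x, spart c y]}.
Proof.
by rewrite !big_bool /= -!sbrDr -sbrDl ![spart true _ + _]addrC !spartD.
Qed.

Lemma spart_br b c x y :
  (forall b c x y, homog b x -> homog c y -> homog (b (+) c) {[x, y]}) ->
  homog c x -> spart b {[x, y]} = {[x, spart (b (+) c) y]}.
Proof.
move=> gr hx; rewrite -{1}(spartD y) sbrDr spart_add.
rewrite !(spart_homog _ (gr _ _ _ _ hx (homog_spart _ _))).
by case: b; case: c hx => hx; rewrite /= ?addr0 ?add0r.
Qed.

(** The Jacobi axiom leaves its third argument arbitrary, while a computation with signs needs all
    three homogeneous; linearity in [z] bridges the gap. *)
Lemma jacobi_ext (k : K) x y xy :
  (forall b z, homog b z ->
     {[ x, {[ y, z ]} ]} = {[ xy, z ]} + k *: {[ y, {[ x, z ]} ]}) ->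
  forall z, {[ x, {[ y, z ]} ]} = {[ xy, z ]} + k *: {[ y, {[ x, z ]} ]}.
Proof.
move=> jac z; rewrite -(spartD z) !sbrDr !(jac _ _ (homog_spart _ _)).
by rewrite scalerDr addrACA.
Qed.
End SuperalgebraLemmas.

(** * Coordinates on the superalgebras osp(4|2) *)

Section OspCoordinates.
Variable K : fieldType.

Definition sl2_crd (k : nat) (M : sl2 K) : K :=
  match k with 0 => sl2_val M 0 0 | 1 => sl2_val M 0 1 | _ => sl2_val M 1 0 end.

Fact sl2_of_subproof (a b c : K) :
  \matrix_(i < 2, j < 2) (if i == 0 then if j == 0 then a else b
                          else if j == 0 then c else - a) \in @traceless K.
Proof. by rewrite unfold_in /mxtrace !big_ord_recl big_ord0 !mxE /= addr0 subrr. Qed.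

Definition sl2_of (a b c : K) : sl2 K := Sl2 (sl2_of_subproof a b c).

Lemma ord2P (P : 'I_2 -> Prop) : P 0 -> P 1 -> forall i, P i.
Proof.
move=> P0 P1 [[|[|//]] lt_i].
  by rewrite (_ : Ordinal _ = 0) //; apply: val_inj.
by rewrite (_ : Ordinal _ = 1) //; apply: val_inj.
Qed.

Lemma sum2E (V : nmodType) (F : 'I_2 -> V) : \sum_i F i = F 0 + F 1.
Proof.
by rewrite !big_ord_recl big_ord0 addr0; congr (_ + F _); apply: val_inj.
Qed.

Lemma sum8E (V : nmodType) (F : 'I_2 * 'I_2 * 'I_2 -> V) :
  \sum_i F i = F (0, 0, 0) + F (0, 0, 1) + (F (0, 1, 0) + F (0, 1, 1))
             + (F (1, 0, 0) + F (1, 0, 1) + (F (1, 1, 0) + F (1, 1, 1))).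
Proof.
transitivity (\sum_i \sum_j \sum_k F (i, j, k)).
  by rewrite pair_bigA pair_bigA; apply: eq_bigr => [[[i j] k]].
by rewrite !sum2E.
Qed.

Lemma sl2_11 (M : sl2 K) : sl2_val M 1 1 = - sl2_val M 0 0.
Proof.
apply/eqP; have := sl2_valP M; rewrite unfold_in /mxtrace sum2E.
by rewrite addrC addr_eq0.
Qed.

Lemma sl2_ext (M N : sl2 K) :
  sl2_crd 0 M = sl2_crd 0 N -> sl2_crd 1 M = sl2_crd 1 N ->
  sl2_crd 2 M = sl2_crd 2 N -> M = N.
Proof.
move=> /= e0 e1 e2; apply: val_inj; apply/matrixP; apply: ord2P; apply: ord2P => //=.
by rewrite !sl2_11 e0.
Qed.

Variable z : bool.
Implicit Types a b : osp_deg K z.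

(* Indices 0-2, 3-5 and 6-8 are the coordinates on H, E, F in the three copies
   of sl(2); index [9 + 4 i + 2 j + k] is that on [e_i (x) e_j (x) e_k]. *)
Definition osp_crd (n : nat) a : K :=
  match n with
  | 0 | 1 | 2 => sl2_crd n a.1.1.1
  | 3 | 4 | 5 => sl2_crd (n - 3) a.1.1.2
  | 6 | 7 | 8 => sl2_crd (n - 6) a.1.2
  | 9 => a.2 (0, 0, 0) | 10 => a.2 (0, 0, 1)
  | 11 => a.2 (0, 1, 0) | 12 => a.2 (0, 1, 1)
  | 13 => a.2 (1, 0, 0) | 14 => a.2 (1, 0, 1)
  | 15 => a.2 (1, 1, 0) | 16 => a.2 (1, 1, 1)
  | _ => 0
  end.

Lemma osp_crd_ext a b : (forall n, (n < 17)%N -> osp_crd n a = osp_crd n b) -> a = b.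
Proof.
move=> e; case: a b e => [[[M1 M2] M3] t] [[[N1 N2] N3] u] e.
congr (_, _, _, _).
- by apply: sl2_ext; [apply: (e 0) | apply: (e 1) | apply: (e 2)].
- by apply: sl2_ext; [apply: (e 3) | apply: (e 4) | apply: (e 5)].
- by apply: sl2_ext; [apply: (e 6) | apply: (e 7) | apply: (e 8)].
apply/ffunP => -[[i j] k]; move: i j k.
apply: ord2P; apply: ord2P; apply: ord2P.
- exact: (e 9). - exact: (e 10). - exact: (e 11). - exact: (e 12).
- exact: (e 13). - exact: (e 14). - exact: (e 15). - exact: (e 16).
Qed.

Lemma osp_crd_linear n (k : K) a b : osp_crd n (k *: a + b) = k * osp_crd n a + osp_crd n b.
Proof.
by do 17?[case: n => [|n]]; rewrite /osp_crd /= ?mxE ?ffunE // mulr0 addr0.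
Qed.

Lemma osp_crdD n a b : osp_crd n (a + b) = osp_crd n a + osp_crd n b.
Proof. by have := osp_crd_linear n 1 a b; rewrite scale1r mul1r. Qed.
Lemma osp_crd0 n : osp_crd n 0 = 0.
Proof. by apply: (addrI (osp_crd n 0)); rewrite -osp_crdD !addr0. Qed.
Lemma osp_crdZ n k a : osp_crd n (k *: a) = k * osp_crd n a.
Proof. by have := osp_crd_linear n k a 0; rewrite osp_crd0 !addr0. Qed.
Lemma osp_crdN n a : osp_crd n (- a) = - osp_crd n a.
Proof. by rewrite -scaleN1r osp_crdZ mulN1r. Qed.

Definition osp_of (F : nat -> K) : osp_deg K z :=
  (sl2_of (F 0%N) (F 1%N) (F 2%N), sl2_of (F 3%N) (F 4%N) (F 5%N), sl2_of (F 6%N) (F 7%N) (F 8%N),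
   [ffun i : 'I_2 * 'I_2 * 'I_2 => F (9 + 4 * i.1.1 + 2 * i.1.2 + i.2)%N])%N.

Lemma osp_crd_of n F : (n < 17)%N -> osp_crd n (osp_of F) = F n.
Proof. by do 17?[case: n => [|n]] => // _; rewrite /osp_crd /= ?mxE ?ffunE. Qed.

Lemma osp_crd_spart e a :
  osp_crd^~ (spart e a) = fun n => if (8 < n)%N == e then osp_crd n a else 0.
Proof.
apply: funext => n; by do 17?[case: n => [|n]]; case: e => //=; rewrite /osp_crd /= ?mxE ?ffunE.
Qed.

(* omega (x) omega evaluated on two slices of the odd parts of [F] and [G], each
   given by the indices of its entries 00, 01, 10, 11. *)
Definition omega2 (F G : nat -> K) (i0 i1 i2 i3 j0 j1 j2 j3 : nat) : K :=
  F i0 * G j3 - F i1 * G j2 - F i2 * G j1 + F i3 * G j0.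

(** One formula serves both algebras: [w] switches the action of sl(V_3) on and off, [v] the term
    psi_3. *)
Definition br_crd (F G : nat -> K) (n : nat) : K :=
  let w : K := (~~ z)%:R in let v : K := z%:R in
  match n with
  | 0 => F 1%N * G 2%N - F 2%N * G 1%N
         - (omega2 F G 9 10 11 12 13 14 15 16 + omega2 F G 13 14 15 16 9 10 11 12)
  | 1 => 2 * (F 0%N * G 1%N - F 1%N * G 0%N) + 2 * omega2 F G 9 10 11 12 9 10 11 12
  | 2 => 2 * (F 2%N * G 0%N - F 0%N * G 2%N) - 2 * omega2 F G 13 14 15 16 13 14 15 16
  | 3 => F 4%N * G 5%N - F 5%N * G 4%N
         + (omega2 F G 9 10 13 14 11 12 15 16 + omega2 F G 11 12 15 16 9 10 13 14)
  | 4 => 2 * (F 3%N * G 4%N - F 4%N * G 3%N) - 2 * omega2 F G 9 10 13 14 9 10 13 14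
  | 5 => 2 * (F 5%N * G 3%N - F 3%N * G 5%N) + 2 * omega2 F G 11 12 15 16 11 12 15 16
  | 6 => w * (F 7%N * G 8%N - F 8%N * G 7%N)
         - v * (omega2 F G 9 11 13 15 10 12 14 16 + omega2 F G 10 12 14 16 9 11 13 15)
  | 7 => w * (2 * (F 6%N * G 7%N - F 7%N * G 6%N)) + v * (2 * omega2 F G 9 11 13 15 9 11 13 15)
  | 8 => w * (2 * (F 8%N * G 6%N - F 6%N * G 8%N)) - v * (2 * omega2 F G 10 12 14 16 10 12 14 16)
  | 9 => F 0%N * G 9%N + F 1%N * G 13%N + (F 3%N * G 9%N + F 4%N * G 11%N) + w * (F 6%N * G 9%N + F 7%N * G 10%N)
         - (G 0%N * F 9%N + G 1%N * F 13%N + (G 3%N * F 9%N + G 4%N * F 11%N) + w * (G 6%N * F 9%N + G 7%N * F 10%N))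
  | 10 => F 0%N * G 10%N + F 1%N * G 14%N + (F 3%N * G 10%N + F 4%N * G 12%N) + w * (F 8%N * G 9%N - F 6%N * G 10%N)
         - (G 0%N * F 10%N + G 1%N * F 14%N + (G 3%N * F 10%N + G 4%N * F 12%N) + w * (G 8%N * F 9%N - G 6%N * F 10%N))
  | 11 => F 0%N * G 11%N + F 1%N * G 15%N + (F 5%N * G 9%N - F 3%N * G 11%N) + w * (F 6%N * G 11%N + F 7%N * G 12%N)
         - (G 0%N * F 11%N + G 1%N * F 15%N + (G 5%N * F 9%N - G 3%N * F 11%N) + w * (G 6%N * F 11%N + G 7%N * F 12%N))
  | 12 => F 0%N * G 12%N + F 1%N * G 16%N + (F 5%N * G 10%N - F 3%N * G 12%N) + w * (F 8%N * G 11%N - F 6%N * G 12%N)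
         - (G 0%N * F 12%N + G 1%N * F 16%N + (G 5%N * F 10%N - G 3%N * F 12%N) + w * (G 8%N * F 11%N - G 6%N * F 12%N))
  | 13 => F 2%N * G 9%N - F 0%N * G 13%N + (F 3%N * G 13%N + F 4%N * G 15%N) + w * (F 6%N * G 13%N + F 7%N * G 14%N)
         - (G 2%N * F 9%N - G 0%N * F 13%N + (G 3%N * F 13%N + G 4%N * F 15%N) + w * (G 6%N * F 13%N + G 7%N * F 14%N))
  | 14 => F 2%N * G 10%N - F 0%N * G 14%N + (F 3%N * G 14%N + F 4%N * G 16%N) + w * (F 8%N * G 13%N - F 6%N * G 14%N)
         - (G 2%N * F 10%N - G 0%N * F 14%N + (G 3%N * F 14%N + G 4%N * F 16%N) + w * (G 8%N * F 13%N - G 6%N * F 14%N))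
  | 15 => F 2%N * G 11%N - F 0%N * G 15%N + (F 5%N * G 13%N - F 3%N * G 15%N) + w * (F 6%N * G 15%N + F 7%N * G 16%N)
         - (G 2%N * F 11%N - G 0%N * F 15%N + (G 5%N * F 13%N - G 3%N * F 15%N) + w * (G 6%N * F 15%N + G 7%N * F 16%N))
  | 16 => F 2%N * G 12%N - F 0%N * G 16%N + (F 5%N * G 14%N - F 3%N * G 16%N) + w * (F 8%N * G 15%N - F 6%N * G 16%N)
         - (G 2%N * F 12%N - G 0%N * F 16%N + (G 5%N * F 14%N - G 3%N * F 16%N) + w * (G 8%N * F 15%N - G 6%N * F 16%N))
  | _ => 0
  end.

Definition psi_entry (i j k l : 'I_2) : K :=
  (k == i)%:R * (if l == 0 then - (j == 1)%:R else (j == 0)%:R) +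
  (k == j)%:R * (if l == 0 then - (i == 1)%:R else (i == 0)%:R).

Definition eps (i j : 'I_2) : K := (i == 0)%:R * (j == 1)%:R - (i == 1)%:R * (j == 0)%:R.

Lemma omega_delta (i j : 'I_2) :
  omega (delta_mx i 0) (delta_mx j 0) = eps i j.
Proof. by rewrite /omega !mxE !eqxx !andbT eq_sym [1 == j]eq_sym [0 == j]eq_sym [1 == i]eq_sym. Qed.

Lemma psi_delta (i j k l : 'I_2) :
  sl2_val (psi (delta_mx i 0) (delta_mx j 0)) k l = psi_entry i j k l.
Proof.
rewrite /= /psi_mx !mxE !big_ord1 !omega_rowE !mxE !eqxx !andbT.
by rewrite [1 == j]eq_sym [0 == j]eq_sym [1 == i]eq_sym [0 == i]eq_sym.
Qed.

Lemma odd_br_entry (P : 'cV[K]_2 * 'cV[K]_2 * 'cV[K]_2 -> 'cV[K]_2 * 'cV[K]_2 * 'cV[K]_2 -> sl2 K) t u k l :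
  sl2_val (odd_br P t u) k l =
  \sum_i \sum_j t i * u j * sl2_val (P (basis_vect K i) (basis_vect K j)) k l.
Proof.
rewrite /odd_br.
elim/big_rec2: _ => [|i x y _ <-]; first by rewrite mxE.
rewrite mxE; congr (_ + _).
elim/big_rec2: _ => [|j x' y' _ <-]; first by rewrite mxE.
by rewrite !mxE.
Qed.

Lemma pure1_entry t u k l : sl2_val (odd_br (@pure1 K) t u) k l =
  \sum_i \sum_j t i * u j *
    (eps i.1.2 j.1.2 * eps i.2 j.2 * psi_entry i.1.1 j.1.1 k l).
Proof.
rewrite odd_br_entry; apply: eq_bigr => i _; apply: eq_bigr => j _.
by rewrite mxE !omega_delta psi_delta.
Qed.

Lemma pure2_entry t u k l : sl2_val (odd_br (@pure2 K) t u) k l =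
  \sum_i \sum_j t i * u j *
    - (eps i.1.1 j.1.1 * eps i.2 j.2 * psi_entry i.1.2 j.1.2 k l).
Proof.
rewrite odd_br_entry; apply: eq_bigr => i _; apply: eq_bigr => j _.
by rewrite 2!mxE !omega_delta psi_delta.
Qed.

Lemma pure3_entry t u k l : sl2_val (odd_br (@pure3 K z) t u) k l =
  z%:R * \sum_i \sum_j t i * u j *
    (eps i.1.1 j.1.1 * eps i.1.2 j.1.2 * psi_entry i.2 j.2 k l).
Proof.
rewrite odd_br_entry mulr_sumr; apply: eq_bigr => i _.
rewrite mulr_sumr; apply: eq_bigr => j _; rewrite /pure3.
by case: (z); rewrite mxE ?omega_delta ?psi_delta ?mul1r ?mul0r ?mulr0.
Qed.

Let osp_crd_brE := (sum2E, sl2_11, pure1_entry, pure2_entry, pure3_entry).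

Ltac odd_coordinate := rewrite /osp_crd /= !mxE ?osp_crd_brE ?sum8E /eps /psi_entry /= /omega2; ring.
Ltac tensor_coordinate := rewrite /osp_crd /= !ffunE /= ?osp_crd_brE /GRing.scale /=; ring.

(** An equality of functions rather than of values, so that rewriting also reaches brackets nested
    inside [br_crd]. *)
Lemma osp_crd_br a b : osp_crd^~ {[a, b]} = br_crd (osp_crd^~ a) (osp_crd^~ b).
Proof.
apply: funext => n.
do 3 (case: n => [|n]; first by odd_coordinate).
do 3 (case: n => [|n]; first by odd_coordinate).
do 3 (case: n => [|n]; first by odd_coordinate).
do 8 (case: n => [|n]; first by tensor_coordinate).
by [].
Qed.
End OspCoordinates.
Arguments osp_crd {K z} n a.
Arguments osp_crd_br {K z} a b.
Arguments osp_crd_spart {K z} e a.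
Arguments osp_crd_ext {K z a b}.
Arguments osp_crd_of {K z n}.
Arguments br_crd {K}.
Arguments osp_crd : simpl never.

Lemma osp_crd_brn (K : fieldType) (z : bool) n (a b : osp_deg K z) :
  osp_crd n {[a, b]} = br_crd z (osp_crd^~ a) (osp_crd^~ b) n.
Proof. exact: (congr1 (@^~ n) (osp_crd_br a b)). Qed.
Lemma osp_crd_spartn (K : fieldType) (z : bool) n e (a : osp_deg K z) :
  osp_crd n (spart e a) = if (8 < n)%N == e then osp_crd n a else 0.
Proof. exact: (congr1 (@^~ n) (osp_crd_spart e a)). Qed.

(** * The Lie superalgebra identities of osp_{-1}(4|2) *)

Section Osp.
Variable K : fieldType.
Implicit Types a b x y : osp_m1 K.

Lemma osp_jacobi (b c : bool) (x y z : osp_m1 K) : homog b x -> homog c y ->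
    {[ x, {[ y, z ]} ]} =
      {[ {[ x, y ]}, z ]} + (-1 : K) ^+ (b && c) *: {[ y, {[ x, z ]} ]}.
Proof.
(* Homogeneity is used as [x = spart b x]: the coordinates of the wrong parity become 0, and a
   polynomial identity without hypotheses remains. *)
move=> <- <-; apply: osp_crd_ext => n; rewrite osp_crdD osp_crdZ.
rewrite !osp_crd_brn !osp_crd_br !osp_crd_spart.
move: (osp_crd^~ x) (osp_crd^~ y) (osp_crd^~ z) => F G H.
by case: b c => [] []; do 17?[case: n => [|n]] => // _;
  rewrite /br_crd /omega2 /=; ring.
Qed.

Lemma osp_skew (b c : bool) (x y : osp_m1 K) : homog b x -> homog c y ->
    {[ x, y ]} = - ((-1 : K) ^+ (b && c) *: {[ y, x ]}).
Proof.
move=> <- <-; apply: osp_crd_ext => n; rewrite osp_crdN osp_crdZ !osp_crd_brn !osp_crd_spart.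
move: (osp_crd^~ x) (osp_crd^~ y) => F G.
by case: b c => [] []; do 17?[case: n => [|n]] => // _;
  rewrite /br_crd /omega2 /=; ring.
Qed.

Lemma osp_graded (b c : bool) (x y : osp_m1 K) : homog b x -> homog c y ->
    homog (b (+) c) {[ x, y ]}.
Proof.
move=> <- <-; apply: osp_crd_ext => n; rewrite osp_crd_spartn osp_crd_brn !osp_crd_spart.
move: (osp_crd^~ x) (osp_crd^~ y) => F G.
by case: b c => [] []; do 17?[case: n => [|n]] => // _;
  rewrite /br_crd /omega2 /=; ring.
Qed.
End Osp.

(** * Derivations killing the determining coordinates *)

Section Normalized.
Variables (K : fieldType) (b : bool) (c : nat -> nat -> K).
Hypothesis two0 : (2 : K) != 0.

Definition unit_crd (k n : nat) : K := (n == k)%:R.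

Definition sum17 (F G : nat -> K) : K :=
  F 0%N * G 0%N + F 1%N * G 1%N + F 2%N * G 2%N + F 3%N * G 3%N + F 4%N * G 4%N + F 5%N * G 5%N +
  F 6%N * G 6%N + F 7%N * G 7%N + F 8%N * G 8%N +
  F 9%N * G 9%N + F 10%N * G 10%N + F 11%N * G 11%N + F 12%N * G 12%N +
  F 13%N * G 13%N + F 14%N * G 14%N + F 15%N * G 15%N + F 16%N * G 16%N.

Definition psl_index (k : nat) := (k < 17)%N && ((k < 6)%N || (8 < k)%N).

(** Here [c k n] is coordinate [n] of the image of basis vector [k] under a derivation of parity
    [b]; the left side is the image of the bracket of the basis vectors [k] and [l]. *)
Hypothesis c_rel : forall k l n, psl_index k -> psl_index l -> (n < 17)%N ->
  sum17 (br_crd false (unit_crd k) (unit_crd l)) (c^~ n) =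
  br_crd false (c k) (unit_crd l) n +
  (-1) ^+ (b && (8 < k)%N) * br_crd false (unit_crd k) (c l) n.

Hypothesis c_im : forall k n, psl_index k -> (5 < n < 9)%N -> c k n = 0.

(** Together with [c_H2], [c_E] and [c_e] these are 17 conditions, as many as the dimension of
    osp_{-1}(4|2): each can be achieved by subtracting the action of one coordinate. *)
Hypothesis c_H1 : forall n, n \in [:: 1; 2; 9; 10; 11; 12; 13; 14; 15; 16]%N ->
  c 0 n = 0.
Hypothesis c_H2 : c 3 4 = 0 /\ c 3 5 = 0.
Hypothesis c_E : c 1 1 = 0 /\ c 4 4 = 0.
Hypothesis c_e : [/\ c 9 9 = 0, c 9 10 = 0 & c 10 9 = 0].

Let c6 k : psl_index k -> c k 6 = 0. Proof. by move=> hk; apply: c_im. Qed.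
Let c7 k : psl_index k -> c k 7 = 0. Proof. by move=> hk; apply: c_im. Qed.
Let c8 k : psl_index k -> c k 8 = 0. Proof. by move=> hk; apply: c_im. Qed.

Let four0 : (4 : K) != 0.
Proof. by rewrite (_ : 4 = 2 * 2) ?mulf_neq0 // -natrM. Qed.

Let one0 : (1 : K) != 0. Proof. exact: oner_neq0. Qed.
Let sgn0 : ((-1) ^+ b : K) != 0. Proof. by rewrite signr_eq0. Qed.

(* After rewriting with [known], the relation for [k], [l], [n] says that a unit
   (1, 2, 4 or a sign) times the unknown coefficient of the goal vanishes. *)
Ltac by_rel k l n known :=
  let E := fresh in
  have E := @c_rel k l n isT isT isT;
  rewrite /sum17 /br_crd /omega2 /unit_crd /= ?(andbT, andbF, expr0) ?known in E;
  move/eqP: E; rewrite -subr_eq0 => /eqP E;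
  first [ apply: (mulfI one0); rewrite mulr0 -{}E; ring
        | apply: (mulfI two0); rewrite mulr0 -{}E; ring
        | apply: (mulfI four0); rewrite mulr0 -{}E; ring
        | apply: (mulfI sgn0); rewrite mulr0 -{}E; ring
        | apply: (mulfI one0); rewrite mulr0 -[RHS]oppr0 -{}E; ring
        | apply: (mulfI two0); rewrite mulr0 -[RHS]oppr0 -{}E; ring
        | apply: (mulfI four0); rewrite mulr0 -[RHS]oppr0 -{}E; ring
        | apply: (mulfI sgn0); rewrite mulr0 -[RHS]oppr0 -{}E; ring ].

(** The coordinates 0, 3, 4, 5 of the image of H_1 remain. They vanish by [H_1, E_1] = 2 E_1,
    [H_1, E_2] = 0 and [H_1, H_2] = 0. *)
Lemma c0_eq0 n : (n < 17)%N -> c 0 n = 0.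
Proof.
have z6 := (@c6 0 isT, @c7 0 isT, @c8 0 isT).
case: c_H2 => c34 c35.
do 17?[case: n => [|n]] => // _; try exact: c_H1; try exact: c_im.
- by_rel 0%N 1%N 1%N (c34, c35).
- by_rel 0%N 4%N 4%N (c34, c35).
- by_rel 0%N 3%N 4%N (c34, c35).
- by_rel 0%N 3%N 5%N (c34, c35).
Qed.

(* Weights of the coordinates under H_1 and H_2, shifted by 2 to be natural. *)
Definition wt1 (n : nat) : nat := nth 0 [:: 2; 4; 0; 2; 2; 2; 2; 2; 2; 3; 3; 3; 3; 1; 1; 1; 1]%N n.
Definition wt2 (n : nat) : nat := nth 0 [:: 2; 2; 2; 2; 4; 0; 2; 2; 2; 3; 3; 1; 1; 3; 3; 1; 1]%N n.

Lemma br_crd0 (F G : nat -> K) n : (forall m, (m < 17)%N -> F m = 0) ->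
  (n < 17)%N -> br_crd false F G n = 0.
Proof.
move=> F0; have z0 := (F0 0 isT, F0 1 isT, F0 2 isT, F0 3 isT, F0 4 isT, F0 5 isT, F0 6 isT, F0 7 isT, F0 8 isT).
have z9 := (F0 9 isT, F0 10 isT, F0 11 isT, F0 12 isT, F0 13 isT, F0 14 isT, F0 15 isT, F0 16 isT).
by do 17?[case: n => [|n]] => // _; rewrite /br_crd /omega2 /= !(z0, z9); ring.
Qed.

Lemma br_crdH1 (F : nat -> K) n : (n < 17)%N ->
  br_crd false (unit_crd 0%N) F n = ((wt1 n)%:R - 2) * F n.
Proof.
by do 17?[case: n => [|n]] => // _; rewrite /br_crd /omega2 /unit_crd /wt1 /=; ring.
Qed.

Lemma br_crdH2 (F : nat -> K) n : (n < 17)%N ->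
  br_crd false (unit_crd 3%N) F n = ((wt2 n)%:R - 2) * F n.
Proof.
by do 17?[case: n => [|n]] => // _; rewrite /br_crd /omega2 /unit_crd /wt2 /=; ring.
Qed.

Lemma sum17_unit k (w F G : nat -> K) : (k < 17)%N ->
  (forall n, (n < 17)%N -> F n = w n * unit_crd k n) -> sum17 F G = w k * G k.
Proof.
move=> k17 hF; rewrite /sum17 !hF // /unit_crd; clear hF.
by do 17?[case: k k17 => [|k] k17] => //=; ring.
Qed.

(* These differences are invertible in every characteristic other than 2; the
   difference 3 is not when p = 3, and has to be treated separately. *)
Definition small_diff (i j : nat) := (i - j + (j - i))%N \in [:: 1; 2; 4]%N.

Lemma small_diffP i j : small_diff i j -> (i%:R - 2 - (j%:R - 2) : K) != 0.
Proof.
rewrite opprB addrA subrK /small_diff.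
have h m : m \in [:: 1; 2; 4]%N -> (m%:R : K) != 0.
  by rewrite !inE => /or3P[] /eqP->.
case/orP: (leq_total i j) => le_ij.
  move: (le_ij); rewrite -subn_eq0 => /eqP-> /h.
  by rewrite add0n natrB // -[j%:R - _]opprB oppr_eq0.
by move: (le_ij); rewrite -subn_eq0 => /eqP-> /h; rewrite addn0 natrB.
Qed.

(** A derivation that kills H_1 commutes with its adjoint action, so it preserves the weight
    wherever the difference of weights is invertible. *)
Lemma c_wt1 k n : psl_index k -> (n < 17)%N -> small_diff (wt1 k) (wt1 n) ->
  c k n = 0.
Proof.
move=> hk n17 d; have k17 : (k < 17)%N by case/andP: hk.
have := c_rel (k := 0%N) isT hk n17.
rewrite (@sum17_unit k (fun k => (wt1 k)%:R - 2)) // => [|m m17]; last exact: br_crdH1.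
rewrite (br_crd0 _ c0_eq0) // br_crdH1 // add0r andbF mul1r => e.
by apply: (mulfI (small_diffP d)); rewrite mulrBl e subrr mulr0.
Qed.

Lemma c3_eq0 n : (n < 17)%N -> c 3 n = 0.
Proof.
have z6 := (@c6 3 isT, @c7 3 isT, @c8 3 isT).
case: c_H2 => c34 c35.
do 17?[case: n => [|n]] => // _; try exact: c34; try exact: c35; try exact: c_im;
  try exact: c_wt1.
- by_rel 3%N 1%N 1%N (c34, c35).
- by_rel 3%N 4%N 4%N (c34, c35).
Qed.

Lemma c_wt2 k n : psl_index k -> (n < 17)%N -> small_diff (wt2 k) (wt2 n) ->
  c k n = 0.
Proof.
move=> hk n17 d; have k17 : (k < 17)%N by case/andP: hk.
have := c_rel (k := 3%N) isT hk n17.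
rewrite (@sum17_unit k (fun k => (wt2 k)%:R - 2)) // => [|m m17]; last exact: br_crdH2.
rewrite (br_crd0 _ c3_eq0) // br_crdH2 // add0r andbF mul1r => e.
by apply: (mulfI (small_diffP d)); rewrite mulrBl e subrr mulr0.
Qed.

Ltac wt_zero := try exact: c_im; try exact: c_wt1; try exact: c_wt2.

(** The two weights together suffice even for p = 3. Even roots have one weight 2 or -2 and the
    other 0, while both weights of an odd vector are 1 or -1; so a difference 3 in one weight comes
    with a difference 1 in the other. *)
Lemma c1_eq0 n : (n < 17)%N -> c 1 n = 0.
Proof. by case: c_E => c11 _; do 17?[case: n => [|n]] => // _; wt_zero. Qed.

Lemma c4_eq0 n : (n < 17)%N -> c 4 n = 0.
Proof. by case: c_E => _ c44; do 17?[case: n => [|n]] => // _; wt_zero. Qed.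

Lemma c2_eq0 n : (n < 17)%N -> c 2 n = 0.
Proof.
do 17?[case: n => [|n]] => // _; wt_zero.
by_rel 1%N 2%N 0%N (@c0_eq0 0 isT, @c1_eq0 0 isT, @c1_eq0 1 isT, @c1_eq0 2 isT).
Qed.

Lemma c5_eq0 n : (n < 17)%N -> c 5 n = 0.
Proof.
do 17?[case: n => [|n]] => // _; wt_zero.
by_rel 4%N 5%N 3%N (@c3_eq0 3 isT, @c4_eq0 3 isT, @c4_eq0 4 isT, @c4_eq0 5 isT).
Qed.

Lemma c9_eq0 n : (n < 17)%N -> c 9 n = 0.
Proof. by case: c_e => c99 c910 _; do 17?[case: n => [|n]] => // _; wt_zero. Qed.

Lemma br_crd_scale (F G G' : nat -> K) t n :
  (forall m, (m < 17)%N -> G m = t * G' m) -> (n < 17)%N ->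
  br_crd false F G n = t * br_crd false F G' n.
Proof.
move=> hG; have z0 := (hG 0 isT, hG 1 isT, hG 2 isT, hG 3 isT, hG 4 isT, hG 5 isT, hG 6 isT, hG 7 isT, hG 8 isT)%N.
have z9 := (hG 9 isT, hG 10 isT, hG 11 isT, hG 12 isT, hG 13 isT, hG 14 isT, hG 15 isT, hG 16 isT)%N.
by do 17?[case: n => [|n]] => // _; rewrite /br_crd /omega2 /= !(z0, z9); ring.
Qed.

(** A derivation killing the element [k] commutes with its action up to sign, so the eigenvalue [t]
    passes from [l] to the bracket [m]; the sign disappears because [k] is even. *)
Lemma c_act t k l m : psl_index k -> psl_index l -> (m < 17)%N -> (k <= 8)%N ->
  (forall n, (n < 17)%N -> c k n = 0) ->
  (forall n, (n < 17)%N ->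
     br_crd false (unit_crd k) (unit_crd l) n = unit_crd m n) ->
  (forall n, (n < 17)%N -> c l n = t * unit_crd l n) ->
  forall n, (n < 17)%N -> c m n = t * unit_crd m n.
Proof.
move=> hk hl m17 k8 ck0 hkl cl n n17.
have := c_rel hk hl n17.
rewrite (@sum17_unit m (fun=> 1)) // => [|j j17]; last by rewrite mul1r hkl.
rewrite mul1r => ->.
rewrite (br_crd0 _ ck0) // add0r ltnNge k8 andbF mul1r.
by rewrite (br_crd_scale _ cl) // hkl.
Qed.

Lemma br_F1 j n : j \in [:: 9; 10; 11; 12]%N -> (n < 17)%N ->
  br_crd false (unit_crd 2) (unit_crd j) n = unit_crd j.+4 n.
Proof.
by rewrite !inE => /or4P[] /eqP->; do 17?[case: n => [|n]] => // _;
  rewrite /br_crd /omega2 /unit_crd /=; ring.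
Qed.

Lemma br_F2 j n : j \in [:: 9; 10]%N -> (n < 17)%N ->
  br_crd false (unit_crd 5) (unit_crd j) n = unit_crd j.+2 n.
Proof.
by rewrite !inE => /orP[] /eqP->; do 17?[case: n => [|n]] => // _;
  rewrite /br_crd /omega2 /unit_crd /=; ring.
Qed.

(** F_2 and F_1 (indices 5 and 2), both killed, carry e_0 (x) e_0 (x) e_k to the other three basis
    vectors with the same third factor; their indices are larger by 2, 4 and 6. *)
Lemma c_odd j t : j \in [:: 9; 10]%N ->
  (forall n, (n < 17)%N -> c j n = t * unit_crd j n) ->
  forall i n, i \in [:: 0; 2; 4; 6]%N -> (n < 17)%N -> c (j + i) n = t * unit_crd (j + i) n.
Proof.
rewrite !inE => hj cj; have [pj pj2] : psl_index j /\ psl_index (j + 2).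
  by case/orP: hj => /eqP->.
have j2 : (j + 2 < 17)%N /\ (j + 6 < 17)%N by case/orP: hj => /eqP->.
have j4 : (j + 4 < 17)%N by case/orP: hj => /eqP->.
have c2 n : (n < 17)%N -> c (j + 2) n = t * unit_crd (j + 2) n.
  apply: (@c_act t 5 j (j + 2)) => //; [by case: j2 | exact: c5_eq0 |].
  by rewrite addn2 => m; apply: br_F2; rewrite !inE.
have h i m : (i == 0) || (i == 2) -> (m < 17)%N ->
    br_crd false (unit_crd 2) (unit_crd (j + i)) m = unit_crd (j + i).+4 m.
  by move=> hi; apply: br_F1; rewrite !inE; case/orP: hj => /eqP->; case/orP: hi => /eqP->.
move=> i n; rewrite !inE => /or4P[] /eqP->.
- by rewrite addn0; apply: cj.
- exact: c2.
- apply: (@c_act t 2 j (j + 4)) => //; first exact: c2_eq0.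
  by move=> m hm; rewrite -{1}[j]addn0 h // addn0 addn4.
- apply: (@c_act t 2 (j + 2) (j + 6)) => //; [by case: j2 | exact: c2_eq0 |].
  by move=> m hm; rewrite h // !addnS.
Qed.

Theorem normalized_eq0 k n : psl_index k -> (n < 17)%N -> c k n = 0.
Proof.
have h9 m i : i \in [:: 0; 2; 4; 6]%N -> (m < 17)%N -> c (9 + i) m = 0.
  move=> hi hm; rewrite (@c_odd 9 0) ?mul0r // => l hl.
  by rewrite mul0r c9_eq0.
set t := c 10 10.
have c10 m : (m < 17)%N -> c 10 m = t * unit_crd 10 m.
  case: c_e => _ _ c109.
  by do 17?[case: m => [|m]] => // _; rewrite ?mulr0 ?mulr1 //; wt_zero.
have h10 := @c_odd 10 t isT c10.
(* The derivation is now 0 on V_1 (x) V_2 (x) e_0 and [t] on V_1 (x) V_2 (x) e_1. The bracket of e_0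
   (x) e_0 (x) e_0 with e_1 (x) e_1 (x) e_1 lies in the span of H_1 and H_2, which is killed, and
   its coordinate on H_1 is -1; so [t] vanishes. *)
have t0 : t = 0.
  have z9 m : (m < 17)%N -> c 9 m = 0 by apply: (h9 m 0).
  have z16 m : (m < 17)%N -> c 16 m = t * unit_crd 16 m by apply: (h10 6).
  have := @c_rel 9 16 0 isT isT isT.
  rewrite (br_crd0 _ z9) // (br_crd_scale _ z16) // add0r.
  rewrite /sum17 /br_crd /omega2 /unit_crd /= !c0_eq0 // !c3_eq0 // => e.
  apply: (mulfI sgn0); rewrite mulr0 -[RHS]oppr0.
  transitivity (- ((-1) ^+ b * (t * (-1)))); first by ring.
  congr (- _).
  rewrite andbT in e.
  (* The last factor is the bracket of the two unit vectors, spelled out in the form in which [e]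
     contains it. *)
  have -> : (-1) ^+ b * (t * -1) = (-1) ^+ b * (t * (0 * 0 - 0 * 0 - (1 * 1 - 0 * 0 - 0 * 0 + 0 * 0 + (0 * 0 - 0 * 0 - 0 * 0 + 0 * 0)))) by ring.
  by rewrite -e; ring.
have h10' m i : i \in [:: 0; 2; 4; 6]%N -> (m < 17)%N -> c (10 + i) m = 0.
  by move=> hi hm; rewrite h10 // t0 mul0r.
move=> hk hn; move: hk.
do 17?[case: k => [|k]] => // _.
- exact: c0_eq0. - exact: c1_eq0. - exact: c2_eq0.
- exact: c3_eq0. - exact: c4_eq0. - exact: c5_eq0.
- exact: (h9 n 0). - exact: (h10' n 0). - exact: (h9 n 2). - exact: (h10' n 2).
- exact: (h9 n 4). - exact: (h10' n 4). - exact: (h9 n 6). - exact: (h10' n 6).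
Qed.
End Normalized.

(** * Derivations, cocycles and the central extension of the ideal psl(2|2) *)

(* M stands for osp_{-1}(4|2), known only through its coordinates, so that
   conversion never unfolds matrices and tensors; Psi embeds g as the ideal
   sl(V_1) + sl(V_2) + V_1 (x) V_2 (x) V_3. *)
Section OspIdeal.
Variables (K : fieldType) (g M : superalgType K) (Psi : {linear g -> M}).
Variables (crd : nat -> M -> K) (elt : (nat -> K) -> M).
Hypothesis two0 : (2 : K) != 0.
Hypothesis crd_ext : forall a b, (forall n, (n < 17)%N -> crd n a = crd n b) -> a = b.
Hypothesis crd_linear : forall n k a b, crd n (k *: a + b) = k * crd n a + crd n b.
Hypothesis crd_br : forall a b, crd^~ {[a, b]} = br_crd false (crd^~ a) (crd^~ b).
Hypothesis crd_spart : forall e a,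
  crd^~ (spart e a) = fun n => if (8 < n)%N == e then crd n a else 0.
Hypothesis crd_elt : forall F,
  crd^~ (elt F) = fun n => if (n < 17)%N then F n else 0.
Hypothesis jacobi : forall (b c : bool) (x y z : M), homog b x -> homog c y ->
  {[ x, {[ y, z ]} ]} =
    {[ {[ x, y ]}, z ]} + (-1 : K) ^+ (b && c) *: {[ y, {[ x, z ]} ]}.
Hypothesis graded : forall (b c : bool) (x y : M), homog b x -> homog c y ->
  homog (b (+) c) {[ x, y ]}.
Hypothesis skew : forall (b c : bool) (x y : M), homog b x -> homog c y ->
  {[ x, y ]} = - ((-1 : K) ^+ (b && c) *: {[ y, x ]}).

Definition in_psl (a : M) := [/\ crd 6%N a = 0, crd 7%N a = 0 & crd 8%N a = 0].
Hypothesis Psi_hom : superhom Psi.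
Hypothesis Psi_inj : injective Psi.
Hypothesis Psi_im : forall a, (exists u, Psi u = a) <-> in_psl a.

Lemma crdD n a b : crd n (a + b) = crd n a + crd n b.
Proof. by have := crd_linear n 1 a b; rewrite scale1r mul1r. Qed.
Lemma crd0 n : crd n 0 = 0.
Proof. by apply: (addrI (crd n 0)); rewrite -crdD !addr0. Qed.
Lemma crdZ n k a : crd n (k *: a) = k * crd n a.
Proof. by have := crd_linear n k a 0; rewrite crd0 !addr0. Qed.
Lemma crd_brn n a b : crd n {[a, b]} = br_crd false (crd^~ a) (crd^~ b) n.
Proof. exact: (congr1 (@^~ n) (crd_br a b)). Qed.
Lemma crd_spartn n e a : crd n (spart e a) = if (8 < n)%N == e then crd n a else 0.
Proof. exact: (congr1 (@^~ n) (crd_spart e a)). Qed.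
Lemma crd_eltn n F : (n < 17)%N -> crd n (elt F) = F n.
Proof. by move=> n17; rewrite [LHS](congr1 (@^~ n) (crd_elt F)) n17. Qed.

Definition pr (a : M) : M := elt (fun n => if (5 < n < 9)%N then 0 else crd n a).

Lemma crd_pr n a : (n < 17)%N -> crd n (pr a) = if (5 < n < 9)%N then 0 else crd n a.
Proof. exact: crd_eltn. Qed.

Lemma pr_in a : in_psl (pr a). Proof. by split; rewrite crd_pr. Qed.

Lemma crd_im a n : in_psl a -> (5 < n < 9)%N -> crd n a = 0.
Proof. by case=> h6 h7 h8; do 9?[case: n => [|n]]. Qed.

Lemma pr_id a : in_psl a -> pr a = a.
Proof.
by move=> h; apply: crd_ext => n n17; rewrite crd_pr //; case: ifP => // /(crd_im h).
Qed.

(** The projection [pr] makes this left inverse of [Psi] total and linear on [M]; it is a two-sided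
    inverse on the ideal only. *)
Definition Phi (a : M) : g := xget 0 [set u | Psi u = pr a].

Lemma PhiE a : Psi (Phi a) = pr a.
Proof.
rewrite /Phi; case: xgetP => [u _ //|no].
by have [] := (Psi_im (pr a)).2 (pr_in a) => u /no.
Qed.

Fact Phi_linear : linear Phi.
Proof.
move=> k a b; apply: Psi_inj; rewrite linearP !PhiE.
apply: crd_ext => n n17; rewrite crd_linear !crd_pr // crd_linear.
by case: ifP => // _; rewrite mulr0 addr0.
Qed.
HB.instance Definition _ := GRing.isLinear.Build K M g *:%R Phi Phi_linear.

Lemma PhiD a b : Phi (a + b) = Phi a + Phi b. Proof. exact: raddfD. Qed.
Lemma Phi0 : Phi 0 = 0. Proof. exact: raddf0. Qed.
Lemma PhiZ k a : Phi (k *: a) = k *: Phi a. Proof. exact: linearZ. Qed.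

Lemma PsiP u : in_psl (Psi u). Proof. by apply/Psi_im; exists u. Qed.

Lemma PsiK : cancel Psi Phi.
Proof. by move=> u; apply: Psi_inj; rewrite PhiE pr_id //; apply: PsiP. Qed.

Lemma PhiK a : in_psl a -> Psi (Phi a) = a.
Proof. by move=> h; rewrite PhiE pr_id. Qed.

Lemma Psi_spart b u : Psi (spart b u) = spart b (Psi u).
Proof. exact: Psi_hom.1. Qed.
Lemma Psi_br u v : Psi {[u, v]} = {[Psi u, Psi v]}.
Proof. exact: Psi_hom.2. Qed.
Lemma Psi_homog b u : homog b u <-> homog b (Psi u).
Proof.
rewrite /homog -Psi_spart; split=> [-> //|]; exact: Psi_inj.
Qed.

Lemma br_im a b : in_psl b -> in_psl {[a, b]}.
Proof.
by case=> h6 h7 h8; split; rewrite crd_brn /br_crd /= ?h6 ?h7 ?h8; ring.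
Qed.

Lemma PsiD u v : Psi (u + v) = Psi u + Psi v. Proof. exact: raddfD. Qed.
Lemma PsiB u v : Psi (u - v) = Psi u - Psi v. Proof. exact: raddfB. Qed.
Lemma PsiZ k u : Psi (k *: u) = k *: Psi u. Proof. exact: linearZ. Qed.
Lemma Psi0 : Psi 0 = 0. Proof. exact: raddf0. Qed.

(** * The action of osp_{-1}(4|2) on psl(2|2) and the determination of all derivations *)

Definition delta (a : M) : g -> g := fun u => Phi {[a, Psi u]}.

Lemma Psi_delta a u : Psi (delta a u) = {[a, Psi u]}.
Proof. by rewrite PhiK // //; apply/br_im/PsiP. Qed.

Lemma delta_linear k a b : delta (k *: a + b) = k *: delta a + delta b.
Proof.
by apply: funext => u; apply: Psi_inj; rewrite linearP !Psi_delta sbrDl sbrZl.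
Qed.

Lemma superder_delta b a : homog b a -> superder b (delta a).
Proof.
move=> ha; split=> [k u v|c u hu|c u v hu].
- by apply: Psi_inj; rewrite linearP !Psi_delta linearP sbrDr sbrZr.
- apply/Psi_homog; rewrite Psi_delta; apply: graded => //.
  exact/Psi_homog.
- apply: Psi_inj; rewrite PsiD PsiZ !Psi_delta !Psi_br !Psi_delta.
  by apply: jacobi => //; apply/Psi_homog.
Qed.

Lemma delta_der a : is_der (delta a).
Proof.
exists (delta (spart false a)), (delta (spart true a)); split.
- exact/superder_delta/homog_spart.
- exact/superder_delta/homog_spart.
- by rewrite -[delta (spart _ _)]scale1r -delta_linear scale1r spartD.
Qed.

Lemma delta0 : delta 0 = 0.
Proof. by apply: funext => u; apply: Psi_inj; rewrite Psi_delta sbr0l linear0. Qed.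

Lemma fpart_delta b a : fpart b (delta a) = delta (spart b a).
Proof.
rewrite -{1}[a]spartD -[spart false a]scale1r delta_linear fpartP scale1r.
rewrite !(fpart_superder _ (superder_delta (homog_spart _ _))).
by case: b; rewrite ?add0r ?addr0.
Qed.

Lemma deltaD a b u : delta (a + b) u = delta a u + delta b u.
Proof. by apply: Psi_inj; rewrite PsiD !Psi_delta sbrDl. Qed.

Lemma scomm_delta a b : scomm (delta a) (delta b) = delta {[a, b]}.
Proof.
apply: funext => u; rewrite (sbr_parts a b).
transitivity (\sum_(e : bool) \sum_(f : bool)
                delta {[spart e a, spart f b]} u); last first.
  by rewrite !big_bool /= !deltaD.
apply: eq_bigr => e _; apply: eq_bigr => f _; rewrite !fpart_delta.
apply: Psi_inj; rewrite PsiB PsiZ !Psi_delta.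
apply/eqP; rewrite subr_eq; apply/eqP.
exact: jacobi (homog_spart _ _) (homog_spart _ _).
Qed.

Lemma is_inner_delta D : is_inner D <-> exists2 a, in_psl a & D = delta a.
Proof.
split=> [[u ->]|[a ha ->]].
- exists (Psi u); first exact: PsiP.
  by apply: funext => v; apply: Psi_inj; rewrite Psi_delta Psi_br.
- exists (Phi a); apply: funext => v; apply: Psi_inj.
  by rewrite Psi_delta Psi_br PhiK.
Qed.

Definition ob k : M := elt (unit_crd K k).

Lemma crd_ob k n : crd n (ob k) = if (n < 17)%N then unit_crd K k n else 0.
Proof. exact: (congr1 (@^~ n) (crd_elt _)). Qed.

Lemma ob_im k : psl_index k -> in_psl (ob k).
Proof.
by move=> hk; split; rewrite crd_ob /unit_crd /=; do 9?[case: k hk => [|k] hk].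
Qed.

Lemma Psi_ob k : psl_index k -> Psi (Phi (ob k)) = ob k.
Proof. by move=> hk; apply/PhiK/ob_im. Qed.

Lemma ob_homog k : homog (8 < k)%N (ob k).
Proof.
apply: crd_ext => n n17; rewrite crd_spartn crd_ob n17 /unit_crd.
by case: eqP => // h; case: eqP => // e; case: h; rewrite e.
Qed.

Lemma osp_sum a : a = \sum_(k < 17) crd k a *: ob k.
Proof.
apply: crd_ext => n n17.
rewrite (big_morph (crd n) (fun a b => crdD n a b) (crd0 n)).
rewrite (bigD1 (Ordinal n17)) //= crdZ crd_ob n17 /unit_crd eqxx mulr1 big1 ?addr0 // => k.
by rewrite -val_eqE /= crdZ crd_ob n17 /unit_crd eq_sym => /negPf->; rewrite mulr0.
Qed.

Lemma sum17E (F G : nat -> K) : \sum_(k < 17) F k * G k = sum17 F G.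
Proof. by rewrite /sum17 !big_ord_recr big_ord0 /= add0r. Qed.

Definition der_crd (D : g -> g) k n := crd n (Psi (D (Phi (ob k)))).

Lemma crd_der D u n : linear D ->
  crd n (Psi (D u)) = sum17 (crd^~ (Psi u)) ((der_crd D)^~ n).
Proof.
move=> lD; pose L : {linear g -> g} := HB.pack D (GRing.isLinear.Build K g g *:%R D lD).
rewrite -[D]/(L : g -> g) -{1}(PsiK u) {1}(osp_sum (Psi u)) !linear_sum /=.
rewrite (big_morph (crd n) (fun a b => crdD n a b) (crd0 n)) -sum17E.
apply: eq_bigr => k _.
have LZ c u' : D (c *: u') = c *: D u' by exact: (linearZ_LR L).
by rewrite PhiZ LZ PsiZ crdZ.
Qed.

Lemma der_crd_im D k n : (5 < n < 9)%N -> der_crd D k n = 0.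
Proof. exact/crd_im/PsiP. Qed.

Lemma der_crd_rel b D k l n : superder b D -> psl_index k -> psl_index l ->
  (n < 17)%N ->
  sum17 (br_crd false (unit_crd K k) (unit_crd K l)) ((der_crd D)^~ n) =
  br_crd false (der_crd D k) (unit_crd K l) n +
  (-1) ^+ (b && (8 < k)%N) * br_crd false (unit_crd K k) (der_crd D l) n.
Proof.
move=> [lD _ dD] hk hl n17.
have hob := Psi_ob.
have obE j : crd^~ (ob j) = fun m => if (m < 17)%N then unit_crd K j m else 0.
  by apply: funext => m; rewrite crd_ob.
have := congr1 (fun v => crd n (Psi v)) (dD (8 < k)%N (Phi (ob k)) (Phi (ob l)) _).
rewrite (Psi_homog _ (Phi (ob k))) hob // => /(_ (ob_homog k)) e.
rewrite PsiD PsiZ !Psi_br crdD crdZ !crd_brn !hob // in e.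
rewrite crd_der // Psi_br !hob // crd_br !obE in e.
have unitE F n' : br_crd false F (fun m => if (m < 17)%N then unit_crd K l m else 0) n' = br_crd false F (unit_crd K l) n'.
  by do 17?[case: n' => [|n']].
have unitE' F n' : br_crd false (fun m => if (m < 17)%N then unit_crd K k m else 0) F n' = br_crd false (unit_crd K k) F n'.
  by do 17?[case: n' => [|n']].
have unitE2 : br_crd false (fun m => if (m < 17)%N then unit_crd K k m else 0) (fun m => if (m < 17)%N then unit_crd K l m else 0) = br_crd false (unit_crd K k) (unit_crd K l).
  by apply: funext => m; rewrite unitE unitE'.
by move: e; rewrite unitE2 unitE unitE'.
Qed.

Lemma der_crd_inj D E : linear D -> linear E ->
  (forall k n, psl_index k -> (n < 17)%N -> der_crd D k n = der_crd E k n) -> D = E.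
Proof.
move=> lD lE h; apply: funext => u; apply: Psi_inj; apply: crd_ext => n n17.
rewrite !crd_der // /sum17.
have im := crd_im (PsiP u).
by rewrite !(im 6) ?(im 7) ?(im 8) ?mul0r ?addr0 // !h.
Qed.

Lemma der_crd_delta a k n : psl_index k -> (n < 17)%N ->
  der_crd (delta a) k n = br_crd false (crd^~ a) (unit_crd K k) n.
Proof.
move=> hk n17; rewrite /der_crd Psi_delta Psi_ob // crd_brn.
have -> : crd^~ (ob k) = fun m => if (m < 17)%N then unit_crd K k m else 0.
  by apply: funext => m; rewrite crd_ob.
by do 17?[case: n n17 => [|n] n17].
Qed.

(* The element whose adjoint action agrees with [D] in the coordinates that
   the hypotheses [c_H1], [c_H2], [c_E], [c_e] of section Normalized set to 0. *)
Definition der_elt (D : g -> g) : M :=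
  let c := der_crd D in
  elt (nth 0 [:: c 1%N 1%N / 2; - c 0%N 1%N / 2; c 0%N 2%N / 2;
    c 4%N 4%N / 2; - c 3%N 4%N / 2; c 3%N 5%N / 2;
    c 9%N 9%N - c 1%N 1%N / 2 - c 4%N 4%N / 2; c 10%N 9%N; c 9%N 10%N;
    - c 0%N 9%N; - c 0%N 10%N; - c 0%N 11%N; - c 0%N 12%N; c 0%N 13%N; c 0%N 14%N; c 0%N 15%N; c 0%N 16%N]).

Lemma der_crd_par b D k n : superder b D -> psl_index k ->
  (8 < n)%N != b (+) (8 < k)%N -> der_crd D k n = 0.
Proof.
move=> [_ pD _] hk hn.
have hk' : homog (8 < k)%N (Phi (ob k)).
  by apply/Psi_homog; rewrite Psi_ob //; apply: ob_homog.
have /Psi_homog := pD _ _ hk'; rewrite /der_crd => <-.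
by rewrite crd_spartn (negPf hn).
Qed.

Lemma der_elt_homog b D : superder b D -> homog b (der_elt D).
Proof.
move=> hD; apply: crd_ext => n n17; rewrite crd_spartn crd_eltn //.
have z k m : psl_index k -> (8 < m)%N != b (+) (8 < k)%N -> der_crd D k m = 0.
  exact: der_crd_par hD.
case: eqP => // /eqP; move: n17.
do 17?[case: n => [|n]] => //= _; case: (b) z => // z _;
  by rewrite !z //; ring.
Qed.

(** The entries of [der_elt] solve the 17 normalizing equations for the difference [E], which is
    again a derivation of parity [b]; so [normalized_eq0] applies to it. *)
Theorem superder_delta_elt b D : superder b D -> D = delta (der_elt D).
Proof.
move=> hD; set a := der_elt D.
pose E := (- 1) *: delta a + D.
have hE : superder b E.
  exact/superderL/hD/superder_delta/der_elt_homog.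
have cE k n : psl_index k -> (n < 17)%N ->
    der_crd E k n = der_crd D k n - br_crd false (crd^~ a) (unit_crd K k) n.
  by move=> hk n17; rewrite -der_crd_delta // /der_crd PsiD PsiZ crdD crdZ mulN1r addrC.
have aE n : (n < 17)%N -> crd n a = _ := fun h => crd_eltn _ h.
suff E0 : E = 0.
  by move/eqP: E0; rewrite /E scaleN1r addrC subr_eq0 => /eqP.
have [lE _ _] := hE; apply: der_crd_inj => //.
  by move=> k u v; rewrite scaler0 addr0.
move=> k n hk n17; rewrite [RHS]/der_crd Psi0 crd0.
apply: (@normalized_eq0 K b) => //.
- by move=> *; apply: der_crd_rel.
- by move=> *; apply: der_crd_im.
- move=> n' hn; have n17' : (n' < 17)%N.
    by move: hn; rewrite !inE; do 17?[case: n' => [|n']].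
  rewrite cE // /br_crd /omega2 /unit_crd; clear n17'.
  by move: hn; do 17?[case: n' => [|n'] //] => _; rewrite /= !aE //=; field; exact: two0.
- by split; rewrite cE // /br_crd /omega2 /unit_crd /= !aE //=; field; exact: two0.
- by split; rewrite cE // /br_crd /omega2 /unit_crd /= !aE //=; field; exact: two0.
- by split; rewrite cE // /br_crd /omega2 /unit_crd /= !aE //=; field; exact: two0.
Qed.

Theorem der_delta D : is_der D -> exists a, D = delta a.
Proof.
case=> D0 [D1 [h0 h1 ->]]; exists (der_elt D0 + der_elt D1).
apply: funext => u; rewrite deltaD.
by rewrite -(superder_delta_elt h0) -(superder_delta_elt h1).
Qed.

(** The 17 normalizing coordinates of the action of [a] determine [a], its part in sl(V_3) included;
    in other words, the ideal has trivial centralizer in [M]. *)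
Lemma der_elt_delta a : der_elt (delta a) = a.
Proof.
apply: crd_ext => n n17; rewrite crd_eltn // !der_crd_delta // /br_crd /omega2 /unit_crd.
by do 17?[case: n n17 => [|n] // n17]; rewrite /=; field; rewrite ?two0.
Qed.

Lemma delta_inj : injective delta.
Proof. by move=> a b e; rewrite -[a]der_elt_delta e der_elt_delta. Qed.

Definition der_to (D : der g) : M := der_elt D.
Definition der_from (a : M) : der g := Der (asboolT (delta_der a)).

Lemma der_toP (D : der g) : (D : g -> g) = delta (der_to D).
Proof. by have [a ha] := der_delta (derP D); rewrite /der_to ha der_elt_delta. Qed.

Lemma der_fromK : cancel der_from der_to.
Proof. exact: der_elt_delta. Qed.
Lemma der_toK : cancel der_to der_from.
Proof. by move=> D; apply: val_inj; rewrite /= -der_toP. Qed.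

Fact der_to_linear : linear der_to.
Proof.
move=> k D E; apply: delta_inj; rewrite -der_toP delta_linear -!der_toP.
exact: (linearP (val : der g -> (g -> g))).
Qed.
HB.instance Definition _ := GRing.isLinear.Build K (der g) M *:%R der_to der_to_linear.

Theorem der_superiso : superiso (der g) M.
Proof.
exists der_to; split; last by exists der_from; [exact: der_toK | exact: der_fromK].
split=> [b D|D E]; apply: delta_inj; rewrite -der_toP /=.
  by rewrite -fpart_delta -der_toP.
by rewrite -scomm_delta -!der_toP.
Qed.

(** * Root vectors and torus in coordinates *)

Definition root (k : nat) (e : K) : g := Phi (e *: ob k).

Lemma crd_root k e n : psl_index k -> (n < 17)%N -> crd n (Psi (root k e)) = e * unit_crd K k n.
Proof.
move=> hk n17; rewrite PhiK ?crdZ ?crd_ob ?n17 //.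
by have [h6 h7 h8] := ob_im hk; split; rewrite crdZ ?h6 ?h7 ?h8 mulr0.
Qed.

(** The order is x_1, ..., x_6, y_1, ..., y_6. With [root_coef] these are the coordinates of the
    matrices E_12, E_23, E_34, E_13, E_24, -E_14 and E_21, E_32, E_43, -E_31, -E_42, -E_41 under the
    embedding of sl(2|2) modulo scalars; the halves belong to the lower left block. *)
Definition root_idx := [:: 1; 15; 4; 11; 13; 9; 2; 10; 5; 14; 12; 16]%N.
Definition root_coef : seq K :=
  [:: 1; 1; 1; 1; -1; 1; 1; - 2^-1; 1; - 2^-1; 2^-1; - 2^-1].
Definition root_vec (i : nat) : g := root (nth 0%N root_idx i) (nth 0 root_coef i).
Definition torus_psl : set g :=
  [set t | forall n, (n < 17)%N -> n != 0%N -> n != 3%N -> crd n (Psi t) = 0].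
Definition root_vectors := [tuple root_vec i | i < 12].

Lemma root_coef_neq0 i : (i < 12)%N -> nth 0 root_coef i != 0.
Proof.
by do 12?[case: i => [|i]] => //= _; rewrite ?oppr_eq0 ?invr_eq0 ?oner_eq0.
Qed.

Lemma root_idxP i : (i < 12)%N -> psl_index (nth 0%N root_idx i).
Proof. by do 12?[case: i => [|i]]. Qed.

Lemma root_idx_uniq i j : (i < 12)%N -> (j < 12)%N ->
  (nth 0%N root_idx i == nth 0%N root_idx j) = (i == j).
Proof. by move=> hi hj; rewrite nth_uniq. Qed.

Lemma crd_Psi_sum n (I : Type) (r : seq I) (F : I -> g) :
  crd n (Psi (\sum_(i <- r) F i)) = \sum_(i <- r) crd n (Psi (F i)).
Proof.
apply: (big_morph (fun u => crd n (Psi u))) => [u v|]; first by rewrite PsiD crdD.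
by rewrite Psi0 crd0.
Qed.

Lemma crd_root_vec i n : (i < 12)%N -> (n < 17)%N ->
  crd n (Psi (root_vec i)) = nth 0 root_coef i * (n == nth 0%N root_idx i)%:R.
Proof. by move=> hi hn; rewrite crd_root // root_idxP. Qed.

Lemma crd_comb (c : 'I_12 -> K) (i : 'I_12) :
  crd (nth 0%N root_idx i) (Psi (\sum_j c j *: tnth root_vectors j)) =
  c i * nth 0 root_coef i.
Proof.
have i17 : (nth 0%N root_idx i < 17)%N by case/andP: (root_idxP (ltn_ord i)).
rewrite crd_Psi_sum (bigD1 i) //= tnth_mktuple PsiZ crdZ crd_root_vec // eqxx mulr1.
rewrite big1 ?addr0 // => j ji; rewrite tnth_mktuple PsiZ crdZ crd_root_vec //.
by rewrite root_idx_uniq // eq_sym val_eqE (negPf ji) !mulr0.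
Qed.

Lemma root_idx_surj n : psl_index n -> n != 0%N -> n != 3%N ->
  exists i : 'I_12, n = nth 0%N root_idx i.
Proof.
move=> hn n0 n3; have h : (index n root_idx < 12)%N.
  by rewrite -[12%N]/(size root_idx) index_mem; move: hn n0 n3; do 17?[case: n => [|n]].
by exists (Ordinal h); rewrite nth_index // -index_mem.
Qed.

Theorem root_basis : basis_mod [set: g] torus_psl root_vectors.
Proof.
split=> // [z _|c hc i]; last first.
  have /eqP := crd_comb c i; rewrite hc; last first.
  - by case: i => i; do 12?[case: i => [|i]].
  - by case: i => i; do 12?[case: i => [|i]].
  - by case/andP: (root_idxP (ltn_ord i)).
  by rewrite eq_sym mulf_eq0 (negPf (root_coef_neq0 (ltn_ord i))) orbF => /eqP.
pose c (i : 'I_12) := crd (nth 0%N root_idx i) (Psi z) / nth 0 root_coef i.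
exists c, (z - \sum_i c i *: tnth root_vectors i); split; last by rewrite addrC subrK.
move=> n n17 n0 n3.
rewrite PsiB crdD -scaleN1r crdZ mulN1r.
case hn : (psl_index n).
  have [i ->] := root_idx_surj hn n0 n3.
  by rewrite crd_comb divfK ?subrr // root_coef_neq0.
have h : (5 < n < 9)%N by move/negbT: hn; rewrite /psl_index n17 negb_or -!leqNgt.
by rewrite !(crd_im (PsiP _) h) subr0.
Qed.

Definition rv_set : set g := [set u | u \in (root_vectors : seq g) \/ torus_psl u].

Lemma rv_setP u : rv_set u -> torus_psl u \/ exists2 i, (i < 12)%N & u = root_vec i.
Proof.
case=> [/tnthP[i ->]|]; [right|by left].
by exists i => //; rewrite tnth_mktuple.
Qed.

Lemma br_crd_eq (F F' G G' : nat -> K) n :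
  (forall m, (m < 17)%N -> F m = F' m) -> (forall m, (m < 17)%N -> G m = G' m) ->
  (n < 17)%N -> br_crd false F G n = br_crd false F' G' n.
Proof.
move=> eF eG n17; rewrite /br_crd /omega2.
by do 17?[case: n n17 => [|n] // n17]; rewrite !eF // !eG.
Qed.

Lemma crd_delta_root A i n : (i < 12)%N -> (n < 17)%N ->
  crd n (Psi (delta (elt A) (root_vec i))) =
  nth 0 root_coef i *
  br_crd false (fun m => if (m < 17)%N then A m else 0) (unit_crd K (nth 0%N root_idx i)) n.
Proof.
move=> hi hn; rewrite Psi_delta crd_brn crd_elt; apply: br_crd_scale => // m hm.
by rewrite crd_root_vec // mulrC.
Qed.

Lemma delta_rootP A i j e : (i < 12)%N -> (j < 12)%N ->
  (forall n, (n < 17)%N ->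
    nth 0 root_coef i *
    br_crd false (fun m => if (m < 17)%N then A m else 0) (unit_crd K (nth 0%N root_idx i)) n =
    e * (nth 0 root_coef j * (n == nth 0%N root_idx j)%:R)) ->
  delta (elt A) (root_vec i) = e *: root_vec j.
Proof.
move=> hi hj h; apply: Psi_inj; apply: crd_ext => n hn.
by rewrite crd_delta_root // h // PsiZ crdZ crd_root_vec.
Qed.

Lemma delta_torus A t : torus_psl t ->
  (forall n, (n < 17)%N -> n \notin [:: 0; 3; 6; 7; 8]%N -> A n = 0) ->
  delta (elt A) t = 0.
Proof.
move=> ht hA; apply: Psi_inj; rewrite Psi_delta Psi0; apply: crd_ext => n n17.
rewrite crd0 crd_brn crd_elt /br_crd /omega2.
have tz m (h : (m < 17)%N) (h' : (m != 0)%N && (m != 3)%N) : crd m (Psi t) = 0.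
  by case/andP: h' => m0 m3; apply: ht.
have zt := (tz 1 isT isT, tz 2 isT isT, tz 4 isT isT, tz 5 isT isT, tz 6 isT isT,
  tz 7 isT isT, tz 8 isT isT, tz 9 isT isT, tz 10 isT isT, tz 11 isT isT,
  tz 12 isT isT, tz 13 isT isT, tz 14 isT isT, tz 15 isT isT, tz 16 isT isT)%N.
have zA := (hA 1 isT isT, hA 2 isT isT, hA 4 isT isT, hA 5 isT isT,
  hA 9 isT isT, hA 10 isT isT, hA 11 isT isT,
  hA 12 isT isT, hA 13 isT isT, hA 14 isT isT, hA 15 isT isT, hA 16 isT isT)%N.
by do 17?[case: n n17 => [|n] // n17]; rewrite /= !zt ?zA; ring.
Qed.

Fact delta_is_linear a : linear (delta a).
Proof.
by move=> k u v; apply: Psi_inj; rewrite Psi_delta !PsiD !PsiZ !Psi_delta sbrDr sbrZr.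
Qed.
HB.instance Definition _ a := GRing.isLinear.Build K g g *:%R (delta a) (delta_is_linear a).

(** * The derivations D_{-4}, D_0 and the automorphism theta *)

Definition D4_elt : M := elt (fun n => - 2^-1 * (n == 8)%:R).
(** This is (H_3 - H_2) / 2. The outer part is H_3 / 2; the inner part -H_2 / 2 gives x_3 the
    eigenvalue -1 and cancels the eigenvalues of x_5 and x_6. *)
Definition D0_elt : M := elt (fun n => - 2^-1 * (n == 3)%:R + 2^-1 * (n == 6)%:R).

Notation r i := (root_vec i).
Ltac table := by do 17?[case=> [|]] => // _;
  rewrite /br_crd /omega2 /unit_crd /=; field; rewrite ?two0.

(** F_3 raises the index of an odd coordinate by 1, from the upper right block of gl(2|2) to the
    lower left one. The factor -1/2 is the coefficient of y_6, and the remaining signs are those of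
    [root_coef]. *)
Lemma D4_root : [/\ delta D4_elt (r 1) = r 11, delta D4_elt (r 3) = - r 10,
  delta D4_elt (r 4) = - r 9, delta D4_elt (r 5) = r 7 &
  forall i, (i < 12)%N -> i \notin [:: 1; 3; 4; 5]%N -> delta D4_elt (r i) = 0].
Proof.
split=> [||||i hi hn].
- rewrite -[RHS]scale1r. apply: delta_rootP => //. table.
- rewrite -scaleN1r. apply: delta_rootP => //. table.
- rewrite -scaleN1r. apply: delta_rootP => //. table.
- rewrite -[RHS]scale1r. apply: delta_rootP => //. table.
- rewrite -(scale0r (r 0)); apply: delta_rootP => // n hn'; move: hn.
  by do 12?[case: i hi => [|i] hi] => // _;
    do 17?[case: n hn' => [|n] // hn']; rewrite /br_crd /omega2 /unit_crd /=; field; rewrite ?two0.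
Qed.

Lemma D0_root : [/\ delta D0_elt (r 1) = r 1, delta D0_elt (r 2) = - r 2 & delta D0_elt (r 3) = r 3]
  /\ [/\ delta D0_elt (r 7) = - r 7, delta D0_elt (r 8) = r 8 & delta D0_elt (r 9) = - r 9] /\
  forall i, (i < 12)%N -> i \notin [:: 1; 2; 3; 7; 8; 9]%N -> delta D0_elt (r i) = 0.
Proof.
split; last split; last move=> i hi hn.
- split; [rewrite -[RHS]scale1r|rewrite -scaleN1r|rewrite -[RHS]scale1r];
    apply: delta_rootP => //; table.
- split; [rewrite -scaleN1r|rewrite -[RHS]scale1r|rewrite -scaleN1r];
    apply: delta_rootP => //; table.
- rewrite -(scale0r (r 0)); apply: delta_rootP => // n hn'; move: hn.
  by do 12?[case: i hi => [|i] hi] => // _;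
    do 17?[case: n hn' => [|n] // hn']; rewrite /br_crd /omega2 /unit_crd /=; field; rewrite ?two0.
Qed.

(* On V_1 (x) V_2 (x) V_3: exchange the basis vectors of V_1 and of V_2, act on
   V_3 by [e_0 |-> - e_1 / 2], [e_1 |-> 2 e_0], and multiply by [s]. The inverse
   of the automorphism obtained for [s = 1] is the map for [s = -1]. *)
Definition theta_crd (s : K) (F : nat -> K) (n : nat) : K :=
  nth 0 [:: - F 0%N; F 2%N; F 1%N; - F 3%N; F 5%N; F 4%N; 0; 0; 0;
    s * (2 * F 16%N); s * - (F 15%N / 2); s * (2 * F 14%N); s * - (F 13%N / 2);
    s * (2 * F 12%N); s * - (F 11%N / 2); s * (2 * F 10%N); s * - (F 9%N / 2)] n.

Definition theta (s : K) (u : g) : g := Phi (elt (theta_crd s (crd^~ (Psi u)))).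

Lemma crd_theta s u n : (n < 17)%N ->
  crd n (Psi (theta s u)) = theta_crd s (crd^~ (Psi u)) n.
Proof. by move=> n17; rewrite PhiK ?crd_eltn //; split; rewrite crd_eltn. Qed.

Fact theta_linear s : linear (theta s).
Proof.
move=> k u v; apply: Psi_inj; apply: crd_ext => n n17.
rewrite PsiD PsiZ crdD crdZ !crd_theta //.
do 17?[case: n n17 => [|n] // n17]; rewrite /theta_crd /= ?PsiD ?PsiZ ?crdD ?crdZ; ring.
Qed.
HB.instance Definition _ s := GRing.isLinear.Build K g g *:%R (theta s) (theta_linear s).

Lemma crd_psl u n : (5 < n < 9)%N -> crd n (Psi u) = 0.
Proof. exact/crd_im/PsiP. Qed.

Lemma theta_superhom : superhom (theta 1).
Proof.
split=> [b u|u v]; apply: Psi_inj; apply: crd_ext => n n17.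
  rewrite crd_theta // !Psi_spart crd_spartn crd_theta // crd_spart.
  by case: b; do 17?[case: n n17 => [|n] // n17]; rewrite /theta_crd /=; ring.
rewrite crd_theta // !Psi_br crd_br crd_brn.
rewrite (@br_crd_eq _ (theta_crd 1 (crd^~ (Psi u))) _ (theta_crd 1 (crd^~ (Psi v)))) //;
  try by move=> m; apply: crd_theta.
have [z6 z7 z8] := PsiP u; have [z6' z7' z8'] := PsiP v.
do 17?[case: n n17 => [|n] // n17];
  rewrite /theta_crd /br_crd /omega2 /= ?(z6, z7, z8, z6', z7', z8'); field; rewrite ?two0 //.
Qed.

Lemma thetaK s : s * s = 1 -> cancel (theta s) (theta (- s)).
Proof.
move=> ss u; apply: Psi_inj; apply: crd_ext => n n17; rewrite crd_theta //.
have s0 : s != 0.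
  by apply/eqP => s0; move/eqP: ss; rewrite s0 mul0r eq_sym oner_eq0.
have [z6 z7 z8] := PsiP u; set T := fun m => crd m (Psi (theta s u)).
have hT m : (m < 17)%N -> T m = theta_crd s (crd^~ (Psi u)) m by apply: crd_theta.
do 17?[case: n n17 => [|n] // n17];
  rewrite /theta_crd /= !hT // /theta_crd /= ?(z6, z7, z8) ?opprK //;
  rewrite -[RHS]mul1r -ss; field; rewrite ?two0 ?s0 //.
Qed.

Lemma theta_rootP s i j e : (i < 12)%N -> (j < 12)%N ->
  (forall n, (n < 17)%N ->
    theta_crd s (fun m => nth 0 root_coef i * (m == nth 0%N root_idx i)%:R) n =
    e * (nth 0 root_coef j * (n == nth 0%N root_idx j)%:R)) ->
  theta s (root_vec i) = e *: root_vec j.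
Proof.
move=> hi hj h; apply: Psi_inj; apply: crd_ext => n hn.
rewrite crd_theta // PsiZ crdZ crd_root_vec // -h // /theta_crd.
by do 17?[case: n hn => [|n] // hn]; rewrite /= !crd_root_vec.
Qed.

Ltac theta_table := by do 17?[case=> [|]] => // _;
  rewrite /theta_crd /=; field; rewrite ?two0.

Lemma theta_root :
  [/\ theta 1 (r 0) = r 6, theta 1 (r 1) = r 7 & theta 1 (r 2) = r 8] /\
  [/\ theta 1 (r 6) = r 0, theta 1 (r 7) = - r 1 & theta 1 (r 8) = r 2].
Proof.
split; split; [rewrite -[RHS]scale1r|rewrite -[RHS]scale1r|rewrite -[RHS]scale1r|
  rewrite -[RHS]scale1r|rewrite -scaleN1r|rewrite -[RHS]scale1r];
  apply: theta_rootP => //; theta_table.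
Qed.

Definition D4'_elt : M := elt (fun n => 2 * (n == 7)%:R).

(** theta acts on the factor V_3 by an element of SL(V_3), and this element conjugates -F_3 / 2 to 2
    E_3. *)
Lemma theta_D4 : theta 1 \o delta D4_elt \o theta (-1) = delta D4'_elt.
Proof.
apply: funext => u; apply: Psi_inj; apply: crd_ext => n n17.
rewrite crd_theta // !Psi_delta !crd_brn !crd_br !crd_elt.
have [z6 z7 z8] := PsiP u; set T := fun m => crd m (Psi (theta _ u)).
have hT m : (m < 17)%N -> T m = theta_crd (-1) (crd^~ (Psi u)) m by apply: crd_theta.
do 17?[case: n n17 => [|n] // n17];
  rewrite /theta_crd /br_crd /omega2 /= ?hT // /theta_crd /= ?(z6, z7, z8);
  field; rewrite ?two0 //.
Qed.

Definition D4_table := [:: (r 1, r 11); (r 3, - r 10); (r 4, - r 9); (r 5, r 7)].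
Definition D0_table := [:: (r 1, r 1); (r 2, - r 2); (r 3, r 3);
  (r 7, - r 7); (r 8, r 8); (r 9, - r 9)].

Lemma D4_given : given_by rv_set D4_table (delta D4_elt).
Proof.
have [e1 e3 e4 e5 e0] := D4_root; split.
  by move=> q; rewrite !inE => /or4P[] /eqP->.
move=> u hu; case: (rv_setP hu) => [tu _|[i hi ->]].
  apply: delta_torus => // n n17 h; case: eqP => [e|]; last by rewrite mulr0.
  by rewrite e in h.
case h : (i \in [:: 1; 3; 4; 5]%N); last by rewrite e0 // h.
by move: h; rewrite /= !inE => /or4P[] /eqP ->; rewrite eqxx ?orbT.
Qed.

Lemma D0_given : given_by rv_set D0_table (delta D0_elt).
Proof.
have [[e1 e2 e3] [[e7 e8 e9] e0]] := D0_root; split.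
  by move=> q; rewrite !inE => /or4P[|||/or3P[]] /eqP->.
move=> u hu; case: (rv_setP hu) => [tu _|[i hi ->]].
  apply: delta_torus => // n n17 h.
  by case: eqP h => [->|_]; case: eqP => [->|_] //; rewrite !mulr0 addr0.
case h : (i \in [:: 1; 2; 3; 7; 8; 9]%N); last by rewrite e0 // h.
by move: h; rewrite /= !inE => /or4P[|||/or3P[]] /eqP ->; rewrite eqxx ?orbT.
Qed.

Theorem der_basis : basis_mod [set D : g -> g | is_der D] [set D : g -> g | is_inner D]
  [tuple (delta D4_elt : g -> g); (delta D0_elt : g -> g);
         theta 1 \o delta D4_elt \o theta (-1)].
Proof.
have combE (c : 'I_3 -> K) : \sum_i c i *: tnth [tuple delta D4_elt; delta D0_elt;
    theta 1 \o delta D4_elt \o theta (-1)] i =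
    delta (c 0 *: D4_elt + (c 1 *: D0_elt + (c 2 *: D4'_elt + 0))).
  rewrite !delta_linear delta0 theta_D4 !big_ord_recl big_ord0 !(tnth_nth 0) /=.
  by congr (c _ *: _ + (c _ *: _ + (c _ *: _ + _))); apply: val_inj.
have crdE (c : 'I_3 -> K) n : (n < 17)%N ->
    crd n (c 0 *: D4_elt + (c 1 *: D0_elt + (c 2 *: D4'_elt + 0))) =
    c 0 * (- 2^-1 * (n == 8)%:R) + (c 1 * (- 2^-1 * (n == 3)%:R + 2^-1 * (n == 6)%:R)
    + c 2 * (2 * (n == 7)%:R)).
  by move=> n17; rewrite !crd_linear crd0 !crd_eltn // addr0.
split.
- move=> i; rewrite (tnth_nth 0) theta_D4.
  by case: i => [[|[|[|//]]]] /= _; apply: delta_der.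
- move=> D /der_delta[a ->].
  (* The coefficients that cancel coordinates 8, 6 and 7 of [a], so that the difference lies in the
     ideal and acts as an inner derivation. *)
  pose c (i : 'I_3) := nth 0 [:: - 2 * crd 8%N a; 2 * crd 6%N a; crd 7%N a / 2] i.
  pose d := c 0 *: D4_elt + (c 1 *: D0_elt + (c 2 *: D4'_elt + 0)).
  exists c, (delta (a - d)); split; last first.
    by rewrite combE -/d; apply: funext => u; rewrite -[RHS]deltaD addrC subrK.
  apply/is_inner_delta; exists (a - d) => //.
  by split; rewrite crdD -scaleN1r crdZ crdE // /c /=; field; rewrite ?two0.
- move=> c; rewrite combE => /is_inner_delta[a [h6 h7 h8]] /delta_inj e.
  rewrite -{}e !crdE //= in h6 h7 h8.
  have i0 : (2^-1 : K) != 0 by rewrite invr_eq0.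
  move=> i; case: i => [[|[|[|//]]]] hi.
  + rewrite (_ : Ordinal hi = 0); last exact: val_inj.
    by apply: (mulfI i0); rewrite mulr0 -[RHS]oppr0 -{}h8; ring.
  + rewrite (_ : Ordinal hi = 1); last exact: val_inj.
    by apply: (mulfI i0); rewrite mulr0 -{}h6; ring.
  + rewrite (_ : Ordinal hi = 2); last exact: val_inj.
    by apply: (mulfI two0); rewrite mulr0 -{}h7; ring.
Qed.

(** * Dual coordinates, wedges and the three cocycles *)

Definition hat (i : nat) (u : g) : K := crd (nth 0%N root_idx i) (Psi u) / nth 0 root_coef i.

Lemma hat_linear i k u v : hat i (k *: u + v) = k * hat i u + hat i v.
Proof. by rewrite /hat PsiD PsiZ crd_linear mulrDl mulrA. Qed.

Lemma hat_root i j : (i < 12)%N -> (j < 12)%N -> hat i (root_vec j) = (i == j)%:R.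
Proof.
move=> hi hj; rewrite /hat crd_root_vec ?root_idx_uniq //; last first.
  by case/andP: (root_idxP hi).
by case: eqP => [->|_]; rewrite ?mulr0 ?mul0r // mulr1 divff // root_coef_neq0.
Qed.

Lemma hat_torus i t : (i < 12)%N -> torus_psl t -> hat i t = 0.
Proof.
move=> hi ht; rewrite /hat ht ?mul0r //.
- by case/andP: (root_idxP hi).
- by do 12?[case: i hi => [|i] // hi].
- by do 12?[case: i hi => [|i] // hi].
Qed.

Lemma hat_rv_set i a : (i < 12)%N -> rv_set a -> a <> root_vec i -> hat i a = 0.
Proof.
move=> hi ha ai; case: (rv_setP ha) => [|[j hj e]]; first exact: hat_torus.
by rewrite e hat_root //; case: eqP => // ij; case: ai; rewrite e ij.
Qed.

Definition root_par i := (8 < nth 0%N root_idx i)%N.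

Lemma hat_par i b u : homog b u -> b != root_par i -> hat i u = 0.
Proof. by move=> <- h; rewrite /hat Psi_spart crd_spartn eq_sym (negPf h) mul0r. Qed.

(** A single sign is right because the two root vectors have the same parity in every wedge that
    occurs. *)
Definition wedge (i j : nat) (u v : g) : K^o :=
  hat i u * hat j v - (-1) ^+ root_par i * (hat j u * hat i v).

Lemma wedgeP i j : (i < 12)%N -> (j < 12)%N -> i != j -> root_par i = root_par j ->
  is_wedge rv_set (root_vec i) (root_vec j) (wedge i j).
Proof.
move=> hi hj ij pij; split.
- split=> [v k u u'|u k v v']; rewrite /wedge !hat_linear /GRing.scale /=; ring.
- move=> b c x y hx hy; rewrite /wedge.
  case hb : (b == root_par i); last first.
    by rewrite !(hat_par (i := i) hx) ?hb // (hat_par (i := j) hx) -?pij ?hb // !(mul0r, mulr0, subr0, oppr0).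
  case hc : (c == root_par i); last first.
    by rewrite !(hat_par (i := i) hy) ?hc // (hat_par (i := j) hy) -?pij ?hc // !(mul0r, mulr0, subr0, oppr0).
  rewrite (eqP hb) (eqP hc) andbb; case: (root_par i); rewrite /=; ring.
- by rewrite /wedge !hat_root // !eqxx eq_sym (negPf ij) mulr1 mul0r mulr0 subr0.
move=> a b ha hb h1 h2; rewrite /wedge.
have -> : hat i a * hat j b = 0.
  case: (pselect (a = root_vec i)) => [ea|na]; last by rewrite (hat_rv_set hi ha na) mul0r.
  case: (pselect (b = root_vec j)) => [eb|nb]; last by rewrite (hat_rv_set hj hb nb) mulr0.
  by case: h1; rewrite ea eb.
have -> : hat j a * hat i b = 0.
  case: (pselect (a = root_vec j)) => [ea|na]; last by rewrite (hat_rv_set hj ha na) mul0r.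
  case: (pselect (b = root_vec i)) => [eb|nb]; last by rewrite (hat_rv_set hi hb nb) mulr0.
  by case: h2; rewrite ea eb.
by rewrite mulr0 subr0.
Qed.

(** Numbers 1 and 2 are multiples of the form omega_1 omega_2 on V_1 (x) V_2 (x) e_1 and on V_1 (x)
    V_2 (x) e_0. Number 0 equals the component of psi_3 on H only up to the coboundary of the
    coordinate on H_2. *)
Definition coc_crd (k : nat) (F G : nat -> K) : K :=
  match k with
  | 0 => - 2 * (F 15%N * G 10%N + F 10%N * G 15%N) + (F 4%N * G 5%N - F 5%N * G 4%N)
         + 2 * (F 11%N * G 14%N + F 14%N * G 11%N)
  | 1 => 4 * (F 10%N * G 16%N + F 16%N * G 10%N) - 4 * (F 14%N * G 12%N + F 12%N * G 14%N)
  | _ => F 15%N * G 9%N + F 9%N * G 15%N - (F 11%N * G 13%N + F 13%N * G 11%N)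
  end.

Definition coc (k : nat) (u v : g) : K^o := coc_crd k (crd^~ (Psi u)) (crd^~ (Psi v)).

Lemma coc0E : wedge 1 7 + wedge 2 8 - wedge 3 9 = coc 0.
Proof.
apply: funext => u; apply: funext => v; rewrite /coc /=.
rewrite -[LHS]/(wedge 1 7 u v + wedge 2 8 u v - wedge 3 9 u v) /wedge /hat /=.
by field; rewrite ?two0 ?oppr_eq0 ?oner_eq0.
Qed.

Lemma coc1E : wedge 7 11 + wedge 9 10 = coc 1.
Proof.
apply: funext => u; apply: funext => v; rewrite /coc /=.
rewrite -[LHS]/(wedge 7 11 u v + wedge 9 10 u v) /wedge /hat /=.
by field; rewrite ?two0 ?oppr_eq0 ?oner_eq0.
Qed.

Lemma coc2E : wedge 1 5 + wedge 3 4 = coc 2.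
Proof.
apply: funext => u; apply: funext => v; rewrite /coc /=.
rewrite -[LHS]/(wedge 1 5 u v + wedge 3 4 u v) /wedge /hat /=.
by field; rewrite ?two0 ?oppr_eq0 ?oner_eq0.
Qed.

Lemma coc_linearl k v : linear ((coc k)^~ v).
Proof.
move=> c u u'; rewrite /coc /coc_crd /GRing.scale /=.
by case: k => [|[|k]]; rewrite ?PsiD ?PsiZ !crd_linear; ring.
Qed.

Lemma coc_linearr k u : linear (coc k u).
Proof.
move=> c v v'; rewrite /coc /coc_crd /GRing.scale /=.
by case: k => [|[|k]]; rewrite ?PsiD ?PsiZ !crd_linear; ring.
Qed.

Lemma crd_homog b u : homog b u ->
  crd^~ (Psi u) = fun n => if (8 < n)%N == b then crd n (Psi u) else 0.
Proof. by move=> hu; rewrite -{1}hu Psi_spart crd_spart. Qed.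

Lemma coc_crd_cocycle k b c (x y z : nat -> K)
    (F := fun n => if (8 < n)%N == b then x n else 0)
    (G := fun n => if (8 < n)%N == c then y n else 0) :
  (forall n, (5 < n < 9)%N -> [/\ x n = 0, y n = 0 & z n = 0]) ->
  coc_crd k (br_crd false F G) z =
  coc_crd k F (br_crd false G z) - (-1) ^+ (b && c) * coc_crd k G (br_crd false F z).
Proof.
move=> h; have [x6 y6 z6] := h 6%N isT; have [x7 y7 z7] := h 7%N isT; have [x8 y8 z8] := h 8%N isT.
by case: k => [|[|k]]; rewrite /F /G /coc_crd /br_crd /omega2; case: b {F}; case: c {G};
  rewrite /= ?(x6, y6, z6, x7, y7, z7, x8, y8, z8); ring.
Qed.

Lemma coc_cocycle k : is_cocycle (coc k).
Proof.
split; first by split=> [v|u]; [exact: coc_linearl | exact: coc_linearr].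
- move=> b c x y hx hy; rewrite /coc (crd_homog hx) (crd_homog hy).
  by case: k => [|[|k]]; rewrite /coc_crd; case: b {hx}; case: c {hy}; rewrite /=; ring.
- move=> b c x y z hx hy; rewrite /coc !Psi_br !crd_br (crd_homog hx) (crd_homog hy).
  by apply: coc_crd_cocycle => n hn; rewrite !crd_psl.
- move=> _ x hx; rewrite /coc Psi_br crd_br (crd_homog hx).
  by case: k => [|[|k]]; rewrite /coc_crd /br_crd /omega2 /=; ring.
Qed.

(* Trace forms with opposite signs on sl(V_1) and sl(V_2), and -2 times the
   product of the three symplectic forms on the odd part. *)
Definition beta_crd (F G : nat -> K) : K :=
  2 * F 0%N * G 0%N + F 1%N * G 2%N + F 2%N * G 1%N
  - (2 * F 3%N * G 3%N + F 4%N * G 5%N + F 5%N * G 4%N)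
  - 2 * (F 9%N * G 16%N - F 10%N * G 15%N - F 11%N * G 14%N + F 12%N * G 13%N
         - F 13%N * G 12%N + F 14%N * G 11%N + F 15%N * G 10%N - F 16%N * G 9%N).

Definition beta (a b : M) : K := beta_crd (crd^~ a) (crd^~ b).

Lemma beta_linearl k a a' b : beta (k *: a + a') b = k * beta a b + beta a' b.
Proof. by rewrite /beta /beta_crd !crd_linear; ring. Qed.

Lemma beta_inv a b c : in_psl a -> in_psl b -> in_psl c ->
  beta {[a, b]} c = beta a {[b, c]}.
Proof.
move=> [a6 a7 a8] [b6 b7 b8] [c6 c7 c8]; rewrite /beta !crd_br.
by rewrite /beta_crd /br_crd /omega2 /= !(a6, a7, a8, b6, b7, b8, c6, c7, c8); ring.
Qed.

Lemma beta_ob a k : psl_index k -> beta a (ob k) =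
  nth 0 [:: 2 * crd 0%N a; crd 2%N a; crd 1%N a; - (2 * crd 3%N a); - crd 5%N a; - crd 4%N a;
   0; 0; 0; 2 * crd 16%N a; - (2 * crd 15%N a); - (2 * crd 14%N a); 2 * crd 13%N a;
   - (2 * crd 12%N a); 2 * crd 11%N a; 2 * crd 10%N a; - (2 * crd 9%N a)] k.
Proof.
rewrite /beta /ob crd_elt /beta_crd /unit_crd.
by do 17?[case: k => [|k] //]; move=> _; rewrite /=; ring.
Qed.

(** The Gram matrix in this basis is monomial: each basis vector of the ideal pairs with exactly one
    other or with itself, and the values are 1 or 2 up to sign. *)
Lemma beta_nondeg a : in_psl a -> (forall k, psl_index k -> beta a (ob k) = 0) -> a = 0.
Proof.
move=> ha h; apply: crd_ext => n n17; rewrite crd0.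
case hn : (psl_index n); last first.
  by apply: crd_im ha _; move/negbT: hn; rewrite /psl_index n17 negb_or -!leqNgt.
apply: (mulfI two0); rewrite mulr0.
have h' k hk := etrans (esym (beta_ob a hk)) (h k hk).
move: hn; do 17?[case: n n17 => [|n] // n17] => _.
- by have /= e := h' 0%N isT; rewrite -e; ring.
- by have /= e := h' 2%N isT; rewrite e mulr0.
- by have /= e := h' 1%N isT; rewrite e mulr0.
- by have /= e := h' 3%N isT; rewrite -[RHS]oppr0 -e; ring.
- by have /= e := h' 5%N isT; rewrite -[RHS](mulr0 (- 2)) -e; ring.
- by have /= e := h' 4%N isT; rewrite -[RHS](mulr0 (- 2)) -e; ring.
- by have /= e := h' 16%N isT; rewrite -[RHS]oppr0 -e; ring.
- by have /= e := h' 15%N isT; rewrite -e; ring.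
- by have /= e := h' 14%N isT; rewrite -e; ring.
- by have /= e := h' 13%N isT; rewrite -[RHS]oppr0 -e; ring.
- by have /= e := h' 12%N isT; rewrite -e; ring.
- by have /= e := h' 11%N isT; rewrite -[RHS]oppr0 -e; ring.
- by have /= e := h' 10%N isT; rewrite -[RHS]oppr0 -e; ring.
- by have /= e := h' 9%N isT; rewrite -e; ring.
Qed.

(** * From cocycles to derivations by the invariant form *)

Section Represent.
Variable w : g -> g -> K^o.
Hypothesis w_l : forall y, linear (w^~ y).
Hypothesis w_r : forall x, linear (w x).

Definition wob x k : K := w x (Phi (ob k)).
(** The inverse of the monomial Gram matrix of [beta], applied to the values of [w x] on the
    basis. *)
Definition rep_crd (x : g) (n : nat) : K :=
  nth 0 [:: wob x 0 / 2; wob x 2; wob x 1; - (wob x 3 / 2); - wob x 5; - wob x 4; 0; 0; 0;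
    - (wob x 16 / 2); wob x 15 / 2; wob x 14 / 2; - (wob x 13 / 2);
    wob x 12 / 2; - (wob x 11 / 2); - (wob x 10 / 2); wob x 9 / 2] n.
Definition rep (x : g) : g := Phi (elt (rep_crd x)).

Lemma crd_rep x n : (n < 17)%N -> crd n (Psi (rep x)) = rep_crd x n.
Proof. by move=> n17; rewrite PhiK ?crd_eltn //; split; rewrite crd_eltn. Qed.

Lemma rep_linear : linear rep.
Proof.
move=> c x x'; apply: Psi_inj; apply: crd_ext => n n17.
rewrite PsiD PsiZ crd_linear !crd_rep // /rep_crd.
have e k : wob (c *: x + x') k = c * wob x k + wob x' k by rewrite /wob w_l.
by do 17?[case: n n17 => [|n] // n17]; rewrite /= ?e; ring.
Qed.

Lemma w_sum x y : w x y = sum17 (crd^~ (Psi y)) (wob x).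
Proof.
have wD u v : w x (u + v) = w x u + w x v by have := w_r x 1 u v; rewrite !scale1r.
have w0 : w x 0 = 0 by apply: (addrI (w x 0)); rewrite -wD !addr0.
have wZ k u : w x (k *: u) = k *: w x u by have := w_r x k u 0; rewrite w0 !addr0.
rewrite -{1}(PsiK y) {1}(osp_sum (Psi y)) (big_morph Phi PhiD Phi0).
rewrite (big_morph (w x) wD w0) -sum17E; apply: eq_bigr => k _.
by rewrite PhiZ wZ.
Qed.

Lemma repP x y : beta (Psi (rep x)) (Psi y) = w x y.
Proof.
rewrite w_sum /sum17 /beta /beta_crd !crd_rep // /rep_crd /=.
by have [z6 z7 z8] := PsiP y; rewrite z6 z7 z8; field; rewrite ?two0.
Qed.

Variable b : bool.
Hypothesis w_par : forall c d x y, homog c x -> homog d y -> c (+) d != b -> w x y = 0.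
Hypothesis w_coc : forall c d x y z, homog c x -> homog d y ->
  w {[ x, y ]} z = w x {[ y, z ]} - (-1) ^+ (c && d) * w y {[ x, z ]}.

Lemma beta_nondegP u : (forall v, beta (Psi u) (Psi v) = 0) -> u = 0.
Proof.
move=> h; apply: Psi_inj; rewrite Psi0; apply: beta_nondeg; first exact: PsiP.
by move=> k hk; rewrite -(Psi_ob hk).
Qed.

Lemma rep_par c x : homog c x -> homog (b (+) c) (rep x).
Proof.
move=> hx; apply: Psi_inj; apply: crd_ext => n n17.
rewrite Psi_spart crd_spartn crd_rep //; case: eqP => // /eqP hn.
have z k : psl_index k -> (8 < k)%N != b (+) c -> wob x k = 0.
  move=> hk hbc; apply: (w_par hx (d := (8 < k)%N)).
    by apply/Psi_homog; rewrite Psi_ob //; apply: ob_homog.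
  by move: hbc; case: (8 < k)%N; case: (b); case: (c).
move: hn; rewrite /rep_crd.
by do 17?[case: n n17 => [|n] // n17]; rewrite /= => hn; rewrite ?z ?mul0r ?oppr0.
Qed.

(** Pairing with an arbitrary [z] is enough by nondegeneracy. Invariance of [beta] and antisymmetry
    of the bracket then turn the Leibniz rule into the cocycle identity of [w]. *)
Lemma rep_derivation c d x y : homog c x -> homog d y ->
  rep {[ x, y ]} = {[ rep x, y ]} + (-1 : K) ^+ (b && c) *: {[ x, rep y ]}.
Proof.
move=> hx hy; apply/eqP; rewrite -subr_eq0; apply/eqP; apply: beta_nondegP => z.
rewrite -scaleN1r addrC PsiD PsiZ beta_linearl repP PsiD addrC [Psi _ + _]addrC.
rewrite PsiZ beta_linearl !Psi_br.
have hx' := (Psi_homog _ _).1 hx; have hy' := (Psi_homog _ _).1 (rep_par hy).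
rewrite (skew hx' hy') -scaleNr -[_ *: {[_, _]}]addr0 beta_linearl.
rewrite !beta_inv; try exact: PsiP.
rewrite -!Psi_br !repP (w_coc _ hx hy).
have -> v : beta 0 v = 0 by rewrite /beta /beta_crd !crd0; ring.
by case: b c d {hx hy hx' hy'} => [] [] []; rewrite /=; ring.
Qed.

Lemma rep_superder : superder b rep.
Proof.
split; [exact: rep_linear | exact: rep_par |].
move=> c x y hx.
have repD u v : rep (u + v) = rep u + rep v by have := rep_linear 1 u v; rewrite !scale1r.
rewrite -(spartD y) !sbrDr repD !(rep_derivation hx (homog_spart _ _)).
by rewrite repD sbrDr scalerDr addrACA.
Qed.
End Represent.

(** The component of parity [b]. A cocycle may be mixed, while the passage to derivations treats one
    parity at a time. *)
Definition form_part (w : g -> g -> K^o) (b : bool) (x y : g) : K^o :=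
  \sum_(c : bool) w (spart c x) (spart (b (+) c) y).

Lemma form_part_homog (w : g -> g -> K^o) b c x y :
  (forall y, linear (w^~ y)) -> homog c x -> form_part w b x y = w x (spart (b (+) c) y).
Proof.
move=> lw hx; rewrite /form_part big_bool /= !(spart_homog _ hx).
have w0 v : w 0 v = 0.
  have := lw v (-1) 0 0; rewrite scaler0 addr0 scaleN1r => h.
  by rewrite h addNr.
by case: c hx => hx; rewrite /= w0 ?addr0 ?add0r.
Qed.

Lemma Psi_graded b c (u v : g) : homog b u -> homog c v -> homog (b (+) c) {[u, v]}.
Proof. by move=> hu hv; apply/Psi_homog; rewrite Psi_br; apply: graded; apply/Psi_homog. Qed.

Lemma cocycle_rep w : is_cocycle w ->
  exists a, forall x y, w x y = beta {[a, Psi x]} (Psi y).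
Proof.
case=> [[wl wr] _ wc _].
have rep_part b : exists a, forall x y, form_part w b x y = beta {[a, Psi x]} (Psi y).
  have pl y : linear ((form_part w b)^~ y).
    move=> k u v; rewrite /form_part scaler_sumr -big_split; apply: eq_bigr => c _ /=.
    by rewrite spartL wl.
  have pr' x : linear (form_part w b x).
    move=> k u v; rewrite /form_part scaler_sumr -big_split; apply: eq_bigr => c _ /=.
    by rewrite spartL wr.
  have pp c d x y : homog c x -> homog d y -> c (+) d != b -> form_part w b x y = 0.
    move=> hx hy cdb; rewrite (form_part_homog _ _ wl hx) (spart_homog _ hy).
    case: eqP => [e|_].
      by move: cdb; rewrite -e; case: (b); case: (c).
    have := wr x (-1) 0 0; rewrite scaler0 addr0 scaleN1r => h.
    by rewrite h addNr.
  have pc c d x y z : homog c x -> homog d y ->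
      form_part w b {[ x, y ]} z = form_part w b x {[ y, z ]}
        - (-1) ^+ (c && d) * form_part w b y {[ x, z ]}.
    move=> hx hy; rewrite (form_part_homog _ _ wl (Psi_graded hx hy)).
    rewrite (form_part_homog _ _ wl hx) (form_part_homog _ _ wl hy).
    rewrite (spart_br _ _ Psi_graded hx) (spart_br _ _ Psi_graded hy) (wc _ _ _ _ _ hx hy).
    by rewrite !addbA [b (+) d (+) c]addbAC.
  have hD := rep_superder pl pr' pp pc.
  exists (der_elt (rep (form_part w b))) => x y.
  by rewrite -Psi_delta -(superder_delta_elt hD) (repP pr').
have [a0 h0] := rep_part false; have [a1 h1] := rep_part true.
exists (a0 + a1) => x y.
have -> : {[a0 + a1, Psi x]} = 1 *: {[a0, Psi x]} + {[a1, Psi x]} by rewrite scale1r sbrDl.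
rewrite beta_linearl mul1r -h0 -h1.
have wD u v y' : w (u + v) y' = w u y' + w v y' by have := wl y' 1 u v; rewrite !scale1r.
have wD' u v y' : w y' (u + v) = w y' u + w y' v by have := wr y' 1 u v; rewrite !scale1r.
rewrite /form_part !big_bool /= -[x in LHS]spartD -[y in LHS]spartD wD !wD'.
by rewrite addrC addrACA addrC addrACA [X in _ + X]addrC [X in X + _]addrC; ring.
Qed.

(** By invariance the ideal part of [a] contributes only the coboundary of [beta a]. The three
    coordinates on sl(V_3) contribute the cocycles, that on H_3 with the correction by the
    coboundary of the coordinate on H_2. *)
Lemma beta_decomp a x y : beta {[a, Psi x]} (Psi y) =
  2 * crd 6%N a * coc 0 x y - crd 7%N a / 2 * coc 1 x y + 2 * crd 8%N a * coc 2 x y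
  + (beta a {[Psi x, Psi y]} - 2 * crd 6%N a * crd 3%N {[Psi x, Psi y]}).
Proof.
have [x6 x7 x8] := PsiP x; have [y6 y7 y8] := PsiP y.
rewrite /beta !crd_brn !crd_br /coc /coc_crd /beta_crd /br_crd /omega2 /= !(x6, x7, x8, y6, y7, y8).
by field; rewrite ?two0.
Qed.

Lemma bilinear_of (f : g -> g -> K^o) : (forall y, linear (f^~ y)) -> (forall x, linear (f x)) ->
  exists w : {bilinear g -> g -> K^o}, (w : g -> g -> K^o) = f.
Proof.
move=> hl hr.
pose w : {bilinear g -> g -> K^o} := HB.pack f
  (bilinear_isBilinear.Build K g g K^o *:%R *:%R f (pair hl hr)).
by exists w.
Qed.

Lemma coc_root k i j : (i < 12)%N -> (j < 12)%N -> coc k (r i) (r j) =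
  coc_crd k (fun n => nth 0 root_coef i * (n == nth 0%N root_idx i)%:R)
            (fun n => nth 0 root_coef j * (n == nth 0%N root_idx j)%:R).
Proof.
by move=> hi hj; rewrite /coc; case: k => [|[|k]]; rewrite /coc_crd !crd_root_vec.
Qed.

Lemma crd_br_root n i j : (n < 17)%N -> (i < 12)%N -> (j < 12)%N ->
  crd n (Psi {[r i, r j]}) =
  br_crd false (fun n => nth 0 root_coef i * (n == nth 0%N root_idx i)%:R)
            (fun n => nth 0 root_coef j * (n == nth 0%N root_idx j)%:R) n.
Proof.
move=> hn hi hj; rewrite Psi_br crd_brn; apply: br_crd_eq => // m hm; exact: crd_root_vec.
Qed.

Theorem cocycle_basis (w : 3.-tuple (g -> g -> K^o)) :
  (forall k : 'I_3, tnth w k = coc k) ->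
  basis_mod [set w : g -> g -> K^o | is_cocycle w]
            [set w : g -> g -> K^o | is_coboundary w] w.
Proof.
move=> hw.
have sumE (c : 'I_3 -> K) x y : (\sum_i c i *: tnth w i) x y =
    c 0 * coc 0 x y + c 1 * coc 1 x y + c 2 * coc 2 x y.
  rewrite (_ : \sum_i c i *: tnth w i = c 0 *: coc 0 + c 1 *: coc 1 + c 2 *: coc 2) //.
  rewrite !big_ord_recl big_ord0 addr0 addrA !hw /=.
  by congr (c _ *: _ + c _ *: _ + c _ *: _); apply: val_inj.
split.
- by move=> k; rewrite hw; apply: coc_cocycle.
- move=> z /cocycle_rep[a ha].
  pose f u : K^o := beta a (Psi u) - 2 * crd 6%N a * crd 3%N (Psi u).
  have lf : linear f.
    move=> k u v; rewrite /f /beta /beta_crd PsiD PsiZ !crd_linear /GRing.scale /=; ring.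
  pose L : {linear g -> K^o} := HB.pack f (GRing.isLinear.Build K g K^o *:%R f lf).
  pose c (i : 'I_3) := nth 0 [:: 2 * crd 6%N a; - (crd 7%N a / 2); 2 * crd 8%N a] i.
  exists c, (fun x y => L {[x, y]}); split; first by exists L.
  apply: funext => x; apply: funext => y; rewrite ha beta_decomp.
  rewrite -[RHS]/((\sum_i c i *: tnth w i) x y + f {[x, y]}) sumE /f Psi_br.
  by congr (_ + _); rewrite /c ![nth _ _ _]/= [(- _) * _]mulNr.
move=> c [f hf].
have e i j : c 0 * coc 0 (r i) (r j) + c 1 * coc 1 (r i) (r j) + c 2 * coc 2 (r i) (r j)
    = f {[r i, r j]}.
  by rewrite -sumE hf.
(* A coboundary vanishes on the commuting pair y_2, y_6, where the second cocycle is 1 and the other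
   two are 0. The pair x_2, x_6 does the same for the third cocycle. *)
have c1 : c 1 = 0.
  have := e 7%N 11%N; rewrite (_ : {[r 7, r 11]} = 0) ?raddf0; last first.
    apply: Psi_inj; rewrite Psi0; apply: crd_ext => n n17; rewrite crd0 crd_br_root //.
    by do 17?[case: n n17 => [|n] // n17]; rewrite /br_crd /omega2 /=; ring.
  rewrite !coc_root // /coc_crd /= => <-; field; rewrite ?two0 //.
have c2 : c 2 = 0.
  have := e 1%N 5%N; rewrite (_ : {[r 1, r 5]} = 0) ?raddf0; last first.
    apply: Psi_inj; rewrite Psi0; apply: crd_ext => n n17; rewrite crd0 crd_br_root //.
    by do 17?[case: n n17 => [|n] // n17]; rewrite /br_crd /omega2 /=; ring.
  rewrite !coc_root // /coc_crd /= => <-; field; rewrite ?two0 //.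
(* The relation [x_3, y_3] = [x_2, y_2] - [x_4, y_4] constrains every coboundary. The first cocycle
   is 1 on the left pair and 1 - (-1) = 2 on the right, so [c 0 = 2 * c 0]. *)
have c0 : c 0 = 0.
  have h : {[r 2, r 8]} = {[r 1, r 7]} - {[r 3, r 9]}.
    apply: Psi_inj; rewrite PsiB; apply: crd_ext => n n17.
    rewrite crdD -scaleN1r crdZ !crd_br_root //.
    by do 17?[case: n n17 => [|n] // n17]; rewrite /br_crd /omega2 /=; field; rewrite ?two0.
  have fB u v : f (u - v) = f u - f v by exact: raddfB.
  have := e 2%N 8%N; rewrite h fB -!e !coc_root // /coc_crd /= => h'.
  move/eqP: h'; rewrite -subr_eq0 => /eqP h'.
  by apply: oppr_inj; rewrite oppr0 -[RHS]h'; field; rewrite ?two0.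
move=> i; case: i => [[|[|[|//]]]] hi.
- by rewrite (_ : Ordinal hi = 0) //; apply: val_inj.
- by rewrite (_ : Ordinal hi = 1) //; apply: val_inj.
- by rewrite (_ : Ordinal hi = 2) //; apply: val_inj.
Qed.

(** * The central extension and osp_0(4|2) *)

Section CentralExtension.
Variables (M0 : superalgType K) (crd' : nat -> M0 -> K) (elt' : (nat -> K) -> M0).
Hypothesis crd'_ext : forall a b, (forall n, (n < 17)%N -> crd' n a = crd' n b) -> a = b.
Hypothesis crd'_linear : forall n k a b, crd' n (k *: a + b) = k * crd' n a + crd' n b.
Hypothesis crd'_br : forall a b, crd'^~ {[a, b]} = br_crd true (crd'^~ a) (crd'^~ b).
Hypothesis crd'_spart : forall e a,
  crd'^~ (spart e a) = fun n => if (8 < n)%N == e then crd' n a else 0.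
Hypothesis crd'_elt : forall F,
  crd'^~ (elt' F) = fun n => if (n < 17)%N then F n else 0.
Variable w : 3.-tuple {bilinear g -> g -> K^o}.
Hypothesis w_coc : forall k x y, tnth w k x y = coc k x y.

(** The added center becomes sl(V_3). The factors 2 and -1/2 compare the last two cocycles with the
    components of psi_3; subtracting the coordinate on H_2 absorbs the coboundary by which the first
    one differs from its component. *)
Definition ce_crd (a : centext w) (n : nat) : K :=
  match n with
  | 6 => a.2 0 0 - crd 3 (Psi a.1)
  | 7 => 2 * a.2 0 2
  | 8 => - (a.2 0 1 / 2)
  | n => crd n (Psi a.1)
  end.

Definition ce_to (a : centext w) : M0 := elt' (ce_crd a).

Lemma crd'_to a n : (n < 17)%N -> crd' n (ce_to a) = ce_crd a n.
Proof. by move=> h; rewrite [LHS](congr1 (@^~ n) (crd'_elt _)) h. Qed.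

Fact ce_to_linear : linear ce_to.
Proof.
move=> k a b; apply: crd'_ext => n n17; rewrite crd'_linear !crd'_to //.
do 17?[case: n n17 => [|n] // n17]; rewrite /ce_crd /= ?mxE ?PsiD ?PsiZ ?crd_linear; ring.
Qed.
HB.instance Definition _ := GRing.isLinear.Build K (centext w) M0 *:%R ce_to ce_to_linear.

Definition ce_from (b : M0) : centext w :=
  (Phi (elt (crd'^~ b)),
   \row_k nth 0 [:: crd' 6 b + crd' 3 b; - 2 * crd' 8 b; crd' 7 b / 2] k).

Lemma ce_toK : cancel ce_to ce_from.
Proof.
move=> a; rewrite [RHS]surjective_pairing; congr pair.
- apply: Psi_inj; rewrite PhiE; apply: crd_ext => n n17.
  rewrite crd_pr // crd_eltn // crd'_to //; have [z6 z7 z8] := PsiP a.1.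
  by do 17?[case: n n17 => [|n] // n17]; rewrite /=.
- apply/rowP => k; rewrite mxE !crd'_to // /ce_crd.
  by case: k => [[|[|[|//]]]] hk /=; rewrite -[RHS]/(a.2 0 _);
    [rewrite (_ : Ordinal hk = 0)|rewrite (_ : Ordinal hk = 1)|rewrite (_ : Ordinal hk = 2)];
    try exact: val_inj; field; rewrite ?two0.
Qed.

Lemma ce_fromK : cancel ce_from ce_to.
Proof.
move=> b; apply: crd'_ext => n n17; rewrite crd'_to // /ce_crd.
have h m : (m < 17)%N -> crd m (Psi (ce_from b).1) = if (5 < m < 9)%N then 0 else crd' m b.
  by move=> hm; rewrite PhiE crd_pr // crd_eltn.
by do 17?[case: n n17 => [|n] // n17]; rewrite ?h // ?mxE /=; field; rewrite ?two0.
Qed.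

Theorem centext_superiso : superiso (centext w) M0.
Proof.
exists ce_to; split; last by exists ce_from; [exact: ce_toK | exact: ce_fromK].
have trunc n F : (n < 17)%N -> (fun n => if (n < 17)%N then F n else 0 : K) n = F n by move=> ->.
split=> [b a|a b]; apply: crd'_ext => n n17.
- rewrite crd'_to // [RHS](congr1 (@^~ n) (crd'_spart _ _)) crd'_to // /ce_crd.
  rewrite -[(spart b a).1]/(spart b a.1) -[(spart b a).2]/(if b then 0 else a.2).
  rewrite !Psi_spart.
  by case: b; do 17?[case: n n17 => [|n] // n17]; rewrite /= ?crd_spartn /= ?mxE; ring.
- rewrite crd'_to // [RHS](congr1 (@^~ n) (crd'_br _ _)) /ce_crd.
  rewrite -[{[a, b]}.1]/({[a.1, b.1]}) -[{[a, b]}.2]/(\row_k (tnth w k a.1 b.1 : K)).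
  rewrite !Psi_br !crd_brn.
  have [z6 z7 z8] := PsiP a.1; have [z6' z7' z8'] := PsiP b.1.
  do 17?[case: n n17 => [|n] // n17]; rewrite ?mxE ?w_coc /coc /coc_crd /br_crd /omega2 !crd'_to //= ?(z6, z7, z8, z6', z7', z8');
  field; rewrite ?two0 //.
Qed.
End CentralExtension.

Lemma br_rootP i j k e : (i < 12)%N -> (j < 12)%N -> (k < 12)%N ->
  (forall n, (n < 17)%N ->
    br_crd false (fun n => nth 0 root_coef i * (n == nth 0%N root_idx i)%:R)
            (fun n => nth 0 root_coef j * (n == nth 0%N root_idx j)%:R) n =
    e * (nth 0 root_coef k * (n == nth 0%N root_idx k)%:R)) ->
  {[r i, r j]} = e *: r k.
Proof.
move=> hi hj hk h; apply: Psi_inj; apply: crd_ext => n n17.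
by rewrite crd_br_root // h // PsiZ crdZ crd_root_vec.
Qed.

Lemma root_brackets :
  [/\ {[r 0, r 1]} = r 3, {[r 1, r 2]} = r 4 & {[r 2, r 3]} = r 5] /\
  [/\ {[r 6, r 7]} = r 9, {[r 7, r 8]} = r 10 & {[r 8, r 9]} = r 11].
Proof. by split; split; rewrite -[RHS]scale1r; apply: br_rootP => //; table. Qed.

Lemma root_vectorsE : root_vectors =
  [tuple r 0; r 1; r 2; r 3; r 4; r 5; r 6; r 7; r 8; r 9; r 10; r 11].
Proof.
apply: eq_from_tnth => i; rewrite tnth_mktuple (tnth_nth 0).
by case: i => i; do 12?[case: i => [|i]].
Qed.

Theorem psl_cohomology (M0 : superalgType K) (crd' : nat -> M0 -> K) (elt' : (nat -> K) -> M0)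
    (crd'_ext : forall a b, (forall n, (n < 17)%N -> crd' n a = crd' n b) -> a = b)
    (crd'_linear : forall n k a b, crd' n (k *: a + b) = k * crd' n a + crd' n b)
    (crd'_br : forall a b, crd'^~ {[a, b]} = br_crd true (crd'^~ a) (crd'^~ b))
    (crd'_spart : forall e a,
      crd'^~ (spart e a) = fun n => if (8 < n)%N == e then crd' n a else 0)
    (crd'_elt : forall F, crd'^~ (elt' F) = fun n => if (n < 17)%N then F n else 0)
    (x1 x2 x3 x4 x5 x6 y1 y2 y3 y4 y5 y6 : g) :
  [/\ x1 = r 0, x2 = r 1 & x3 = r 2] -> [/\ x4 = r 3, x5 = r 4 & x6 = r 5] ->
  [/\ y1 = r 6, y2 = r 7 & y3 = r 8] -> [/\ y4 = r 9, y5 = r 10 & y6 = r 11] ->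
  let root_vectors :=
    [tuple x1; x2; x3; x4; x5; x6; y1; y2; y3; y4; y5; y6] in
  let B : set g := [set u | u \in (root_vectors : seq g) \/ torus_psl u] in
  basis_mod [set: g] torus_psl root_vectors /\
  (exists D4 D0 theta theta' : {linear g -> g},
    [/\ given_by B [:: (x2, y6); (x4, - y5); (x5, - y4); (x6, y2)] D4,
        given_by B [:: (x2, x2); (x3, - x3); (x4, x4);
                       (y2, - y2); (y3, y3); (y4, - y4)] D0,
        [/\ superhom theta, cancel theta theta', cancel theta' theta,
            [/\ theta x1 = y1, theta x2 = y2 & theta x3 = y3] &
            [/\ theta y1 = x1, theta y2 = - x2 & theta y3 = x3]] &
        basis_mod [set D : g -> g | is_der D] [set D : g -> g | is_inner D]
          [tuple (D4 : g -> g); (D0 : g -> g); theta \o D4 \o theta']]) /\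
  superiso (der g) M /\
  (exists (x2y2 x3y3 x4y4 y2y6 y4y5 x2x6 x4x5 : g -> g -> K^o)
          (w1 w2 w3 : {bilinear g -> g -> K^o}),
    [/\ [/\ is_wedge B x2 y2 x2y2, is_wedge B x3 y3 x3y3 &
            is_wedge B x4 y4 x4y4] /\
        [/\ is_wedge B y2 y6 y2y6, is_wedge B y4 y5 y4y5,
            is_wedge B x2 x6 x2x6 & is_wedge B x4 x5 x4x5],
        [/\ (w1 : g -> g -> K^o) = x2y2 + x3y3 - x4y4,
            (w2 : g -> g -> K^o) = y2y6 + y4y5 &
            (w3 : g -> g -> K^o) = x2x6 + x4x5],
        basis_mod [set w : g -> g -> K^o | is_cocycle w]
          [set w : g -> g -> K^o | is_coboundary w]
          [tuple (w1 : g -> g -> K^o); (w2 : g -> g -> K^o);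
                 (w3 : g -> g -> K^o)] &
        superiso (centext [tuple w1; w2; w3]) M0]).
Proof.
move=> [-> -> ->] [-> -> ->] [-> -> ->] [-> -> ->] rv B.
have eB : B = rv_set by rewrite /B /rv_set root_vectorsE.
rewrite eB; split; first by rewrite /rv -root_vectorsE; apply: root_basis.
split.
  exists (delta D4_elt), (delta D0_elt), (theta 1), (theta (-1)); split.
  - exact: D4_given.
  - exact: D0_given.
  - have [t1 t2] := theta_root; split=> //; [exact: theta_superhom | |].
      by apply: thetaK; rewrite mul1r.
    by rewrite -[X in cancel _ (theta X)]opprK; apply: thetaK; rewrite mulrNN mul1r.
  - exact: der_basis.
split; first exact: der_superiso.
have [w1 e1] := bilinear_of (coc_linearl 0) (coc_linearr 0).
have [w2 e2] := bilinear_of (coc_linearl 1) (coc_linearr 1).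
have [w3 e3] := bilinear_of (coc_linearl 2) (coc_linearr 2).
exists (wedge 1 7), (wedge 2 8), (wedge 3 9), (wedge 7 11), (wedge 9 10), (wedge 1 5), (wedge 3 4).
exists w1, w2, w3; split.
- by split; split; apply: wedgeP.
- by rewrite e1 e2 e3 coc0E coc1E coc2E.
- apply: cocycle_basis => k; rewrite (tnth_nth 0).
  by case: k => [[|[|[|//]]]] hk /=; rewrite ?e1 ?e2 ?e3.
- apply: (centext_superiso crd'_ext crd'_linear crd'_br crd'_spart crd'_elt) => k x y.
  rewrite (tnth_nth w1); case: k => [[|[|[|//]]]] hk.
  - exact: (congr1 (fun w => w x y) e1).
  - exact: (congr1 (fun w => w x y) e2).
  - exact: (congr1 (fun w => w x y) e3).
Qed.
End OspIdeal.

(** * The Lie superalgebra gl(2|2) *)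

Definition gl22 (K : fieldType) : Type := 'M[K]_4.

Section Gl22.
Variable K : fieldType.

HB.instance Definition _ := GRing.Lmodule.copy (gl22 K) 'M[K]_4.
Local Notation gl := (gl22 K).
Implicit Types (M N : gl) (b c : bool).

Definition odd_ord (i : 'I_4) := (1 < i)%N.

Definition gl_spart b M : gl :=
  \matrix_(i, j) (if odd_ord i (+) odd_ord j == b then (M : 'M[K]_4) i j else 0).

(** The supercommutator as one bilinear formula for mixed arguments: the odd part of [M] multiplies
    [spart false N - spart true N], which puts the sign on the product of two odd parts. *)
Definition gl_br M N : gl :=
  M *m N - N *m gl_spart false M - (gl_spart false N - gl_spart true N) *m gl_spart true M.

Fact gl_spart_linear b : linear (gl_spart b).
Proof. by move=> k M N; apply/matrixP => i j; rewrite !mxE; case: ifP; rewrite // mulr0 addr0. Qed.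
HB.instance Definition _ b := GRing.isLinear.Build K gl gl *:%R (gl_spart b) (gl_spart_linear b).

Fact gl_spartK b c M : gl_spart b (gl_spart c M) = if b == c then gl_spart b M else 0.
Proof.
apply/matrixP => i j; rewrite (fun_if (fun N : 'M[K]_4 => N i j)) !mxE.
by case: eqP => [<-|]; case: eqP => // <-; case: eqP.
Qed.

Fact gl_spartD M : gl_spart false M + gl_spart true M = M.
Proof. by apply/matrixP => i j; rewrite !mxE; case: (_ (+) _); rewrite ?add0r ?addr0. Qed.

Fact gl_br_linearl N : linear (gl_br^~ N).
Proof.
move=> k M M'; rewrite /gl_br !gl_spart_linear !mulmxDl !mulmxDr.
rewrite -!scalemxAl -!scalemxAr !scalerBr !opprD.
move: (M *m N) (M' *m N) (N *m _) (N *m _) (_ *m gl_spart true M) (_ *m gl_spart true M').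
by move=> *; apply/matrixP => i j; rewrite !mxE; ring.
Qed.

Fact gl_br_linearr M : linear (gl_br M).
Proof.
move=> k N N'; rewrite /gl_br !gl_spart_linear !mulmxDl !mulmxDr !mulNmx.
rewrite !mulmxDl -!scalemxAl -!scalemxAr !scalerBr !opprD.
move: (M *m N) (M *m N') (N *m _) (N' *m _) (_ *m gl_spart true M) (_ *m gl_spart true M).
move: (_ *m gl_spart true M) (_ *m gl_spart true M).
by move=> *; apply/matrixP => i j; rewrite !mxE; ring.
Qed.

HB.instance Definition _ := isSuperalgebra.Build K gl gl_spart_linear
  gl_spartK gl_spartD gl_br_linearl gl_br_linearr.

Lemma gl_homogP b M :
  homog b M <-> forall i j, odd_ord i (+) odd_ord j != b -> (M : 'M[K]_4) i j = 0.
Proof.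
split=> [<- i j h|h]; first by rewrite mxE (negPf h).
by apply/matrixP => i j; rewrite mxE; case: eqP => // /eqP /h.
Qed.

Lemma gl_mul_homog b c M N : homog b M -> homog c N -> homog (b (+) c) (M *m N : gl).
Proof.
move=> /gl_homogP hM /gl_homogP hN; apply/gl_homogP => i j hij; rewrite mxE big1 // => k _.
case h : (odd_ord i (+) odd_ord k == b); last by rewrite hM ?mul0r ?h.
rewrite hN ?mulr0 //; apply: contra hij => /eqP <-; move/eqP: h => <-.
by case: (odd_ord i); case: (odd_ord j); case: (odd_ord k).
Qed.

Lemma gl_brE b c M N : homog b M -> homog c N ->
  {[M, N]} = M *m N - (-1 : K) ^+ (b && c) *: (N *m M : 'M[K]_4) :> 'M[K]_4.
Proof.
move=> hM hN.
rewrite -[LHS]/(M *m N - N *m spart false M - (spart false N - spart true N) *m spart true M).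
rewrite !(spart_homog _ hM) !(spart_homog _ hN).
case: b hM => _; case: c hN => _; rewrite /= ?expr0 ?expr1 ?scaleN1r ?scale1r
  ?mulmx0 ?mul0mx ?subr0 ?sub0r ?mulNmx ?opprK //.
Qed.

Fact gl_graded b c M N : homog b M -> homog c N -> homog (b (+) c) {[ M, N ]}.
Proof.
move=> hM hN; rewrite [{[_, _]}](gl_brE hM hN) addrC -scaleNr.
apply: homogL; last exact: gl_mul_homog.
by rewrite addbC; apply: gl_mul_homog.
Qed.

Fact gl_skew b c M N : homog b M -> homog c N ->
  {[ M, N ]} = - ((-1 : K) ^+ (b && c) *: {[ N, M ]}).
Proof.
move=> hM hN; rewrite [{[M, _]}](gl_brE hM hN) [{[N, _]}](gl_brE hN hM).
move: (M *m N) (N *m M) => A B; apply/matrixP => i j; rewrite !mxE.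
by case: b c {hM hN} => [] []; rewrite /=; ring.
Qed.

Fact gl_jacobi b c M N L : homog b M -> homog c N ->
  {[ M, {[ N, L ]} ]} = {[ {[ M, N ]}, L ]} + (-1 : K) ^+ (b && c) *: {[ N, {[ M, L ]} ]}.
Proof.
move=> hM hN.
have jac d L' : homog d L' -> {[ M, {[ N, L' ]} ]} =
    {[ {[ M, N ]}, L' ]} + (-1 : K) ^+ (b && c) *: {[ N, {[ M, L' ]} ]}.
  move=> hL; rewrite [LHS](gl_brE hM (gl_graded hN hL)) (gl_brE hN hL).
  rewrite [{[{[_, _]}, _]}](gl_brE (gl_graded hM hN) hL) (gl_brE hM hN).
  rewrite [{[N, {[_, _]}]}](gl_brE hN (gl_graded hM hL)) (gl_brE hM hL).
  rewrite !mulmxBl !mulmxBr -!scalemxAl -!scalemxAr !mulmxA.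
  move: (M *m N *m L') (M *m L' *m N) (N *m L' *m M) (L' *m N *m M) (N *m M *m L') (L' *m M *m N) => *.
  apply/matrixP => i j; rewrite !mxE.
  by case: b c d {hM hN hL} => [] [] []; rewrite /=; ring.
exact: jacobi_ext jac _.
Qed.

Fact gl_odd_cube M : homog true M -> {[ M, {[ M, M ]} ]} = 0.
Proof.
move=> hM; rewrite [LHS](gl_brE hM (gl_graded hM hM)) (gl_brE hM hM) /= expr0 expr1 scale1r.
by rewrite scaleN1r opprK mulmxDl mulmxDr mulmxA subrr.
Qed.

HB.instance Definition _ := isLieSuperalgebra.Build K gl gl_graded gl_skew
  gl_jacobi gl_odd_cube.
End Gl22.

(** * The realization as the diagonal matrices *)

Section GlTools.
Variable K : fieldType.
Local Notation gl := (gl22 K).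

Definition dg (t : 'rV[K]_4) : gl := diag_mx t.
Definition unit_mx (i j : 'I_4) : gl := delta_mx i j.

Lemma dg_homog t : homog false (dg t).
Proof.
by apply/gl_homogP => i j; rewrite mxE; case: (i =P j) => [->|_ _]; rewrite ?addbb // mulr0n.
Qed.

Lemma unit_homog i j : homog (odd_ord i (+) odd_ord j) (unit_mx i j).
Proof.
by apply/gl_homogP => k l; rewrite mxE; case: (k =P i) => [->|] //=; case: (l =P j) => [->|] //=;
  rewrite eqxx.
Qed.

Lemma br_dgl t M i j : ({[dg t, M]} : 'M[K]_4) i j = (t 0 i - t 0 j) * (M : 'M[K]_4) i j.
Proof.
rewrite -[{[_, _]}]/(dg t *m M - M *m spart false (dg t) - (spart false M - spart true M) *m spart true (dg t)).
rewrite (spart_homog false (dg_homog t)) (spart_homog true (dg_homog t)) /= mulmx0 subr0.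
by rewrite mul_diag_mx mul_mx_diag !mxE; ring.
Qed.

Lemma br_dgr t M i j : ({[M, dg t]} : 'M[K]_4) i j = (t 0 j - t 0 i) * (M : 'M[K]_4) i j.
Proof.
rewrite -[{[_, _]}]/(M *m dg t - dg t *m spart false M - (spart false (dg t) - spart true (dg t)) *m spart true M).
rewrite (spart_homog false (dg_homog t)) (spart_homog true (dg_homog t)) /= subr0.
rewrite -addrA -opprD -mulmxDr (spartD M).
by rewrite mul_diag_mx mul_mx_diag !mxE; ring.
Qed.

Lemma br_unit i j k l : {[unit_mx i j, unit_mx k l]} =
  (j == k)%:R *: unit_mx i l -
  (-1) ^+ ((odd_ord i (+) odd_ord j) && (odd_ord k (+) odd_ord l)) *: ((l == i)%:R *: unit_mx k j).
Proof.
by rewrite [LHS](gl_brE (unit_homog _ _) (unit_homog _ _)) !mul_delta_mx_cond -!scaler_nat.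
Qed.

Lemma ord4P (P : 'I_4 -> Prop) : P 0 -> P 1 -> P 2 -> P 3 -> forall i, P i.
Proof.
move=> P0 P1 P2 P3 [[|[|[|[|//]]]] h].
- by rewrite (_ : Ordinal h = 0) //; apply: val_inj.
- by rewrite (_ : Ordinal h = 1) //; apply: val_inj.
- by rewrite (_ : Ordinal h = 2) //; apply: val_inj.
- by rewrite (_ : Ordinal h = 3) //; apply: val_inj.
Qed.

Lemma sum4E (V : nmodType) (F : 'I_4 -> V) : \sum_i F i = F 0 + F 1 + F 2 + F 3.
Proof.
rewrite !big_ord_recr big_ord0 /= add0r.
by congr (F _ + F _ + F _ + F _); apply: val_inj.
Qed.

Lemma ord3P (P : 'I_3 -> Prop) : P 0 -> P 1 -> P 2 -> forall i, P i.
Proof.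
move=> P0 P1 P2 [[|[|[|//]]] h].
- by rewrite (_ : Ordinal h = 0) //; apply: val_inj.
- by rewrite (_ : Ordinal h = 1) //; apply: val_inj.
- by rewrite (_ : Ordinal h = 2) //; apply: val_inj.
Qed.

Lemma sum3E (V : nmodType) (F : 'I_3 -> V) : \sum_i F i = F 0 + F 1 + F 2.
Proof.
rewrite !big_ord_recr big_ord0 /= add0r.
by congr (F _ + F _ + F _); apply: val_inj.
Qed.
End GlTools.

Section Realization.
Variables (K : fieldType) (R : realization (psl22_cartan_matrix K)).
Local Notation A := (psl22_cartan_matrix K).
Local Notation h := (cartan R).

(** Rows 1, 2 and columns 2, 3 of the Cartan matrix form diag(-1, 1), invertible in every
    characteristic; [B] and [C] select them. This bounds the dimension of h by 4. *)
Lemma rank_cartan : (2 <= \rank A)%N.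
Proof.
pose B : 'M[K]_(2, 3) := \matrix_(i, j) (i == j :> nat)%:R.
pose C : 'M[K]_(3, 2) := \matrix_(i, j) (if j == 0 then - (i == 1)%:R else (i == 2)%:R).
apply: (@mulmx1_min_rank _ 2 _ _ A B C).
apply/matrixP; case=> [[|[|//]] hi]; case=> [[|[|//]] hj]; rewrite !mxE sum3E !mxE !sum3E !mxE /=; ring.
Qed.

Lemma cartan_dim_le4 : (\dim {: h} <= 4)%N.
Proof.
by rewrite cartan_dim; apply: (leq_trans (leq_sub2l _ rank_cartan)).
Qed.

Definition alpha (j : 'I_3) (v : h) : K := simple_root R j v.

(** The last diagonal entry of the matrix of [v]; the differences of consecutive entries are the
    simple roots. The coroots must become E_11 - E_22, E_22 + E_33 and E_33 - E_44, hence the values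
    0, 0 and -1. *)
Definition lambda (v : h) : K :=
  - coord (codom_tuple (coroot R)) (enum_rank (2 : 'I_3)) v.

Lemma lambda_coroot i : lambda (coroot R i) = if i == 2 then -1 else 0.
Proof.
have -> : coroot R i = (codom_tuple (coroot R))`_(enum_rank i) by rewrite /= nth_codom enum_rankK.
rewrite /lambda coord_free; last exact: coroot_free.
by rewrite (inj_eq enum_rank_inj); case: eqP; rewrite ?oppr0.
Qed.

Lemma alpha_coroot i j : alpha j (coroot R i) = A i j.
Proof. exact: simple_rootE. Qed.

Fact alpha_linear j : linear (alpha j : h -> K^o).
Proof. by move=> k u v; rewrite /alpha linearP. Qed.
Fact lambda_linear : linear (lambda : h -> K^o).
Proof. by move=> k u v; rewrite /lambda linearP opprD scalerN. Qed.

Definition phi_row (v : h) : 'rV[K]_4 :=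
  \row_(i < 4) (nth 0 [:: alpha 0 v + alpha 1 v + alpha 2 v; alpha 1 v + alpha 2 v; alpha 2 v; 0] i
   + lambda v).

Fact phi_row_linear : linear phi_row.
Proof.
move=> k u v; apply/rowP; apply: ord4P; rewrite !mxE /= ?[alpha _ (_ + _)]alpha_linear
  ?[lambda (_ + _)]lambda_linear /GRing.scale /=; ring.
Qed.

HB.instance Definition _ := GRing.isLinear.Build K h 'rV[K]_4 *:%R phi_row phi_row_linear.

Lemma alpha_free (u : 'I_3 -> K) : (forall v, \sum_j u j * alpha j v = 0) -> forall j, u j = 0.
Proof.
move=> hu j.
have fr : free (codom_tuple (simple_root R)) by exact: simple_root_free.
have := fr => /freeP fP.
pose c (k : 'I_#|'I_3|) := u (enum_val k).
have := fP c; rewrite (_ : \sum_i c i *: _ = 0).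
  by move=> /(_ erefl (enum_rank j)); rewrite /c enum_rankK.
apply/lfunP => v; rewrite sum_lfunE zero_lfunE -[RHS](hu v).
rewrite (reindex (enum_val : 'I_#|'I_3| -> 'I_3)) /=; last first.
  by exists enum_rank => x _; rewrite ?enum_valK ?enum_rankK.
by apply: eq_bigr => i _; rewrite /= nth_codom scale_lfunE.
Qed.

Lemma alpha_sum (I : Type) (r : seq I) (F : I -> h) (c : I -> K) j :
  alpha j (\sum_(i <- r) c i *: F i) = \sum_(i <- r) c i * alpha j (F i).
Proof. by rewrite /alpha linear_sum; apply: eq_bigr => i _; rewrite linearZ. Qed.

Lemma alpha_surj (y : 'I_3 -> K) : exists v, forall j, alpha j v = y j.
Proof.
pose b := vbasis {: h}.
pose N : 'M[K]_(\dim {: h}, 3) := \matrix_(i, j) alpha j b`_i.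
have Nfull : row_full N.
  rewrite /row_full -mxrank_tr -/(row_free N^T) -kermx_eq0; apply/rowV0P => u /sub_kermxP hu.
  apply/rowP => j; rewrite mxE; apply: (alpha_free (u := u 0)) => v.
  rewrite (coord_vbasis (memvf v)).
  under eq_bigr => k _ do rewrite alpha_sum mulr_sumr.
  rewrite exchange_big big1 // => i _ /=.
  have /rowP/(_ i) := hu; rewrite !mxE => hi.
  transitivity (coord b i v * (\sum_k u 0 k * N^T k i)); last by rewrite hi mulr0.
  by rewrite mulr_sumr; apply: eq_bigr => k _; rewrite !mxE mulrCA.
have /submxP[w hw] := submx_full (\row_j y j) Nfull.
exists (\sum_i w 0 i *: b`_i) => j; rewrite alpha_sum.
have /rowP/(_ j) := hw; rewrite !mxE => ->.
by apply: eq_bigr => i _; rewrite mxE.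
Qed.

Lemma phi_row_surj t : exists v, phi_row v = t.
Proof.
have [v hv] := alpha_surj (fun j : 'I_3 => nth 0 [:: t 0 0 - t 0 1; t 0 1 - t 0 2; t 0 2 - t 0 3] j).
(* This combination spans the left kernel of the Cartan matrix. It is killed by all simple roots and
   goes to the identity matrix, so it corrects the last entry without changing the differences. *)
pose z := coroot R 0 + (2 *: coroot R 1 - coroot R 2).
have az j : alpha j z = 0.
  rewrite /z /alpha !linearD linearN linearZ /= -![simple_root R j _]/(alpha j _) !alpha_coroot.
  by move: j; apply: ord3P; rewrite !mxE /= /GRing.scale /=; ring.
have lz : lambda z = 1.
  rewrite /z -[coroot R 0]scale1r [LHS](lambda_linear 1) -scaleN1r.
  rewrite [lambda (2 *: _ + _)](lambda_linear 2) -[-1 *: _]addr0 [lambda (-1 *: _ + _)](lambda_linear (-1)).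
  have l0 : lambda 0 = 0 by rewrite /lambda linear0 oppr0.
  by rewrite !lambda_coroot l0 /= /GRing.scale /=; ring.
exists ((t 0 3 - lambda v) *: z + v); apply/rowP => j; rewrite mxE.
have e k : alpha k ((t 0 3 - lambda v) *: z + v) = alpha k v.
  by rewrite [LHS]alpha_linear az scaler0 add0r.
rewrite [lambda (_ + _)]lambda_linear lz !e !hv /GRing.scale /=.
by move: j; apply: ord4P; rewrite /=; ring.
Qed.

(** A surjection onto K^4 from a space of dimension at most 4 is injective. *)
Lemma phi_row_inj v : phi_row v = 0 -> v = 0.
Proof.
pose f := linfun phi_row.
have fE u : f u = phi_row u by rewrite lfunE.
have full : limg f = fullv.
  apply/eqP; rewrite eqEsubv subvf /=; apply/subvP => t _.
  have [u <-] := phi_row_surj t; rewrite -fE; apply: memv_img; exact: memvf.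
have := limg_ker_dim f fullv; rewrite capfv full [X in (_ + X)%N]dimvf => hd hv.
have d0 : \dim (lker f) = 0%N.
  apply/eqP; rewrite -leqn0 -(leq_add2r 4) add0n.
  have dim4 : dim 'rV[K]_4 = 4%N by [].
  by rewrite dim4 in hd; rewrite hd cartan_dim_le4.
have : v \in lker f by rewrite memv_ker fE hv.
by move/eqP: d0; rewrite dimv_eq0 => /eqP->; rewrite memv0 => /eqP.
Qed.
End Realization.

Section GlGenerators.
Variables (K : fieldType) (R : realization (psl22_cartan_matrix K)).
Local Notation gl := (gl22 K).

Definition phi (v : cartan R) : gl := dg (phi_row v).

Fact phi_linear : linear phi.
Proof. by move=> k u v; rewrite /phi /dg phi_row_linear; apply/matrixP => i j; rewrite !mxE mulrnDl -mulrnAr. Qed.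
HB.instance Definition _ := GRing.isLinear.Build K (cartan R) gl *:%R phi phi_linear.

Definition lo (i : 'I_3) : 'I_4 := widen_ord (leqnSn 3) i.
Definition up (i : 'I_3) : 'I_4 := lift ord0 i.

Definition gl_gen : generators R gl :=
  Generators phi (fun i => unit_mx K (lo i) (up i)) (fun i => unit_mx K (up i) (lo i)).

Lemma phi_row_coroot i : phi_row (coroot R i) =
  \row_j ((j == lo i)%:R - (-1) ^+ psl22_par i * (j == up i)%:R).
Proof.
apply/rowP; apply: ord4P; rewrite !mxE lambda_coroot !alpha_coroot; move: i; apply: ord3P;
 by rewrite !mxE /=; ring.
Qed.

Lemma lo_up_par i : odd_ord (lo i) (+) odd_ord (up i) = psl22_par i.
Proof. by move: i; apply: ord3P. Qed.

Lemma phi_row_diff (v : cartan R) i : phi_row v 0 (lo i) - phi_row v 0 (up i) = alpha i (v : cartan R).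
Proof. by move: i; apply: ord3P; rewrite !mxE /=; ring. Qed.

Lemma unit_mxE a b k l : (unit_mx K a b : 'M[K]_4) k l = ((k == a) && (l == b))%:R.
Proof. by rewrite mxE. Qed.

Lemma gl_chevalley : chevalley_relations psl22_par gl_gen.
Proof.
split; first split.
- by move=> v; apply: dg_homog.
- by move=> i; rewrite -lo_up_par; apply: unit_homog.
- by move=> i; rewrite -lo_up_par addbC; apply: unit_homog.
- move=> u v; apply/matrixP => i j; rewrite br_dgl !mxE.
  by case: eqP => [->|]; rewrite ?subrr ?mul0r // mulr0n mulr0.
- move=> v j; apply/matrixP => k l; rewrite br_dgl [RHS]mxE !unit_mxE.
  rewrite -[simple_root _ _ _]/(alpha j (v : cartan R)) -phi_row_diff.
  case: (k =P lo j) => [->|_] /=; last by rewrite !mulr0.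
  by case: (l =P up j) => [->|_] /=; rewrite ?mulr0.
- move=> v j; apply/matrixP => k l; rewrite br_dgl.
  transitivity (- (alpha j (v : cartan R) * (unit_mx K (up j) (lo j) : 'M[K]_4) k l)).
    rewrite -phi_row_diff !unit_mxE; case: (k =P up j) => [->|_] /=; last by rewrite !mulr0 oppr0.
    by case: (l =P lo j) => [->|_] /=; rewrite ?mulr0 ?oppr0 // !mulr1 opprB.
  by rewrite [RHS]mxE; congr (- _); rewrite [RHS]mxE.
- move=> i j; rewrite /= br_unit [odd_ord (up j) (+) _]addbC !lo_up_par.
  case: (i =P j) => [<-|/eqP ij].
    rewrite !eqxx !scale1r andbb /phi phi_row_coroot; apply/matrixP => k l.
    rewrite !mxE; case: (k =P l) => [<-|kl]; rewrite ?mulr1n ?mulr0n.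
      by rewrite !andbb.
    have h (m : 'I_4) : (k == m) && (l == m) = false.
      by apply/negP => /andP[/eqP e1 /eqP e2]; case: kl; rewrite e1 e2.
    by rewrite !h mulr0 subr0.
  have -> : (up i == up j) = false by rewrite /up (inj_eq lift_inj) (negPf ij).
  have -> : (lo j == lo i) = false by rewrite -val_eqE /= eq_sym val_eqE (negPf ij).
  by rewrite !scale0r scaler0 subr0.
Qed.
End GlGenerators.

(** * Generation by the Chevalley generators *)

Section Generation.
Variables (K : fieldType) (n : nat) (A : 'M[K]_n) (R : realization A).
Variables (par : 'I_n -> bool) (L : lieSuperType K) (t : generators R L).
Hypothesis t_rel : chevalley_relations par t.

Definition root_sum (u : L) : Prop :=
  exists r : seq ('rV[int]_n * L), u = \sum_(p <- r) p.2 /\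
    forall p, p \in r -> root_homog t p.1 p.2.

Lemma root_sum0 : root_sum 0.
Proof. by exists [::]; rewrite big_nil. Qed.

Lemma root_homogZ d k u : root_homog t d u -> root_homog t d (k *: u).
Proof. by move=> hu; rewrite -[_ *: _]addr0; apply/RootHomogD/RootHomog0. Qed.

Lemma root_homog_sum d u : root_homog t d u -> root_sum u.
Proof.
move=> hu; exists [:: (d, u)]; rewrite big_seq1; split=> // p.
by rewrite inE => /eqP->.
Qed.

Lemma root_sumL k u v : root_sum u -> root_sum v -> root_sum (k *: u + v).
Proof.
move=> [r [-> hr]] [r' [-> hr']]; exists ([seq (p.1, k *: p.2) | p <- r] ++ r').
rewrite big_cat big_map scaler_sumr; split=> // p; rewrite mem_cat => /orP[/mapP[q hq ->]|].
  exact: (root_homogZ _ (hr q hq)).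
exact: hr'.
Qed.

Lemma root_sumD u v : root_sum u -> root_sum v -> root_sum (u + v).
Proof. by rewrite -[u in u + v]scale1r; apply: root_sumL. Qed.

Lemma root_sum_sum (I : eqType) (r : seq I) (F : I -> L) :
  (forall i, i \in r -> root_sum (F i)) -> root_sum (\sum_(i <- r) F i).
Proof.
elim: r => [_|i r IHr h]; first by rewrite big_nil; apply: root_sum0.
rewrite big_cons; apply: root_sumD; first by apply: h; rewrite mem_head.
by apply: IHr => j hj; apply: h; rewrite inE hj orbT.
Qed.

Lemma root_sum_br u v : root_sum u -> root_sum v -> root_sum {[u, v]}.
Proof.
move=> [r [-> hr]] [r' [-> hr']]; rewrite sbr_suml; apply: root_sum_sum => p hp.
rewrite sbr_sumr; apply: root_sum_sum => q hq.
exact: root_homog_sum (RootHomogBr (hr p hp) (hr' q hq)).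
Qed.

Lemma root_homog_spart d u : root_homog t d u -> forall b, root_homog t d (spart b u).
Proof.
have [[hh hx hy] _ _ _ _] := t_rel.
have hom d' b c u' : homog c u' -> root_homog t d' u' -> root_homog t d' (spart b u').
  by move=> hc hu'; rewrite (spart_homog _ hc); case: ifP => // _; apply: RootHomog0.
elim=> {d u} [d|v|i|i|d k u v _ IHu _ IHv|d e u v _ IHu _ IHv] b.
- by rewrite spart0; apply: RootHomog0.
- by apply: hom (hh v) _; apply: RootHomogH.
- by apply: hom (hx i) _; apply: RootHomogX.
- by apply: hom (hy i) _; apply: RootHomogY.
- by rewrite spartL; apply: RootHomogD.
- rewrite -(spartD u) sbrDl spart_add -[X in root_homog _ _ (X + _)]scale1r.
  apply: RootHomogD; rewrite (spart_br _ _ (@sbr_graded K L) (homog_spart _ _)); exact: RootHomogBr.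
Qed.

Lemma spart_sum b (I : Type) (r : seq I) (F : I -> L) :
  spart b (\sum_(i <- r) F i) = \sum_(i <- r) spart b (F i).
Proof. by apply: (big_morph (spart b)) => [x y|]; rewrite ?spart_add ?spart0. Qed.

Lemma root_sum_spart b u : root_sum u -> root_sum (spart b u).
Proof.
move=> [r [-> hr]]; rewrite spart_sum; apply: root_sum_sum => p hp.
by apply: root_homog_sum; apply: root_homog_spart; apply: hr.
Qed.

Definition root_sum_pred : {pred L} := fun u => `[< root_sum u >].

Fact root_sum_submod_closed : submod_closed root_sum_pred.
Proof.
split=> [|k u v]; first exact/asboolP/root_sum0.
by move=> /asboolP hu /asboolP hv; apply/asboolP/root_sumL.
Qed.

HB.instance Definition _ :=
  GRing.isSubmodClosed.Build K L root_sum_pred root_sum_submod_closed.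

Record root_sub := RootSub { root_val :> L; root_valP : root_val \in root_sum_pred }.

HB.instance Definition _ := [isSub for root_val].
HB.instance Definition _ := [Choice of root_sub by <:].
HB.instance Definition _ := [SubChoice_isSubLmodule of root_sub by <:].

Implicit Types x y : root_sub.

Lemma root_subP x : root_sum x. Proof. by case: x => u /= /asboolP. Qed.

Definition rs_spart b x : root_sub := RootSub (asboolT (root_sum_spart b (root_subP x))).
Definition rs_br x y : root_sub := RootSub (asboolT (root_sum_br (root_subP x) (root_subP y))).

Fact rs_spart_linear b : linear (rs_spart b).
Proof. by move=> k x y; apply: val_inj; rewrite /= spartL. Qed.
Fact rs_spartK b c x : rs_spart b (rs_spart c x) = if b == c then rs_spart b x else 0.
Proof. by apply: val_inj; rewrite /= spartK; case: eqP. Qed.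
Fact rs_spartD x : rs_spart false x + rs_spart true x = x.
Proof. by apply: val_inj; rewrite /= spartD. Qed.
Fact rs_br_linearl y : linear (rs_br^~ y).
Proof. by move=> k x x'; apply: val_inj; rewrite /= sbrDl sbrZl. Qed.
Fact rs_br_linearr x : linear (rs_br x).
Proof. by move=> k y y'; apply: val_inj; rewrite /= sbrDr sbrZr. Qed.

HB.instance Definition _ := isSuperalgebra.Build K root_sub rs_spart_linear
  rs_spartK rs_spartD rs_br_linearl rs_br_linearr.

Lemma rs_homog b x : homog b x <-> homog b (x : L).
Proof. by split=> [/(congr1 root_val)|h]; [|apply: val_inj]. Qed.

Fact rs_graded b c x y : homog b x -> homog c y -> homog (b (+) c) {[x, y]}.
Proof. by move=> /rs_homog hx /rs_homog hy; apply/rs_homog; apply: sbr_graded. Qed.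
Fact rs_skew b c x y : homog b x -> homog c y ->
  {[x, y]} = - ((-1 : K) ^+ (b && c) *: {[y, x]}).
Proof. by move=> /rs_homog hx /rs_homog hy; apply: val_inj; apply: sbr_skew. Qed.
Fact rs_jacobi b c x y (z : root_sub) : homog b x -> homog c y ->
  {[x, {[y, z]}]} = {[{[x, y]}, z]} + (-1 : K) ^+ (b && c) *: {[y, {[x, z]}]}.
Proof. by move=> /rs_homog hx /rs_homog hy; apply: val_inj; apply: sbr_jacobi. Qed.
Fact rs_odd_cube x : homog true x -> {[x, {[x, x]}]} = 0.
Proof. by move=> /rs_homog hx; apply: val_inj; apply: sbr_odd_cube. Qed.

HB.instance Definition _ := isLieSuperalgebra.Build K root_sub rs_graded rs_skew
  rs_jacobi rs_odd_cube.

Definition rs_h (v : cartan R) : root_sub :=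
  RootSub (asboolT (root_homog_sum (RootHomogH t v))).
Fact rs_h_linear : linear rs_h.
Proof. by move=> k u v; apply: val_inj; rewrite /= linearP. Qed.
HB.instance Definition _ := GRing.isLinear.Build K (cartan R) root_sub *:%R rs_h rs_h_linear.

Definition rs_gen : generators R root_sub := Generators rs_h
  (fun i => RootSub (asboolT (root_homog_sum (RootHomogX t i))))
  (fun i => RootSub (asboolT (root_homog_sum (RootHomogY t i)))).

Lemma rs_chevalley : chevalley_relations par rs_gen.
Proof.
have [[hh hx hy] rhh rhx rhy rxy] := t_rel; split.
- by split=> *; apply/rs_homog; [apply: hh | apply: hx | apply: hy].
- by move=> u v; apply: val_inj; apply: rhh.
- by move=> v j; apply: val_inj; apply: rhx.
- by move=> v j; apply: val_inj; apply: rhy.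
- by move=> i j; apply: val_inj; rewrite /= rxy; case: eqP.
Qed.

(** The sums of homogeneous elements form a Lie superalgebra whose generators satisfy the same
    relations. The universal map into it, followed by the inclusion, carries generators to
    themselves, so it is the identity by uniqueness. *)
Theorem presented_root_sum : presented par t -> forall u, root_sum u.
Proof.
case=> _ univ u.
have [f [[fh fgh fgx fgy] _]] := univ root_sub rs_gen rs_chevalley.
have [f0 [cf0 uniq]] := univ L t t_rel.
pose f1 : {linear L -> L} := (val : root_sub -> L) \o f.
have e1 : f1 =1 f0.
  apply: uniq; split; first split.
  - by move=> b x; rewrite /= (fh.1 b x).
  - by move=> x y; rewrite /= (fh.2 x y).
  - by move=> v; rewrite /= fgh.
  - by move=> i; rewrite /= fgx.
  - by move=> i; rewrite /= fgy.
have e2 : idfun =1 f0 by apply: (uniq idfun); split.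
rewrite -[u]/(idfun u) e2 -e1 /=; exact: root_subP.
Qed.
End Generation.

(** * The isomorphism with gl(2|2) *)

Section Support.
Variable K : fieldType.
Local Notation gl := (gl22 K).
Implicit Types (d e : 'rV[int]_3) (M N : gl).

(** The sum of the first [i] basis vectors, chosen so that the matrix unit at (i, j) has degree
    [ord_wt j - ord_wt i]. Degrees are integral and separate the roots in every characteristic. *)
Definition ord_wt (i : 'I_4) : 'rV[int]_3 := \row_(k < 3) (k < i)%:R.

Definition supp d M := forall i j, d != ord_wt j - ord_wt i -> (M : 'M[K]_4) i j = 0.

Lemma supp0 d : supp d 0. Proof. by move=> i j _; rewrite mxE. Qed.
Lemma suppL d k M N : supp d M -> supp d N -> supp d (k *: M + N).
Proof. by move=> hM hN i j h; rewrite !mxE hM // hN // mulr0 addr0. Qed.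
Lemma suppB d M N : supp d M -> supp d N -> supp d (M - N).
Proof. by move=> hM hN i j h; rewrite !mxE hM // hN // subr0. Qed.
Lemma supp_spart d b M : supp d M -> supp d (spart b M).
Proof. by move=> hM i j h; rewrite mxE hM // if_same. Qed.
Lemma supp_mul d e M N : supp d M -> supp e N -> supp (d + e) (M *m N : gl).
Proof.
move=> hM hN i j h; rewrite mxE big1 // => k _.
case hd : (d == ord_wt k - ord_wt i); last by rewrite hM ?mul0r ?hd.
rewrite hN ?mulr0 //; apply: contra h => /eqP->; rewrite (eqP hd).
by rewrite addrC addrA subrK.
Qed.
Lemma supp_br d e M N : supp d M -> supp e N -> supp (d + e) {[M, N]}.
Proof.
move=> hM hN.
rewrite -[{[_, _]}]/(M *m N - N *m spart false M - (spart false N - spart true N) *m spart true M).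
by do ![apply: suppB]; [apply: supp_mul | rewrite addrC; apply: supp_mul => //; apply: supp_spart |
  rewrite addrC; apply: supp_mul; [apply: suppB|]; apply: supp_spart].
Qed.

Lemma supp_dg t : supp 0 (dg t).
Proof. by move=> i j; rewrite mxE; case: (i =P j) => [->|]; rewrite ?subrr ?eqxx // mulr0n. Qed.

Lemma supp_unit i j : supp (ord_wt j - ord_wt i) (unit_mx K i j).
Proof.
move=> k l; rewrite unit_mxE; case: (k =P i) => [->|] //=; case: (l =P j) => [->|] //=.
by rewrite eqxx.
Qed.

Lemma ord_wt_inj : injective ord_wt.
Proof.
have h (i j : 'I_4) : (i < j)%N -> ord_wt i != ord_wt j.
  move=> ij; apply/eqP => /rowP e; have i3 : (i < 3)%N by apply: leq_trans ij (ltn_ord j).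
  by have := e (Ordinal i3); rewrite !mxE /= ltnn ij.
move=> i j e; apply: val_inj; apply/eqP; rewrite eqn_leq leqNgt [in X in _ && X]leqNgt.
by apply/andP; split; apply/negP => /h; rewrite e eqxx.
Qed.

(** Every root of gl(2|2) has multiplicity one. This is computed over all 256 quadruples of indices,
    with the subtracted terms moved across to compare natural numbers. *)
Lemma ord_wt_diff i j k l :
  i != j -> ord_wt j - ord_wt i = ord_wt l - ord_wt k -> i = k /\ j = l.
Proof.
pose test (i j k l : nat) := (i != j) &&
  all (fun m => (m < j) + (m < k) == (m < l) + (m < i))%N (iota 0 3) ==> (i == k) && (j == l).
have tested : all (fun i => all (fun j => all (fun k => all (test i j k)
    (iota 0 4)) (iota 0 4)) (iota 0 4)) (iota 0 4) by [].
have t : test i j k l.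
  have mem (m : 'I_4) : (m : nat) \in iota 0 4 by rewrite mem_iota add0n /= ltn_ord.
  by move/allP/(_ _ (mem i))/allP/(_ _ (mem j))/allP/(_ _ (mem k))/allP/(_ _ (mem l)): tested.
move=> ij e; have : (i == k :> nat) && (j == l :> nat).
  apply: (implyP t); rewrite val_eqE ij andTb; apply/allP => m; rewrite mem_iota add0n => m3.
  move/rowP/(_ (Ordinal m3))/eqP: e; rewrite !mxE /=.
  by case: (m < i)%N; case: (m < j)%N; case: (m < k)%N; case: (m < l)%N.
by rewrite !val_eqE => /andP[/eqP-> /eqP->].
Qed.

Lemma supp_unique d M i j : supp d M -> (M : 'M[K]_4) i j != 0 -> d = ord_wt j - ord_wt i.
Proof. by move=> h nz; apply/eqP; apply: contraR nz => /h ->. Qed.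

Lemma supp_0dg M : supp 0 M -> exists t, M = dg t.
Proof.
move=> h; exists (\row_i (M : 'M[K]_4) i i); apply/matrixP => i j; rewrite !mxE.
case: (i =P j) => [->|ij]; first by rewrite mulr1n.
rewrite mulr0n h // eq_sym subr_eq0; apply/eqP => /ord_wt_inj e; exact: ij (esym e).
Qed.

Lemma supp_off d M i j : i != j -> supp d M -> (M : 'M[K]_4) i j != 0 ->
  M = (M : 'M[K]_4) i j *: unit_mx K i j.
Proof.
move=> ij h nz; apply/matrixP => k l; rewrite [RHS]mxE unit_mxE.
case: (eqVneq ((M : 'M[K]_4) k l) 0) => [z|nz'].
  case: (k =P i) => [ek|]; last by rewrite mulr0.
  case: (l =P j) => [el|]; last by rewrite mulr0.
  by move: nz; rewrite -ek -el z eqxx.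
have := supp_unique h nz'; rewrite (supp_unique h nz) => /(ord_wt_diff ij)[<- <-].
by rewrite !eqxx mulr1.
Qed.

Lemma lo_up_wt i : ord_wt (up i) - ord_wt (lo i) = delta_mx 0 i.
Proof. by apply/rowP => j; move: i j; apply: ord3P; apply: ord3P; rewrite !mxE. Qed.

Lemma supp_gl (R : realization (psl22_cartan_matrix K)) (L : lieSuperType K) (t : generators R L) 
    (f : {linear L -> gl}) d u : carries f t (gl_gen R) -> root_homog t d u -> supp d (f u).
Proof.
case=> -[_ fbr] fh fx fy; elim=> {d u} [d|v|i|i|d k u v _ IHu _ IHv|d e u v _ IHu _ IHv].
- by rewrite linear0; apply: supp0.
- by rewrite fh; apply: supp_dg.
- by rewrite fx -lo_up_wt; apply: supp_unit.
- by rewrite fy -lo_up_wt opprB; apply: supp_unit.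
- by rewrite linearP; apply: suppL.
- by rewrite fbr; apply: supp_br.
Qed.
End Support.

Section GlIso.
Variables (K : fieldType) (R : realization (psl22_cartan_matrix K)).
Variables (L : lieSuperType K) (t : generators R L).
Hypothesis t_pres : presented psl22_par t.
Variable f : {linear L -> gl22 K}.
Hypothesis f_car : carries f t (gl_gen R).

Local Notation gl := (gl22 K).

Let fbr u v : f {[u, v]} = {[f u, f v]}. Proof. by case: f_car => -[]. Qed.
Let fh v : f (gen_h t v) = dg (phi_row v). Proof. by case: f_car. Qed.
Let fx i : f (gen_x t i) = unit_mx K (lo i) (up i). Proof. by case: f_car. Qed.
Let fy i : f (gen_y t i) = unit_mx K (up i) (lo i). Proof. by case: f_car. Qed.
Let t_rel := t_pres.1.

(** In gl(2|2) elements of different degrees have disjoint supports, so if the image of [u]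
    vanishes, the image of each of its homogeneous components does. On h the map is injective by
    [phi_row_inj]. *)
Lemma ker_small : small_ideal t [set u | f u = 0].
Proof.
split.
- split=> /= [|k u v hu hv|u v hv|u v hu]; first exact: linear0.
  + by rewrite linearP hu hv scaler0 addr0.
  + by rewrite fbr hv sbr0r.
  + by rewrite fbr hu sbr0l.
- move=> u /= fu; have [r [eu hr]] := presented_root_sum t_rel t_pres u.
  pose D := undup [seq p.1 | p <- r].
  pose comp d := \sum_(p <- r | p.1 == d) p.2.
  have hcomp d : root_homog t d (comp d).
    rewrite /comp big_seq_cond; apply: big_ind => [|x y hx hy|p /andP[hp /eqP <-]].
    - exact: RootHomog0.
    - by rewrite -[x]scale1r; apply: RootHomogD.
    - exact: hr.
  have hsum : u = \sum_(d <- D) comp d.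
    rewrite eu /comp; under [RHS]eq_bigr => d _ do rewrite big_mkcond.
    rewrite exchange_big big_seq [RHS]big_seq; apply: eq_bigr => p hp.
    rewrite (bigD1_seq p.1) ?undup_uniq //=; last by rewrite mem_undup map_f.
    by rewrite eqxx big1 ?addr0 // => d; rewrite eq_sym => /negPf->.
  have fcomp d : d \in D -> f (comp d) = 0.
    move=> hd; apply/matrixP => i j; rewrite mxE.
    case: (eqVneq d (ord_wt j - ord_wt i)) => [ed|]; last exact: supp_gl f_car (hcomp d) i j.
    have : (f u : 'M[K]_4) i j = 0 by rewrite fu mxE.
    rewrite hsum linear_sum summxE (bigD1_seq d) ?undup_uniq //= big1 ?addr0 // => d' hd'.
    by apply: (supp_gl f_car (hcomp d')); rewrite -ed.
  exists [seq comp d | d <- D]; split; first by rewrite big_map.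
  by move=> v /mapP[d hd ->]; split; [apply: fcomp | exists d].
- move=> v /=; rewrite fh => e; have -> : v = 0; last by rewrite linear0.
  apply: phi_row_inj; apply/rowP => i.
  by have /matrixP/(_ i i) := e; rewrite !mxE eqxx mulr1n.
Qed.

Lemma f_surj M : exists u, f u = M.
Proof.
pose im (N : gl) := exists u, f u = N.
have imL k M' N : im M' -> im N -> im (k *: M' + N).
  by move=> [u <-] [v <-]; exists (k *: u + v); rewrite linearP.
have im0 : im 0 by exists 0; rewrite linear0.
have imZ k M' : im M' -> im (k *: M') by move=> h; rewrite -[_ *: _]addr0; apply: imL.
have imD M' N : im M' -> im N -> im (M' + N) by rewrite -{2}[M']scale1r; apply: imL.
have imbr M' N : im M' -> im N -> im {[M', N]}.
  by move=> [u <-] [v <-]; exists {[u, v]}; rewrite fbr.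
have imx i : im (unit_mx K (lo i) (up i)) by exists (gen_x t i).
have imy i : im (unit_mx K (up i) (lo i)) by exists (gen_y t i).
have imdg d : im (dg d).
  by have [v hv] := phi_row_surj R d; exists (gen_h t v); rewrite fh hv.
have imbr3 i j k : i != k -> im (unit_mx K i j) -> im (unit_mx K j k) -> im (unit_mx K i k).
  move=> ik h1 h2; have := imbr _ _ h1 h2; rewrite br_unit eqxx scale1r.
  by rewrite [k == i]eq_sym (negPf ik) scale0r scaler0 subr0.
have x0 : im (unit_mx K 0 1) by have := imx 0; congr (im (unit_mx K _ _)); apply: val_inj.
have x1 : im (unit_mx K 1 2) by have := imx 1; congr (im (unit_mx K _ _)); apply: val_inj.
have x2 : im (unit_mx K 2 3) by have := imx 2; congr (im (unit_mx K _ _)); apply: val_inj.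
have y0 : im (unit_mx K 1 0) by have := imy 0; congr (im (unit_mx K _ _)); apply: val_inj.
have y1 : im (unit_mx K 2 1) by have := imy 1; congr (im (unit_mx K _ _)); apply: val_inj.
have y2 : im (unit_mx K 3 2) by have := imy 2; congr (im (unit_mx K _ _)); apply: val_inj.
have x02 : im (unit_mx K 0 2) by apply: imbr3 x0 x1.
have x13 : im (unit_mx K 1 3) by apply: imbr3 x1 x2.
have x03 : im (unit_mx K 0 3) by apply: imbr3 x02 x2.
have y20 : im (unit_mx K 2 0) by apply: imbr3 y1 y0.
have y31 : im (unit_mx K 3 1) by apply: imbr3 y2 y1.
have y30 : im (unit_mx K 3 0) by apply: imbr3 y31 y0.
have imE i j : im (unit_mx K i j).
  case: (eqVneq i j) => [->|].
    have -> : unit_mx K j j = dg (delta_mx 0 j).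
      apply/matrixP => k l; rewrite unit_mxE !mxE.
      by case: (k =P l) => [<-|kl]; case: (k =P j) => [ek|] //=; case: (l =P j) => [el|] //=;
        case: kl; rewrite ek el.
    exact: imdg.
  by move: i j; apply: ord4P; apply: ord4P.
rewrite -/(im M) (matrix_sum_delta (M : 'M[K]_4)).
by apply: (big_ind im im0 imD) => i _; apply: (big_ind im im0 imD) => j _; apply: imZ; apply: imE.
Qed.

Variables (G : lieSuperType K) (s : generators R G) (q : {linear L -> G}).
Hypothesis q_car : carries q t s.
Hypothesis q_surj : forall w, exists u, q u = w.
Hypothesis q_small : small_ideal t [set u | q u = 0].
Hypothesis q_max : forall I, small_ideal t I -> I `<=` [set u | q u = 0].

Lemma ker_eq u : q u = 0 <-> f u = 0.
Proof.
split=> [qu|fu]; last exact: (q_max ker_small).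
(* If [f v] is diagonal, [v] differs from an element of h by an element of the kernel of [f], hence
   of [q]. So that element of h lies in the ideal, which meets h trivially. *)
have ker_dg v d : q v = 0 -> f v = dg d -> f v = 0.
  move=> qv fv; have [w hw] := phi_row_surj R d.
  have e : f (v - gen_h t w) = 0 by rewrite linearB fh hw fv subrr.
  have := q_max ker_small e; rewrite /= linearB qv sub0r => /eqP; rewrite oppr_eq0 => /eqP qw.
  have [_ _ h0] := q_small; have := h0 _ qw => /(congr1 f); rewrite linear0 fh hw.
  by rewrite fv.
have [_ gr _] := q_small; have [r [-> hr]] := gr _ qu.
rewrite linear_sum big_seq big1 // => v /hr[qv [d hd]].
have hsupp := supp_gl f_car hd.
apply/matrixP => i j; rewrite [RHS]mxE; apply/eqP; apply: contraT => nz.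
case: (eqVneq i j) => [ij|ij].
  have d0 : d = 0 by rewrite (supp_unique hsupp nz) ij subrr.
  have [e he] : exists e, f v = dg e by apply: supp_0dg; rewrite -d0.
  by move: nz; rewrite (ker_dg v e qv he) mxE eqxx.
(* Otherwise [f v] is a nonzero multiple of one off-diagonal matrix unit. The bracket with a
   preimage of the transposed unit stays in the ideal and has a nonzero diagonal image,
   contradicting [ker_dg]. *)
have [e he] := f_surj (unit_mx K j i).
have [[_ _ idr idl] _ _] := q_small.
have fve : f {[v, e]} = (f v : 'M[K]_4) i j *: {[unit_mx K i j, unit_mx K j i]}.
  by rewrite fbr he {1}(supp_off ij hsupp nz) sbrZl.
have {}fve : exists w, f {[v, e]} = dg w /\ w 0 i != 0.
  exists ((f v : 'M[K]_4) i j *: (delta_mx 0 i - (-1) ^+ (odd_ord i (+) odd_ord j) *: delta_mx 0 j)).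
  rewrite fve; split.
    rewrite br_unit [odd_ord j (+) _]addbC andbb !eqxx !scale1r.
    apply/matrixP => k l; rewrite !mxE; case: (k =P l) => [<-|kl]; first by rewrite !andbb.
    have h (m : 'I_4) : (k == m) && (l == m) = false.
      by apply/negP => /andP[/eqP e1 /eqP e2]; case: kl; rewrite e1 e2.
    by rewrite !h mulr0 subr0 mulr0.
  by rewrite !mxE !eqxx (negPf ij) mulr0 subr0 mulr1.
have [w [hw wi]] := fve.
have := ker_dg _ _ (idl v e qv) hw; rewrite hw => /matrixP/(_ i i); rewrite !mxE eqxx mulr1n => z.
by rewrite z eqxx in wi.
Qed.

Theorem gl_iso : exists F : {linear G -> gl},
  [/\ superhom F, injective F, forall M, exists w, F w = M & carries F s (gl_gen R)].
Proof.
pose F w := f (xget 0 [set u | q u = w]).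
have FE u : F (q u) = f u.
  apply/eqP; rewrite -subr_eq0 -linearB; apply/eqP/ker_eq; rewrite linearB /F.
  case: xgetP => [v _ /= -> |no]; first by rewrite subrr.
  by case: (no u).
have lF : linear F.
  move=> k w w'; have [u <-] := q_surj w; have [u' <-] := q_surj w'.
  by rewrite -linearP !FE linearP.
pose F' : {linear G -> gl} := HB.pack F (GRing.isLinear.Build K G gl *:%R F lF).
have [[fsp _] _ _ _] := f_car; have [[qsp qbr] qh qx qy] := q_car.
have Fhom : superhom F'.
  split=> [b w|w w'] /=; have [u <-] := q_surj w.
    by rewrite -qsp !FE fsp.
  by have [u' <-] := q_surj w'; rewrite -qbr !FE fbr.
exists F'; split=> //.
- move=> w w' e; have := e; have [u <-] := q_surj w; have [u' <-] := q_surj w' => /=.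
  rewrite !FE => /eqP; rewrite -subr_eq0 -linearB => /eqP/ker_eq/eqP.
  by rewrite linearB subr_eq0 => /eqP.
- by move=> M; have [u <-] := f_surj M; exists (q u); rewrite /= FE.
- by split=> // i; rewrite /= -?qh -?qx -?qy FE ?fh ?fx ?fy.
Qed.
End GlIso.

Theorem contragredient_gl (K : fieldType) (R : realization (psl22_cartan_matrix K))
    (G : lieSuperType K) (s : generators R G) :
  contragredient psl22_par s -> exists F : {linear G -> gl22 K},
  [/\ superhom F, injective F, forall M, exists w, F w = M & carries F s (gl_gen R)].
Proof.
move=> [L [t [q [t_pres q_car q_surj q_small q_max]]]].
have [f [f_car _]] := t_pres.2 _ _ (gl_chevalley R).
exact: (gl_iso t_pres f_car q_car q_surj q_small q_max).
Qed.

(** * The quotient of sl(2|2) by the scalars *)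

Section Supertrace.
Variable K : fieldType.
Local Notation gl := (gl22 K).
Implicit Types M N : gl.

Definition ent M (i j : 'I_4) : K := (M : 'M[K]_4) i j.

Lemma ent_br M N i j : ent {[M, N]} i j =
  \sum_k (ent M i k * ent N k j -
    (-1) ^+ ((odd_ord i (+) odd_ord k) && (odd_ord k (+) odd_ord j)) * (ent N i k * ent M k j)).
Proof.
rewrite /ent -[{[_, _]}]/(M *m N - N *m spart false M - (spart false N - spart true N) *m spart true M).
rewrite !mxE -!sumrB; apply: eq_bigr => k _; rewrite !mxE.
by case: (odd_ord i); case: (odd_ord k); case: (odd_ord j) => /=; ring.
Qed.

Lemma entL k M N i j : ent (k *: M + N) i j = k * ent M i j + ent N i j.
Proof. by rewrite /ent !mxE. Qed.
Lemma ent0 i j : ent (0 : gl) i j = 0. Proof. by rewrite /ent mxE. Qed.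
Lemma ent_spart b M i j :
  ent (spart b M) i j = if odd_ord i (+) odd_ord j == b then ent M i j else 0.
Proof. by rewrite /ent mxE. Qed.
Lemma ent_ext M N : (forall i j, ent M i j = ent N i j) -> M = N.
Proof. by move=> h; apply/matrixP. Qed.
Lemma ent_unit a b i j : ent (unit_mx K a b) i j = ((i == a) && (j == b))%:R.
Proof. exact: unit_mxE. Qed.

Definition str M : K := ent M 0 0 + ent M 1 1 - ent M 2 2 - ent M 3 3.

Lemma strL k M N : str (k *: M + N) = k * str M + str N.
Proof. by rewrite /str !entL; ring. Qed.

Lemma str0 : str 0 = 0. Proof. by rewrite /str !ent0; ring. Qed.

Lemma str_br M N : str {[M, N]} = 0.
Proof. by rewrite /str !ent_br !sum4E /=; ring. Qed.

Lemma dg_br (t : 'rV[K]_4) M i j : ent {[dg t, M]} i j = (t 0 i - t 0 j) * ent M i j.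
Proof. exact: br_dgl. Qed.

(** Off-diagonal matrix units are eigenvectors of diagonal matrices with eigenvalue 1 for a suitable
    one, and the diagonal matrices of supertrace 0 are spanned by the brackets of E_12, E_23, E_34
    with their transposes. *)
Lemma str0_sum M : str M = 0 -> exists r : seq (gl * gl), M = \sum_(p <- r) {[p.1, p.2]}.
Proof.
move=> hM; pose D (N : gl) := exists r : seq (gl * gl), N = \sum_(p <- r) {[p.1, p.2]}.
have D0 : D 0 by exists [::]; rewrite big_nil.
have DD N N' : D N -> D N' -> D (N + N').
  by move=> [r ->] [r' ->]; exists (r ++ r'); rewrite big_cat.
have Dbr N N' : D {[N, N']} by exists [:: (N, N')]; rewrite big_seq1.
have DZ k N : D N -> D (k *: N).
  move=> [r ->]; exists [seq (k *: p.1, p.2) | p <- r].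
  by rewrite big_map scaler_sumr; apply: eq_bigr => p _; rewrite sbrZl.
have Dunit i j : i != j -> D (unit_mx K i j).
  move=> ij; have -> : unit_mx K i j = {[dg (delta_mx 0 i), unit_mx K i j]}; last exact: Dbr.
  apply: ent_ext => k l; rewrite dg_br ent_unit !mxE eqxx /=.
  case: (k =P i) => _; case: (l =P j) => [->|_]; rewrite ?mulr0 //=.
  by rewrite eq_sym (negPf ij) subr0 mulr1.
pose t : 'rV[K]_4 := \row_i ent M i i.
pose Moff : gl := M - dg t.
have hoff i j : ent Moff i j = if i == j then 0 else ent M i j.
  rewrite /ent !mxE; case: (i =P j) => [->|]; rewrite ?mulr1n ?subrr //.
  by rewrite mulr0n subr0.
rewrite -/(D M) -(subrK (dg t) M); apply: (DD).
  rewrite -/Moff -/(D Moff) (matrix_sum_delta (Moff : 'M[K]_4)).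
  apply: (big_ind D D0 DD) => i _; apply: (big_ind D D0 DD) => j _.
  rewrite -[X in X *: _]/(ent Moff i j) hoff; case: (eqVneq i j) => [->|ij].
    by rewrite scale0r; apply: D0.
  exact/DZ/Dunit.
have -> : dg t = ent M 0 0 *: {[unit_mx K 0 1, unit_mx K 1 0]} +
    ((ent M 0 0 + ent M 1 1) *: {[unit_mx K 1 2, unit_mx K 2 1]} +
    (- ent M 3 3 *: {[unit_mx K 2 3, unit_mx K 3 2]} + 0)).
  have e22 : ent M 2 2 = ent M 0 0 + ent M 1 1 - ent M 3 3.
    by apply/eqP; rewrite -subr_eq0 -oppr_eq0 -hM /str; apply/eqP; ring.
  apply: ent_ext; apply: ord4P; apply: ord4P;
    rewrite !entL ent0 !ent_br !sum4E !ent_unit /= [LHS]mxE /= ?mxE ?e22 ?mulr1n ?mulr0n; ring.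
by do 3![apply: (DD); first by apply: (DZ); apply: (Dbr)]; apply: (D0).
Qed.
End Supertrace.

(** * The embedding of psl(2|2) into osp_{-1}(4|2) *)

Section Quotient.
Variables (K : fieldType) (R : realization (psl22_cartan_matrix K)).
Variables (M : superalgType K) (crd : nat -> M -> K) (elt : (nat -> K) -> M).
Hypothesis two0 : (2 : K) != 0.
Hypothesis crd_ext : forall a b, (forall n, (n < 17)%N -> crd n a = crd n b) -> a = b.
Hypothesis crd_linear : forall n k a b, crd n (k *: a + b) = k * crd n a + crd n b.
Hypothesis crd_br : forall a b, crd^~ {[a, b]} = br_crd false (crd^~ a) (crd^~ b).
Hypothesis crd_spart : forall e a,
  crd^~ (spart e a) = fun n => if (8 < n)%N == e then crd n a else 0.
Hypothesis crd_elt : forall F,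
  crd^~ (elt F) = fun n => if (n < 17)%N then F n else 0.
Local Notation gl := (gl22 K).
Implicit Types N : gl.

(** The diagonal blocks go to sl(V_1) and sl(V_2), the upper right block to V_1 (x) V_2 (x) e_0, and
    the lower left one, halved, to V_1 (x) V_2 (x) e_1. *)
Definition rho_crd N (n : nat) : K :=
  nth 0 [:: (ent N 0 0 - ent N 1 1) / 2; ent N 0 1; ent N 1 0;
    (ent N 2 2 - ent N 3 3) / 2; ent N 2 3; ent N 3 2; 0; 0; 0;
    - ent N 0 3; - (ent N 2 1 / 2); ent N 0 2; - (ent N 3 1 / 2);
    - ent N 1 3; ent N 2 0 / 2; ent N 1 2; ent N 3 0 / 2] n.

Definition rho N : M := elt (rho_crd N).

Lemma crd_rho N n : (n < 17)%N -> crd n (rho N) = rho_crd N n.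
Proof. by move=> h; rewrite [LHS](congr1 (@^~ n) (crd_elt _)) h. Qed.

Lemma rhoL k N N' : rho (k *: N + N') = k *: rho N + rho N'.
Proof.
apply: crd_ext => n n17; rewrite crd_linear !crd_rho // /rho_crd.
by do 17?[case: n n17 => [|n] // n17]; rewrite /= ?entL; ring.
Qed.

Lemma rho0 : rho 0 = 0.
Proof.
have h := rhoL 0 0 0; rewrite scaler0 addr0 scale0r add0r in h.
have := rhoL (-1) 0 0; rewrite scaler0 addr0 scaleN1r addNr; exact.
Qed.

Lemma rho_spart b N : rho (spart b N) = spart b (rho N).
Proof.
apply: crd_ext => n n17; rewrite [RHS](congr1 (@^~ n) (crd_spart _ _)) !crd_rho // /rho_crd.
by case: b; do 17?[case: n n17 => [|n] // n17]; rewrite /= ?ent_spart /=; ring.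
Qed.

Lemma str_eq0 N : str N = 0 -> ent N 3 3 = ent N 0 0 + ent N 1 1 - ent N 2 2.
Proof.
move=> h; apply/eqP; rewrite -subr_eq0 -oppr_eq0 -h /str; apply/eqP; ring.
Qed.

(** On all of gl(2|2) this fails: [rho] kills diag(1, 1, 0, 0), which acts nontrivially on the odd
    part. *)
Lemma rho_br N N' : str N = 0 -> str N' = 0 -> rho {[N, N']} = {[rho N, rho N']}.
Proof.
move=> /str_eq0 e /str_eq0 e'.
apply: crd_ext => n n17; rewrite [RHS](congr1 (@^~ n) (crd_br _ _)) crd_rho // /rho_crd.
do 17?[case: n n17 => [|n] // n17]; rewrite /br_crd /omega2 !crd_rho // /rho_crd /= ?ent_br ?sum4E /= ?e ?e';
  field; rewrite ?two0 //.
Qed.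

(** On the diagonal [rho] sees only the difference inside each block. Supertrace 0 then makes twice
    the entry of one block equal to twice that of the other. *)
Lemma rho_eq0 N : str N = 0 -> (rho N = 0 <-> exists k, N = k *: (1%:M : gl)).
Proof.
move=> /str_eq0 e3; split=> [h|[k ->]].
  have e n : (n < 17)%N -> rho_crd N n = 0.
    move=> hn; rewrite -crd_rho // h; have := crd_linear n 0 0 0.
    rewrite scaler0 addr0 mul0r add0r => _.
    by have := crd_linear n (-1) 0 0; rewrite scaler0 addr0 mulN1r addNr.
  have i2 : (2^-1 : K) != 0 by rewrite invr_eq0.
  have e01 : ent N 0 0 = ent N 1 1.
    by apply/eqP; rewrite -subr_eq0; apply/eqP/(mulIf i2); rewrite mul0r; apply: (e 0%N isT).
  have e23 : ent N 2 2 = ent N 3 3.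
    by apply/eqP; rewrite -subr_eq0; apply/eqP/(mulIf i2); rewrite mul0r; apply: (e 3%N isT).
  have e12 : ent N 0 0 = ent N 2 2.
    apply: (mulfI two0); apply/eqP; rewrite -subr_eq0; apply/eqP.
    transitivity (ent N 3 3 - ent N 2 2 + (ent N 0 0 - ent N 1 1)); first by rewrite e3; ring.
    by rewrite e23 e01; ring.
  exists (ent N 0 0); apply: ent_ext.
  have o k l n x : (n < 17)%N -> rho_crd N n = x * ent N k l -> x != 0 -> ent N k l = 0.
    by move=> hn hx x0; apply: (mulfI x0); rewrite -hx mulr0 e.
  have sE k l : ent (ent N 0 0 *: (1%:M : gl)) k l = ent N 0 0 * (k == l)%:R by rewrite /ent !mxE.
  apply: ord4P; apply: ord4P; rewrite sE /= ?mulr1 ?mulr0 //.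
  - exact: (e 1%N isT).
  - exact: (e 11%N isT).
  - by apply: oppr_inj; rewrite oppr0; apply: (e 9%N isT).
  - exact: (e 2%N isT).
  - exact: (e 15%N isT).
  - by apply: oppr_inj; rewrite oppr0; apply: (e 13%N isT).
  - by apply/(mulIf i2); rewrite mul0r; apply: (e 14%N isT).
  - by apply/(mulIf i2)/oppr_inj; rewrite mul0r oppr0; apply: (e 10%N isT).
  - exact: (e 4%N isT).
  - by apply/(mulIf i2); rewrite mul0r; apply: (e 16%N isT).
  - by apply/(mulIf i2)/oppr_inj; rewrite mul0r oppr0; apply: (e 12%N isT).
  - exact: (e 5%N isT).
  - by rewrite -e23 e12.
apply: crd_ext => n n17; rewrite crd_rho // -rho0 crd_rho // /rho_crd.
by do 17?[case: n n17 => [|n] // n17]; rewrite /= /ent !mxE /=; ring.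
Qed.

Variables (G : lieSuperType K) (s : generators R G) (F : {linear G -> gl}).
Hypothesis F_hom : superhom F.
Hypothesis F_inj : injective F.
Hypothesis F_surj : forall N, exists w, F w = N.
Hypothesis F_car : carries F s (gl_gen R).

Lemma derivedE w : derived w <-> str (F w) = 0.
Proof.
split=> [[r ->]|/str0_sum[r hr]].
  elim: r => [|p r IHr]; first by rewrite big_nil linear0 str0.
  rewrite big_cons -[X in X + _]scale1r linearP strL IHr F_hom.2 str_br; ring.
have [r' hr'] : exists r' : seq (G * G), [seq (F p.1, F p.2) | p <- r'] = r.
  elim: r {hr} => [|[N N'] r [r' <-]]; first by exists [::].
  have [u <-] := F_surj N; have [u' <-] := F_surj N'.
  by exists ((u, u') :: r').
exists r'; apply: F_inj; rewrite hr -hr' big_map.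
rewrite (big_morph F (fun x y => linearD F x y) (linear0 F)).
by apply: eq_bigr => p _; rewrite F_hom.2.
Qed.

Lemma centerE w : center_of (derived (L := G)) w <->
  str (F w) = 0 /\ exists k, F w = k *: (1%:M : gl).
Proof.
split=> [[/derivedE hw hc]|[hw [k hk]]]; last first.
  split; first exact/derivedE.
  move=> u _; apply: F_inj; rewrite F_hom.2 hk linear0.
  have -> : k *: (1%:M : gl) = dg (const_mx k).
    by apply: ent_ext => i j; rewrite /ent !mxE mulr_natr.
  by apply: ent_ext => i j; rewrite dg_br !mxE subrr mul0r ent0.
split=> //.
have comm N : str N = 0 -> {[F w, N]} = 0.
  move=> hN; have [u hu] := F_surj N.
  by rewrite -hu -F_hom.2 hc ?linear0 //; apply/derivedE; rewrite hu.
have cdg (t : 'rV[K]_4) i j : t 0 0 + t 0 1 - t 0 2 - t 0 3 = 0 -> t 0 j - t 0 i != 0 ->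
    ent (F w) i j = 0.
  move=> ht hij; apply: (mulfI hij); rewrite mulr0.
  rewrite -[LHS]br_dgr comm ?mxE // /str /ent !mxE /= !mulr1n -ht; ring.
(* Two diagonal matrices of supertrace 0: every off-diagonal matrix unit has weight 1 or 2, up to
   sign, under one of them. *)
pose t1 : 'rV[K]_4 := \row_i nth 0 [:: 1; -1; 0; 0] i.
pose t3 : 'rV[K]_4 := \row_i nth 0 [:: 0; 0; 1; -1] i.
have z1 i j : t1 0 j - t1 0 i != 0 -> ent (F w) i j = 0.
  by apply: cdg; rewrite !mxE /=; ring.
have z3 i j : t3 0 j - t3 0 i != 0 -> ent (F w) i j = 0.
  by apply: cdg; rewrite !mxE /=; ring.
have one0 : (1 : K) != 0 by exact: oner_neq0.
have off i j : i != j -> ent (F w) i j = 0.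
  move: i j; apply: ord4P; apply: ord4P => // _; first [
    by apply: z1; rewrite !mxE /= ?opprK ?subr0 ?sub0r ?oppr_eq0 // -opprD oppr_eq0
  | by apply: z3; rewrite !mxE /= ?opprK ?subr0 ?sub0r ?oppr_eq0 // -opprD oppr_eq0].
have diag (i j : 'I_4) : str (unit_mx K i j) = 0 -> ent {[F w, unit_mx K i j]} i j = 0.
  by move=> /comm->; rewrite ent0.
have str_unit (i j : 'I_4) : i != j -> str (unit_mx K i j) = 0.
  by move: i j; apply: ord4P; apply: ord4P; rewrite // /str !ent_unit /= => _; ring.
have e01 : ent (F w) 0 0 = ent (F w) 1 1.
  have := diag 0 1 (str_unit 0 1 isT); rewrite ent_br sum4E !ent_unit /= => e.
  by apply/eqP; rewrite -subr_eq0 -e; apply/eqP; ring.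
have e12 : ent (F w) 1 1 = ent (F w) 2 2.
  have := diag 1 2 (str_unit 1 2 isT); rewrite ent_br sum4E !ent_unit /= => e.
  by apply/eqP; rewrite -subr_eq0 -e; apply/eqP; ring.
have e23 : ent (F w) 2 2 = ent (F w) 3 3.
  have := diag 2 3 (str_unit 2 3 isT); rewrite ent_br sum4E !ent_unit /= => e.
  by apply/eqP; rewrite -subr_eq0 -e; apply/eqP; ring.
exists (ent (F w) 0 0); apply: ent_ext => i j.
have -> : ent (ent (F w) 0 0 *: (1%:M : gl)) i j = ent (F w) 0 0 * (i == j)%:R.
  by rewrite /ent !mxE.
case: (eqVneq i j) => [<-|/off->]; last by rewrite mulr0.
by rewrite mulr1; move: i; apply: ord4P; rewrite // -?e23 -?e12 -?e01.
Qed.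

Variables (g : lieSuperType K) (pi : G -> g).
Hypothesis pi_def : derived_mod_center pi.

Let S := derived (L := G).

(** Nothing is known about [pi] outside the derived algebra, so preimages are chosen inside it. *)
Definition lift_pi (w : g) : G := xget 0 [set u | S u /\ pi u = w].

Lemma lift_piP w : S (lift_pi w) /\ pi (lift_pi w) = w.
Proof.
rewrite /lift_pi; case: xgetP => [u _ //|no]; have [_ _ _ sj _] := pi_def.
by have [u hu e] := sj w; case: (no u).
Qed.

Definition psl_emb (w : g) : M := rho (F (lift_pi w)).

Lemma derivedL k u v : S u -> S v -> S (k *: u + v).
Proof. by move=> /derivedE hu /derivedE hv; apply/derivedE; rewrite linearP strL hu hv mulr0 addr0. Qed.

Lemma pi_eq u v : S u -> S v -> (pi u = pi v <-> rho (F u) = rho (F v)).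
Proof.
move=> hu hv; have [lin _ _ _ ker] := pi_def.
have hd : S (-1 *: v + u) by apply: derivedL.
have e : pi (-1 *: v + u) = pi u - pi v by rewrite lin // scaleN1r addrC.
have e' : rho (F (-1 *: v + u)) = rho (F u) - rho (F v) by rewrite linearP rhoL scaleN1r addrC.
have /rho_eq0 h0 : str (F (-1 *: v + u)) = 0 by apply/derivedE.
split=> h; apply/eqP; rewrite -subr_eq0; apply/eqP.
  rewrite -e'; apply/h0; have : pi (-1 *: v + u) = 0 by rewrite e h subrr.
  by move/(ker _ hd)/centerE => -[].
rewrite -e; apply/(ker _ hd)/centerE; split; first exact/derivedE.
by apply/h0; rewrite e' h subrr.
Qed.

Lemma psl_emb_pi u : S u -> psl_emb (pi u) = rho (F u).
Proof. by move=> hu; have [hl e] := lift_piP (pi u); apply/pi_eq. Qed.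

Lemma pi_surj w : exists2 u, S u & pi u = w.
Proof. by exists (lift_pi w); case: (lift_piP w). Qed.

Fact psl_emb_linear : linear psl_emb.
Proof.
have [lin _ _ _ _] := pi_def.
move=> k w w'; have [u hu <-] := pi_surj w; have [v hv <-] := pi_surj w'.
by rewrite -lin // !psl_emb_pi //; [rewrite linearP rhoL | apply: derivedL].
Qed.
HB.instance Definition _ := GRing.isLinear.Build K g M *:%R psl_emb psl_emb_linear.
Definition psl_emb_lin : {linear g -> M} := psl_emb.

Lemma psl_emb_hom : superhom psl_emb.
Proof.
have [_ sp br _ _] := pi_def; split=> [b w|w w'] /=.
  have [u hu <-] := pi_surj w; rewrite -sp // !psl_emb_pi //; last first.
    apply/derivedE; move/derivedE: hu; rewrite F_hom.1 /str !ent_spart /=.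
    by case: b => /= [_|//]; ring.
  by rewrite F_hom.1 rho_spart.
have [u hu <-] := pi_surj w; have [v hv <-] := pi_surj w'.
rewrite -br // !psl_emb_pi //; last by apply/derivedE; rewrite F_hom.2 str_br.
by rewrite F_hom.2 rho_br //; apply/derivedE.
Qed.

Lemma psl_emb_inj : injective psl_emb.
Proof.
move=> w w'; have [u hu <-] := pi_surj w; have [v hv <-] := pi_surj w'.
by rewrite !psl_emb_pi // => h; apply/pi_eq.
Qed.

Lemma psl_emb_im a : (exists w, psl_emb w = a) <-> in_psl crd a.
Proof.
split=> [[w <-]|[h6 h7 h8]]; first by split; rewrite crd_rho.
(* The inverse of [rho] on the ideal, with the lower left block doubled again. *)
pose N : gl := \matrix_(i, j) nth 0 (nth [::] [::
  [:: crd 0%N a; crd 1%N a; crd 11%N a; - crd 9%N a];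
  [:: crd 2%N a; - crd 0%N a; crd 15%N a; - crd 13%N a];
  [:: 2 * crd 14%N a; - (2 * crd 10%N a); crd 3%N a; crd 4%N a];
  [:: 2 * crd 16%N a; - (2 * crd 12%N a); crd 5%N a; - crd 3%N a]] i) j.
have hN : str N = 0 by rewrite /str /ent !mxE /=; ring.
have [u hu] := F_surj N; exists (pi u).
rewrite psl_emb_pi; last by apply/derivedE; rewrite hu.
rewrite hu; apply: crd_ext => n n17; rewrite crd_rho // /rho_crd /ent.
by do 17?[case: n n17 => [|n] // n17]; rewrite /= ?mxE /= ?h6 ?h7 ?h8 //; field; rewrite ?two0.
Qed.

Lemma psl_emb_xy i :
  psl_emb (pi (gen_x s i)) = rho (unit_mx K (lo i) (up i)) /\
  psl_emb (pi (gen_y s i)) = rho (unit_mx K (up i) (lo i)).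
Proof.
have [_ _ fx fy] := F_car.
have h (a b : 'I_4) : a != b -> str (unit_mx K a b) = 0.
  by move: a b; apply: ord4P; apply: ord4P; rewrite // /str !ent_unit /= => _; ring.
have lu : lo i != up i by move: i; apply: ord3P.
rewrite !psl_emb_pi ?fx ?fy //; apply/derivedE; rewrite ?fx ?fy h // eq_sym //.
Qed.

Lemma psl_emb_torus w :
  (exists h, S (gen_h s h) /\ w = pi (gen_h s h)) <->
  forall n, (n < 17)%N -> n != 0%N -> n != 3%N -> crd n (psl_emb w) = 0.
Proof.
have [_ fh _ _] := F_car; split=> [[h [hS ->]] n n17 n0 n3|hw].
  rewrite psl_emb_pi // crd_rho // fh /rho_crd /ent.
  by do 17?[case: n n17 n0 n3 => [|n] // n17 n0 n3]; rewrite /= ?mxE /= ?mulr0n ?oppr0 ?mul0r ?oppr0.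
pose a := crd 0%N (psl_emb w); pose d := crd 3%N (psl_emb w).
have [h hh] := phi_row_surj R (\row_(i < 4) nth 0 [:: a; - a; d; - d] i).
have Fh : F (gen_h s h) = dg (\row_(i < 4) nth 0 [:: a; - a; d; - d] i).
  by rewrite fh /= /phi hh.
have hS : S (gen_h s h).
  by apply/derivedE; rewrite Fh /str /ent !mxE /= ?mulr1n; ring.
exists h; split=> //; apply: psl_emb_inj; rewrite psl_emb_pi // Fh.
apply: crd_ext => n n17; rewrite crd_rho // /rho_crd /ent.
case: (eqVneq n 0%N) => [->|n0]; first by rewrite !mxE /= !mulr1n -/a; field; rewrite ?two0.
case: (eqVneq n 3%N) => [->|n3]; first by rewrite !mxE /= !mulr1n -/d; field; rewrite ?two0.
rewrite hw //.
by do 17?[case: n n17 n0 n3 => [|n] // n17 n0 n3]; rewrite /= ?mxE /= ?mulr0n ?mul0r ?oppr0.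
Qed.
End Quotient.

(** * Transfer of the results on the ideal to the quotient of the derived algebra of g(A) *)

Section Assembly.
Variable K : fieldType.
Variables (M : superalgType K) (crd : nat -> M -> K) (elt : (nat -> K) -> M).
Hypothesis two0 : (2 : K) != 0.
Hypothesis crd_ext : forall a b, (forall n, (n < 17)%N -> crd n a = crd n b) -> a = b.
Hypothesis crd_linear : forall n k a b, crd n (k *: a + b) = k * crd n a + crd n b.
Hypothesis crd_br : forall a b, crd^~ {[a, b]} = br_crd false (crd^~ a) (crd^~ b).
Hypothesis crd_spart : forall e a,
  crd^~ (spart e a) = fun n => if (8 < n)%N == e then crd n a else 0.
Hypothesis crd_elt : forall F,
  crd^~ (elt F) = fun n => if (n < 17)%N then F n else 0.
Hypothesis jacobi : forall (b c : bool) (x y z : M), homog b x -> homog c y ->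
  {[ x, {[ y, z ]} ]} =
    {[ {[ x, y ]}, z ]} + (-1 : K) ^+ (b && c) *: {[ y, {[ x, z ]} ]}.
Hypothesis graded : forall (b c : bool) (x y : M), homog b x -> homog c y ->
  homog (b (+) c) {[ x, y ]}.
Hypothesis skew : forall (b c : bool) (x y : M), homog b x -> homog c y ->
  {[ x, y ]} = - ((-1 : K) ^+ (b && c) *: {[ y, x ]}).
Variables (M0 : superalgType K) (crd' : nat -> M0 -> K) (elt' : (nat -> K) -> M0).
Hypothesis crd'_ext : forall a b, (forall n, (n < 17)%N -> crd' n a = crd' n b) -> a = b.
Hypothesis crd'_linear : forall n k a b, crd' n (k *: a + b) = k * crd' n a + crd' n b.
Hypothesis crd'_br : forall a b, crd'^~ {[a, b]} = br_crd true (crd'^~ a) (crd'^~ b).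
Hypothesis crd'_spart : forall e a,
  crd'^~ (spart e a) = fun n => if (8 < n)%N == e then crd' n a else 0.
Hypothesis crd'_elt : forall F,
  crd'^~ (elt' F) = fun n => if (n < 17)%N then F n else 0.

Theorem psl22_main
    (R : realization (psl22_cartan_matrix K))
    (gA : lieSuperType K) (s : generators R gA)
    (gA_def : contragredient psl22_par s)
    (g : lieSuperType K) (pi : gA -> g)
    (g_def : derived_mod_center pi) :
  let x1 := pi (gen_x s 0) in
  let x2 := pi (gen_x s 1) in
  let x3 := pi (gen_x s 2) in
  let x4 := {[ x1, x2 ]} in
  let x5 := {[ x2, x3 ]} in
  let x6 := {[ x3, {[ x1, x2 ]} ]} in
  let y1 := pi (gen_y s 0) in
  let y2 := pi (gen_y s 1) in
  let y3 := pi (gen_y s 2) in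
  let y4 := {[ y1, y2 ]} in
  let y5 := {[ y2, y3 ]} in
  let y6 := {[ y3, {[ y1, y2 ]} ]} in
  let torus : set g :=
    [set t | exists h, derived (gen_h s h) /\ t = pi (gen_h s h)] in
  let root_vectors :=
    [tuple x1; x2; x3; x4; x5; x6; y1; y2; y3; y4; y5; y6] in
  let B : set g := [set u | u \in (root_vectors : seq g) \/ torus u] in
  basis_mod [set: g] torus root_vectors /\
  (exists D4 D0 theta theta' : {linear g -> g},
    [/\ given_by B [:: (x2, y6); (x4, - y5); (x5, - y4); (x6, y2)] D4,
        given_by B [:: (x2, x2); (x3, - x3); (x4, x4);
                       (y2, - y2); (y3, y3); (y4, - y4)] D0,
        [/\ superhom theta, cancel theta theta', cancel theta' theta,
            [/\ theta x1 = y1, theta x2 = y2 & theta x3 = y3] &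
            [/\ theta y1 = x1, theta y2 = - x2 & theta y3 = x3]] &
        basis_mod [set D : g -> g | is_der D] [set D : g -> g | is_inner D]
          [tuple (D4 : g -> g); (D0 : g -> g); theta \o D4 \o theta']]) /\
  superiso (der g) M /\
  (exists (x2y2 x3y3 x4y4 y2y6 y4y5 x2x6 x4x5 : g -> g -> K^o)
          (w1 w2 w3 : {bilinear g -> g -> K^o}),
    [/\ [/\ is_wedge B x2 y2 x2y2, is_wedge B x3 y3 x3y3 &
            is_wedge B x4 y4 x4y4] /\
        [/\ is_wedge B y2 y6 y2y6, is_wedge B y4 y5 y4y5,
            is_wedge B x2 x6 x2x6 & is_wedge B x4 x5 x4x5],
        [/\ (w1 : g -> g -> K^o) = x2y2 + x3y3 - x4y4,
            (w2 : g -> g -> K^o) = y2y6 + y4y5 &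
            (w3 : g -> g -> K^o) = x2x6 + x4x5],
        basis_mod [set w : g -> g -> K^o | is_cocycle w]
          [set w : g -> g -> K^o | is_coboundary w]
          [tuple (w1 : g -> g -> K^o); (w2 : g -> g -> K^o);
                 (w3 : g -> g -> K^o)] &
        superiso (centext [tuple w1; w2; w3]) M0]).
Proof.
have [F [F_hom F_inj F_surj F_car]] := contragredient_gl gA_def.
move=> x1 x2 x3 x4 x5 x6 y1 y2 y3 y4 y5 y6 torus.
pose Psi := psl_emb_lin two0 crd_ext crd_linear crd_elt F_hom F_inj F_surj g_def.
have Psi_hom : superhom Psi.
  have := psl_emb_hom two0 crd_ext crd_linear crd_br crd_spart crd_elt F_hom F_inj F_surj g_def. by apply.
have Psi_inj : injective Psi.
  by have := psl_emb_inj two0 crd_ext crd_linear crd_elt F_hom F_inj F_surj g_def; apply.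
have Psi_im a : (exists u, Psi u = a) <-> in_psl crd a.
  by have := psl_emb_im two0 crd_ext crd_linear crd_elt F_hom F_inj F_surj g_def a; apply.
have xy := psl_emb_xy two0 crd_ext crd_linear crd_elt F_hom F_inj F_surj F_car g_def.
have rootE i w a b : (i < 12)%N -> psl_emb elt F pi w = rho elt (unit_mx K a b) ->
    (forall n, (n < 17)%N ->
      rho_crd (unit_mx K a b) n = nth 0 (root_coef K) i * (n == nth 0%N root_idx i)%:R) ->
    w = root_vec Psi crd elt i.
  move=> hi hw h; apply: Psi_inj; apply: crd_ext => n n17.
  rewrite (crd_root_vec crd_ext crd_linear crd_elt Psi_im) // -h //.
  by rewrite -[Psi w]/(psl_emb elt F pi w) hw (crd_rho crd_elt).
have hx : [/\ x1 = root_vec Psi crd elt 0, x2 = root_vec Psi crd elt 1 & x3 = root_vec Psi crd elt 2].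
  split; (apply: rootE; [by []|exact: (xy _).1|]);
  by do 17?[case=> [|]] => // _; rewrite /rho_crd /= ?ent_unit /=; field; rewrite ?two0.
have hy : [/\ y1 = root_vec Psi crd elt 6, y2 = root_vec Psi crd elt 7 & y3 = root_vec Psi crd elt 8].
  split; (apply: rootE; [by []|exact: (xy _).2|]);
  by do 17?[case=> [|]] => // _; rewrite /rho_crd /= ?ent_unit /=; field; rewrite ?two0.
have [[b1 b2 b3] [b4 b5 b6]] := root_brackets two0 crd_ext crd_linear crd_br crd_elt Psi_hom Psi_inj Psi_im.
have hx' : [/\ x4 = root_vec Psi crd elt 3, x5 = root_vec Psi crd elt 4 & x6 = root_vec Psi crd elt 5].
  by case: hx => h1 h2 h3; rewrite /x4 /x5 /x6 h1 h2 h3 b1 b2 b3.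
have hy' : [/\ y4 = root_vec Psi crd elt 9, y5 = root_vec Psi crd elt 10 & y6 = root_vec Psi crd elt 11].
  by case: hy => h1 h2 h3; rewrite /y4 /y5 /y6 h1 h2 h3 b4 b5 b6.
have torusE : torus = torus_psl Psi crd.
  apply/seteqP; split=> w.
    exact: (psl_emb_torus two0 crd_ext crd_linear crd_elt F_hom F_inj F_surj F_car g_def w).1.
  exact: (psl_emb_torus two0 crd_ext crd_linear crd_elt F_hom F_inj F_surj F_car g_def w).2.
rewrite torusE.
exact: (psl_cohomology two0 crd_ext crd_linear crd_br crd_spart crd_elt jacobi graded skew
  Psi_hom Psi_inj Psi_im crd'_ext crd'_linear crd'_br crd'_spart crd'_elt hx hx' hy hy').
Qed.
End Assembly.

Lemma osp_crd_elt (K : fieldType) (z : bool) (F : nat -> K) :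
  osp_crd^~ (osp_of z F) = fun n => if (n < 17)%N then F n else 0.
Proof.
apply: funext => n; case: ltnP => n17; first exact: osp_crd_of.
by do 17?[case: n n17 => [|n] // n17].
Qed.

Lemma two_neq0 (K : fieldType) p : p \in [pchar K] -> p != 2%N -> (2 : K) != 0.
Proof.
move=> hp p2; apply/negP => h; have : 2%N \in [pchar K] by rewrite inE /= h.
by rewrite (pcharf_eq hp) inE eq_sym (negPf p2).
Qed.

Theorem lemma2p19 (K : closedFieldType) (p : nat)
    (p_char : p \in [pchar K]) (p_neq2 : p != 2%N)
    (R : realization (psl22_cartan_matrix K))
    (gA : lieSuperType K) (s : generators R gA)
    (gA_def : contragredient psl22_par s)
    (g : lieSuperType K) (pi : gA -> g)
    (g_def : derived_mod_center pi) :
  let x1 := pi (gen_x s 0) in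
  let x2 := pi (gen_x s 1) in
  let x3 := pi (gen_x s 2) in
  let x4 := {[ x1, x2 ]} in
  let x5 := {[ x2, x3 ]} in
  let x6 := {[ x3, {[ x1, x2 ]} ]} in
  let y1 := pi (gen_y s 0) in
  let y2 := pi (gen_y s 1) in
  let y3 := pi (gen_y s 2) in
  let y4 := {[ y1, y2 ]} in
  let y5 := {[ y2, y3 ]} in
  let y6 := {[ y3, {[ y1, y2 ]} ]} in
  let torus : set g :=
    [set t | exists h, derived (gen_h s h) /\ t = pi (gen_h s h)] in
  let root_vectors :=
    [tuple x1; x2; x3; x4; x5; x6; y1; y2; y3; y4; y5; y6] in
  let B : set g := [set u | u \in (root_vectors : seq g) \/ torus u] in
  basis_mod [set: g] torus root_vectors /\
  (exists D4 D0 theta theta' : {linear g -> g},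
    [/\ given_by B [:: (x2, y6); (x4, - y5); (x5, - y4); (x6, y2)] D4,
        given_by B [:: (x2, x2); (x3, - x3); (x4, x4);
                       (y2, - y2); (y3, y3); (y4, - y4)] D0,
        [/\ superhom theta, cancel theta theta', cancel theta' theta,
            [/\ theta x1 = y1, theta x2 = y2 & theta x3 = y3] &
            [/\ theta y1 = x1, theta y2 = - x2 & theta y3 = x3]] &
        basis_mod [set D : g -> g | is_der D] [set D : g -> g | is_inner D]
          [tuple (D4 : g -> g); (D0 : g -> g); theta \o D4 \o theta']]) /\
  superiso (der g) (osp_m1 K) /\
  (exists (x2y2 x3y3 x4y4 y2y6 y4y5 x2x6 x4x5 : g -> g -> K^o)
          (w1 w2 w3 : {bilinear g -> g -> K^o}),
    [/\ [/\ is_wedge B x2 y2 x2y2, is_wedge B x3 y3 x3y3 &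
            is_wedge B x4 y4 x4y4] /\
        [/\ is_wedge B y2 y6 y2y6, is_wedge B y4 y5 y4y5,
            is_wedge B x2 x6 x2x6 & is_wedge B x4 x5 x4x5],
        [/\ (w1 : g -> g -> K^o) = x2y2 + x3y3 - x4y4,
            (w2 : g -> g -> K^o) = y2y6 + y4y5 &
            (w3 : g -> g -> K^o) = x2x6 + x4x5],
        basis_mod [set w : g -> g -> K^o | is_cocycle w]
          [set w : g -> g -> K^o | is_coboundary w]
          [tuple (w1 : g -> g -> K^o); (w2 : g -> g -> K^o);
                 (w3 : g -> g -> K^o)] &
        superiso (centext [tuple w1; w2; w3]) (osp_0 K)]).
Proof.
have two0 := two_neq0 p_char p_neq2.
have H := @psl22_main K (osp_m1 K) osp_crd (@osp_of K false) two0 (@osp_crd_ext K false)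
  (@osp_crd_linear K false) (@osp_crd_br K false) (@osp_crd_spart K false)
  (@osp_crd_elt K false) (@osp_jacobi K) (@osp_graded K) (@osp_skew K)
  (osp_0 K) osp_crd (@osp_of K true) (@osp_crd_ext K true) (@osp_crd_linear K true)
  (@osp_crd_br K true) (@osp_crd_spart K true) (@osp_crd_elt K true)
  R gA s gA_def g pi g_def.
exact: H.
Qed.
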